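(* Let $\mathcal{C}$ and $\mathcal{X}$ be two $\Lambda$-bounded filtered cospans over a field $\kappa$ that are of finite type. Then $d_B(\mathcal{D}(\mathcal{X}),\mathcal{D}(\mathcal{C}))=d_{\mathrm{int}}(\mathcal{X},\mathcal{C}).$
   Context: Fix a field $\kappa$, $\Lambda>0$, and an increasing homeomorphism $\varphi\colon[-\infty,\infty]\to[-\Lambda,\Lambda]$; for $s\in\mathbb{R}$ let $\rho_s(t)=\varphi(s+\varphi^{-1}(t))$ on $[-\Lambda,\Lambda]$. Filtered cospans and $\mathsf{HCO}$: An ascending chain complex over $\kappa$ is $(C_*,\partial,\ell)$ with $(C_*=\bigoplus_kC_k,\partial)$ a chain complex of $\kappa$-vector spaces and $\ell\colon C_*\to\mathbb{R}\cup\{-\infty\}$ with $\ell(x)=-\infty$ iff $x=0$, $\ell(\sum c_ix_i)\le\max\{\ell(x_i):c_i\ne0\}$ (equality if the $x_i$ lie in distinct degrees), $\ell(\partial x)\le\ell(x)$. A descending complex is $(C_*,\partial,\ell)$ with $\ell\colon C_*\to\mathbb{R}\cup\{+\infty\}$ and $(C_*,\partial,-\ell)$ ascending. A filtered cospan is $\mathcal{C}=((C_{\uparrow*},\partial^C_\uparrow,\ell^C_\uparrow),(C^\downarrow_*,\partial^\downarrow_C,\ell^\downarrow_C),(D_*,\partial_D),\psi_\uparrow,\psi^\downarrow)$ with chain maps $\psi_\uparrow\colon C_{\uparrow*}\to D_*$, $\psi^\downarrow\colon C^\downarrow_*\to D_*$. It is $\Lambda$-bounded if $\ell^C_\uparrow$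 and $\ell^\downarrow_C$ take values in $(-\Lambda,\Lambda)$ on nonzero elements; it is of finite type if it is isomorphic in $\mathsf{HCO}(\kappa)$ to one in which $C_{\uparrow*},C^\downarrow_*,D_*$ are finite-dimensional. For $\mathcal{X}=((X_{\uparrow*},\partial^X_\uparrow,\ell^X_\uparrow),(X^\downarrow_*,\partial^\downarrow_X,\ell^\downarrow_X),(Y_*,\partial_Y),\phi_\uparrow,\phi^\downarrow)$, a degree-$m$ morphism $\mathcal{C}\to\mathcal{X}$ in the dg-category $\mathsf{CO}(\kappa)$ is a quintuple $(\alpha^\downarrow,\alpha_\uparrow,\alpha,K^\downarrow,K_\uparrow)$ of linear maps $\alpha^\downarrow\colon C^\downarrow_*\to X^\downarrow_{*-m}$, $\alpha_\uparrow\colon C_{\uparrow*}\to X_{\uparrow*-m}$, $\alpha\colon D_*\to Y_{*-m}$, $K^\downarrow\colon C^\downarrow_*\to Y_{*-m+1}$, $K_\uparrow\colon C_{\uparrow*}\to Y_{*-m+1}$ with $\ell^X_\uparrow\circ\alpha_\uparrow\le\ell^C_\uparrow$ and $\ell^\downarrow_X\circ\alpha^\downarrow\ge\ell^\downarrow_C$; composition $(\beta^\downarrow,\beta_\uparrow,\beta,L^\downarrow,L_\uparrow)\circ(\alpha^\downarrow,\alpha_\uparrow,\alpha,K^\downarrow,K_\uparrow)=(\beta^\downarrow\alpha^\downarrow,\beta_\uparrow\alpha_\uparrow,\beta\alpha,L^\downarrow\alpha^\downarrow+\beta K^\downarrow,L_\uparrow\alpha_\uparrow+\beta K_\uparrow)$;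 differential $\delta(\alpha^\downarrow,\alpha_\uparrow,\alpha,K^\downarrow,K_\uparrow)=(-\partial^\downarrow_X\alpha^\downarrow+(-1)^m\alpha^\downarrow\partial^\downarrow_C,\ -\partial^X_\uparrow\alpha_\uparrow+(-1)^m\alpha_\uparrow\partial^C_\uparrow,\ \partial_Y\alpha-(-1)^m\alpha\partial_D,\ \phi^\downarrow\alpha^\downarrow-(-1)^m\alpha\psi^\downarrow+\partial_YK^\downarrow+(-1)^mK^\downarrow\partial^\downarrow_C,\ \phi_\uparrow\alpha_\uparrow-(-1)^m\alpha\psi_\uparrow+\partial_YK_\uparrow+(-1)^mK_\uparrow\partial^C_\uparrow)$. $\mathsf{HCO}(\kappa)$ has the same objects and morphisms $H^0(\mathrm{Hom}^*_{\mathsf{CO}(\kappa)}(\mathcal{C},\mathcal{X}),\delta)$. Interleaving distance on cospans: for $\epsilon\ge0$, $\mathcal{T}_\epsilon\mathcal{C}$ is $\mathcal{C}$ with $\ell^C_\uparrow$ replaced by $\rho_{-\epsilon}\circ\ell^C_\uparrow$ and $\ell^\downarrow_C$ by $\rho_\epsilon\circ\ell^\downarrow_C$ (on nonzero elements); $\mathcal{T}_\epsilon$ acts as the identity on morphisms (a morphism $\mathcal{X}\to\mathcal{T}_\epsilon\mathcal{C}$ is then also a morphism $\mathcal{T}_\epsilon\mathcal{X}\to\mathcal{T}_{2\epsilon}\mathcal{C}$). Let $\eta^{2\epsilon}_{\mathcal{C}}\colon\mathcal{C}\to\mathcal{T}_{2\epsilon}\mathcal{C}$ be the class of $(1,1,1,0,0)$.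 An $\epsilon$-interleaving is a pair of morphisms $a\colon\mathcal{C}\to\mathcal{T}_\epsilon\mathcal{X}$, $b\colon\mathcal{X}\to\mathcal{T}_\epsilon\mathcal{C}$ in $\mathsf{HCO}(\kappa)$ with $\mathcal{T}_\epsilon(b)\circ a=\eta^{2\epsilon}_{\mathcal{C}}$ and $\mathcal{T}_\epsilon(a)\circ b=\eta^{2\epsilon}_{\mathcal{X}}$; $d_{\mathrm{int}}(\mathcal{X},\mathcal{C})$ is the infimum of $\epsilon>0$ admitting one ($\infty$ if none). The strip: $\mathbb{M}=\{(x,y):-2\Lambda\le x+y\le2\Lambda\}$, $(x,y)\preceq(x',y')$ iff $x\ge x'$, $y\le y'$, $\partial\mathbb{M}=\{|x+y|=2\Lambda\}$, $T(x,y)=(-2\Lambda-y,2\Lambda-x)$, $S=(-\Lambda,\Lambda]\times[-\Lambda,\Lambda)$, $L=\{x+y\ge-2\Lambda,x\le-\Lambda,y<\Lambda\}$, $A=\{x+y\le2\Lambda,x>-\Lambda,y\ge\Lambda\}$; $\mathbb{M}=\bigsqcup_kT^k(S\sqcup L\sqcup A)$. Flow: $\mathcal{T}^{\mathbb{M}}_\epsilon(T^k(x,y))=T^k(\rho_{-\epsilon}(x),\rho_\epsilon(y))$ for $(x,y)\in S$; $T^k(-2\Lambda-\rho_\epsilon(-2\Lambda-x),\rho_\epsilon(y))$ for $(x,y)\in L$; $T^k(\rho_{-\epsilon}(x),2\Lambda-\rho_{-\epsilon}(2\Lambda-y))$ for $(x,y)\in A$. $d_{\mathbb{M}}(v,w)=\inf\{\epsilon>0:v\preceq\mathcal{T}^{\mathbb{M}}_\epsilon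 w,\ w\preceq\mathcal{T}^{\mathbb{M}}_\epsilon v\}$. For multisets $P,Q$ of points of $\mathbb{M}\setminus\partial\mathbb{M}$, an $\epsilon$-matching relative to $\partial\mathbb{M}$ consists of submultisets $P'\subset P$, $Q'\subset Q$ such that every point of $(P\setminus P')\cup(Q\setminus Q')$ is within $d_{\mathbb{M}}$-distance $\le\epsilon$ of some point of $\partial\mathbb{M}$, and a bijection $f\colon P'\to Q'$ with $d_{\mathbb{M}}(x,f(x))\le\epsilon$; $d_B(P,Q)$ is the infimum of such $\epsilon\ge0$. Persistence diagram: a finite-type $\Lambda$-bounded cospan is isomorphic in $\mathsf{HCO}(\kappa)$ to a direct sum of standard elementary summands, with multiplicities uniquely determined. The standard elementary summands (writing a cospan as [$C^\downarrow$; $D$; $C_\uparrow$], all maps between copies of $\kappa$ the identity, others zero; $\mathcal{E}_k(a,b)_\uparrow$ = $\kappa$ in degrees $k,k+1$ with identity differential and filtration values $a$ (degree $k$), $b$ (degree $k+1$); $\mathcal{E}_k(c,\infty)_\uparrow$ = $\kappa$ in degree $k$ at level $c$; $\mathcal{E}_k(a,b)^\downarrow$ = $\mathcal{E}_k(-a,-b)_\uparrow$ with negated filtration; $\kappa_k$ = $\kappa$ in degree $k$) are: $(\uparrow_a^b)_k=[0;0;\mathcal{E}_k(a,b)_\uparrow]$ ($a<b$), $(\downarrow^a_b)_k=[\mathcal{E}_k(a,b)^\downarrow;0;0]$ ($a>b$), $(\uparrow_a^\infty)_k=[0;0;\mathcal{E}_k(a,\infty)_\uparrow]$, $(\downarrow^a_{-\infty})_k=[\mathcal{E}_k(a,-\infty)^\downarrow;0;0]$,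 $(>_b^a)_k=[\mathcal{E}_k(a,-\infty)^\downarrow;\kappa_k;\mathcal{E}_k(b,\infty)_\uparrow]$, $(\searrow^a)_k=[\mathcal{E}_k(a,-\infty)^\downarrow;\kappa_k;0]$, $(\nearrow_a)_k=[0;\kappa_k;\mathcal{E}_k(a,\infty)_\uparrow]$, $\square_k=[0;\kappa_k;0]$ (parameters in $(-\Lambda,\Lambda)$). To these assign points of $\mathbb{M}\setminus\partial\mathbb{M}$: $(\uparrow_a^b)_k\mapsto T^{-k-1}(-2\Lambda-a,b)$; $(\uparrow_a^\infty)_k\mapsto T^{-k}(\Lambda,a)$; $(\nearrow_a)_k\mapsto T^{-k}(-\Lambda,a)$; $(\downarrow^a_b)_k\mapsto T^{-k-1}(b,2\Lambda-a)$; $(\downarrow^a_{-\infty})_k\mapsto T^{-k}(a,-\Lambda)$; $(\searrow^a)_k\mapsto T^{-k}(a,\Lambda)$; $(>_b^a)_k\mapsto T^{-k}(a,b)$; $\square_k\mapsto T^{-k+1}(\Lambda,-\Lambda)$. The persistence diagram $\mathcal{D}(\mathcal{C})$ is the multiset of the points assigned to the summands in such a decomposition, counted with multiplicity. *)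

(* Defs.v *)
From HB Require Import structures.
From mathcomp Require Import all_boot all_order all_algebra.
From mathcomp Require Import all_classical all_reals.
From mathcomp Require Import topology normedtype ereal.
Import numFieldNormedType.Exports.

Unset Printing Implicit Defensive.

Import Order.TTheory GRing.Theory Num.Theory.
Local Open Scope ring_scope.
Local Open Scope classical_set_scope.
Local Open Scope ring_scope.

(* A graded space C_* = (+)_k C_k is a kappa-vector space V together   *)
(* with the degree projections pr k : V -> C_k (a subspace of V).      *)

Record gcx (K : fieldType) := GCx {
  gsp : lmodType K;
  gpr : int -> gsp -> gsp;
  gbd : gsp -> gsp           (* differential, of degree -1 *)
}.
Arguments gsp {K} g.
Arguments gpr {K} g _ _.
Arguments gbd {K} g _.

Definition lin {K : fieldType} {V W : lmodType K} (f : V -> W) :=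
  forall (a : K) (u v : V), f (a *: u + v) = a *: f u + f v.

Definition gdeg {K : fieldType} (A B : gcx K) (m : int) (f : gsp A -> gsp B) :=
  lin f /\ forall (k : int) (x : gsp A), gpr B (k - m) (f (gpr A k x)) = f (gpr A k x).

Definition graded {K : fieldType} (A : gcx K) :=
  (forall k, lin (gpr A k)) /\
  (forall (j k : int) x, gpr A j (gpr A k x) = if j == k then gpr A k x else 0%R) /\
  (forall x, exists s : seq int,
      [/\ uniq s, x = (\sum_(k <- s) gpr A k x)%R
        & forall k, k \notin s -> gpr A k x = 0%R]).

Definition chain_complex {K : fieldType} (A : gcx K) :=
  graded A /\ gdeg A A 1 (gbd A) /\ (forall x, gbd A (gbd A x) = 0%R).

Definition ascending {K : fieldType} {R : realType} {A : gcx K}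
    (l : gsp A -> \bar R) :=
  [/\ forall x, (l x == -oo%E) = (x == 0%R),
      forall x, l x != +oo%E,
      forall (n : nat) (c : 'I_n -> K) (x : 'I_n -> gsp A),
        (l (\sum_(i < n) c i *: x i)%R <= \big[Order.max/-oo%E]_(i < n | c i != 0%R) l (x i))%E,
      forall (n : nat) (c : 'I_n -> K) (x : 'I_n -> gsp A) (dg : 'I_n -> int),
        injective dg -> (forall i, gpr A (dg i) (x i) = x i) ->
        l (\sum_(i < n) c i *: x i)%R = \big[Order.max/-oo%E]_(i < n | c i != 0%R) l (x i)
    & forall x, (l (gbd A x) <= l x)%E].

Definition descending {K : fieldType} {R : realType} {A : gcx K}
    (l : gsp A -> \bar R) := ascending (fun x => (- l x)%E).

Record cospan (K : fieldType) (R : realType) := Cospan {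
  Cup : gcx K;  lup : gsp Cup -> \bar R;
  Cdn : gcx K;  ldn : gsp Cdn -> \bar R;
  Dm  : gcx K;
  psiUp : gsp Cup -> gsp Dm;
  psiDn : gsp Cdn -> gsp Dm
}.
Arguments Cup {K R} c.  Arguments Cdn {K R} c.  Arguments Dm {K R} c.
Arguments lup {K R} c _.  Arguments ldn {K R} c _.
Arguments psiUp {K R} c _.  Arguments psiDn {K R} c _.

Definition is_cospan {K : fieldType} {R : realType} (C : cospan K R) :=
  [/\ chain_complex (Cup C) /\ chain_complex (Cdn C) /\ chain_complex (Dm C),
      ascending (lup C) /\ descending (ldn C),
      gdeg (Cup C) (Dm C) 0 (psiUp C) /\ gdeg (Cdn C) (Dm C) 0 (psiDn C)
    & (forall x, psiUp C (gbd (Cup C) x) = gbd (Dm C) (psiUp C x)) /\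
      (forall x, psiDn C (gbd (Cdn C) x) = gbd (Dm C) (psiDn C x))].

Definition bounded {K : fieldType} {R : realType} (Lam : R) (C : cospan K R) :=
  (forall x, x != 0%R -> ((- Lam)%:E < lup C x < Lam%:E)%E) /\
  (forall x, x != 0%R -> ((- Lam)%:E < ldn C x < Lam%:E)%E).

Record mor (K : fieldType) (R : realType) (C X : cospan K R) := Mor {
  mDn : gsp (Cdn C) -> gsp (Cdn X);
  mUp : gsp (Cup C) -> gsp (Cup X);
  mD  : gsp (Dm C) -> gsp (Dm X);
  mKDn : gsp (Cdn C) -> gsp (Dm X);
  mKUp : gsp (Cup C) -> gsp (Dm X)
}.
Arguments mDn {K R C X} m _.  Arguments mUp {K R C X} m _.  Arguments mD {K R C X} m _.
Arguments mKDn {K R C X} m _.  Arguments mKUp {K R C X} m _.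
Arguments Mor {K R C X} _ _ _ _ _.
Arguments mor {K R} C X.

Definition is_mor {K : fieldType} {R : realType} (m : int) (C X : cospan K R)
    (f : mor C X) :=
  [/\ gdeg (Cdn C) (Cdn X) m (mDn f), gdeg (Cup C) (Cup X) m (mUp f),
      gdeg (Dm C) (Dm X) m (mD f),
      gdeg (Cdn C) (Dm X) (m - 1) (mKDn f) /\ gdeg (Cup C) (Dm X) (m - 1) (mKUp f)
    & (forall x, (lup X (mUp f x) <= lup C x)%E) /\
      (forall x, (ldn C x <= ldn X (mDn f x))%E)].

Definition comp {K : fieldType} {R : realType} {C X Y : cospan K R}
    (g : mor X Y) (f : mor C X) : mor C Y :=
  Mor (fun x => mDn g (mDn f x)) (fun x => mUp g (mUp f x)) (fun x => mD g (mD f x))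
      (fun x => mKDn g (mDn f x) + mD g (mKDn f x))%R
      (fun x => mKUp g (mUp f x) + mD g (mKUp f x))%R.

Definition idm {K : fieldType} {R : realType} (C X : cospan K R)
    (e1 : gsp (Cdn C) -> gsp (Cdn X)) (e2 : gsp (Cup C) -> gsp (Cup X))
    (e3 : gsp (Dm C) -> gsp (Dm X)) : mor C X :=
  Mor e1 e2 e3 (fun _ => 0%R) (fun _ => 0%R).

Definition delta {K : fieldType} {R : realType} (m : int) {C X : cospan K R}
    (f : mor C X) : mor C X :=
  let sg := ((-1 : K) ^ m)%R in
  Mor (fun x => - gbd (Cdn X) (mDn f x) + sg *: mDn f (gbd (Cdn C) x))%R
      (fun x => - gbd (Cup X) (mUp f x) + sg *: mUp f (gbd (Cup C) x))%R
      (fun x => gbd (Dm X) (mD f x) - sg *: mD f (gbd (Dm C) x))%R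
      (fun x => psiDn X (mDn f x) - sg *: mD f (psiDn C x)
                + gbd (Dm X) (mKDn f x) + sg *: mKDn f (gbd (Cdn C) x))%R
      (fun x => psiUp X (mUp f x) - sg *: mD f (psiUp C x)
                + gbd (Dm X) (mKUp f x) + sg *: mKUp f (gbd (Cup C) x))%R.

Definition meq {K : fieldType} {R : realType} {C X : cospan K R} (f g : mor C X) :=
  [/\ forall x, mDn f x = mDn g x, forall x, mUp f x = mUp g x,
      forall x, mD f x = mD g x, forall x, mKDn f x = mKDn g x
    & forall x, mKUp f x = mKUp g x].

Definition msub {K : fieldType} {R : realType} {C X : cospan K R} (f g : mor C X) :
    mor C X :=
  Mor (fun x => mDn f x - mDn g x)%R (fun x => mUp f x - mUp g x)%R
      (fun x => mD f x - mD g x)%R (fun x => mKDn f x - mKDn g x)%R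
      (fun x => mKUp f x - mKUp g x)%R.

Definition mzero {K : fieldType} {R : realType} (C X : cospan K R) : mor C X :=
  Mor (fun _ => 0%R) (fun _ => 0%R) (fun _ => 0%R) (fun _ => 0%R) (fun _ => 0%R).

(* degree-0 cocycles: representatives of morphisms of HCO(kappa) *)
Definition hco_rep {K : fieldType} {R : realType} (C X : cospan K R) (f : mor C X) :=
  is_mor 0 C X f /\ meq (delta 0 f) (mzero C X).

(* equality of classes in H^0 : f - g = delta h for a degree -1 morphism h *)
Definition htpc {K : fieldType} {R : realType} (C X : cospan K R) (f g : mor C X) :=
  exists h : mor C X, is_mor (-1) C X h /\ meq (msub f g) (delta (-1) h).

Definition hco_iso {K : fieldType} {R : realType} (C X : cospan K R) :=
  exists (f : mor C X) (g : mor X C),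
    [/\ hco_rep C X f, hco_rep X C g,
        htpc C C (comp g f) (idm C C id id id)
      & htpc X X (comp f g) (idm X X id id id)].

Definition fin_dim {K : fieldType} (V : lmodType K) :=
  exists (n : nat) (b : 'I_n -> V),
    forall v : V, exists c : 'I_n -> K, v = (\sum_(i < n) c i *: b i)%R.

Definition finite_type {K : fieldType} {R : realType} (C : cospan K R) :=
  exists Y : cospan K R,
    [/\ is_cospan Y, fin_dim (gsp (Cup Y)), fin_dim (gsp (Cdn Y)),
        fin_dim (gsp (Dm Y)) & hco_iso C Y].

Definition incr_homeo {R : realType} (Lam : R) (phi : \bar R -> R)
    (phiinv : R -> \bar R) :=
  [/\ {homo phi : x y / (x < y)%E >-> (x < y)%R},
      phi -oo%E = (- Lam)%R /\ phi +oo%E = Lam,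
      continuous phi,
      (forall x, phiinv (phi x) = x) /\
      (forall t : R, (- Lam <= t <= Lam)%R -> phi (phiinv t) = t)
    & {within `[(- Lam)%R, Lam], continuous phiinv}].

Definition rho {R : realType} (phi : \bar R -> R) (phiinv : R -> \bar R) (s t : R) : R :=
  phi (s%:E + phiinv t)%E.

Definition Tsh {K : fieldType} {R : realType} (phi : \bar R -> R)
    (phiinv : R -> \bar R) (e : R) (C : cospan K R) : cospan K R :=
  @Cospan K R
    (Cup C) (fun x => if x == 0%R then -oo%E else (rho phi phiinv (- e) (fine (lup C x)))%:E)
    (Cdn C) (fun x => if x == 0%R then +oo%E else (rho phi phiinv e (fine (ldn C x)))%:E)
    (Dm C) (psiUp C) (psiDn C).

(* a morphism X -> T_e C seen as a morphism T_e X -> T_(2e) C = T_e T_e C *)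
Definition Tmor {K : fieldType} {R : realType} (phi : \bar R -> R)
    (phiinv : R -> \bar R) (e : R) {X C : cospan K R}
    (b : mor X (Tsh phi phiinv e C)) :
    mor (Tsh phi phiinv e X) (Tsh phi phiinv (2 * e) C) :=
  @Mor K R (Tsh phi phiinv e X) (Tsh phi phiinv (2 * e) C)
    (mDn b) (mUp b) (mD b) (mKDn b) (mKUp b).

Definition interleaving {K : fieldType} {R : realType} (phi : \bar R -> R)
    (phiinv : R -> \bar R) (e : R) (C X : cospan K R) :=
  exists (a : mor C (Tsh phi phiinv e X)) (b : mor X (Tsh phi phiinv e C)),
    [/\ hco_rep C (Tsh phi phiinv e X) a, hco_rep X (Tsh phi phiinv e C) b,
        htpc C (Tsh phi phiinv (2 * e) C)
          (comp (Tmor phi phiinv e b) a) (idm C (Tsh phi phiinv (2 * e) C) id id id)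
      & htpc X (Tsh phi phiinv (2 * e) X)
          (comp (Tmor phi phiinv e a) b) (idm X (Tsh phi phiinv (2 * e) X) id id id)].

Definition dint {K : fieldType} {R : realType} (phi : \bar R -> R)
    (phiinv : R -> \bar R) (X C : cospan K R) : \bar R :=
  ereal_inf [set e%:E | e in [set e : R | (0 < e)%R /\ interleaving phi phiinv e C X]].

Local Open Scope ring_scope.

Definition Tst {R : realType} (Lam : R) (v : R * R) : R * R :=
  (- (2 * Lam) - v.2, 2 * Lam - v.1).
Definition Tstinv {R : realType} (Lam : R) (v : R * R) : R * R :=
  (2 * Lam - v.2, - (2 * Lam) - v.1).
Definition Tpow {R : realType} (Lam : R) (k : int) (v : R * R) : R * R :=
  match k with
  | Posz n => iter n (Tst Lam) v
  | Negz n => iter n.+1 (Tstinv Lam) v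
  end.

Definition inM {R : realType} (Lam : R) (v : R * R) := `|v.1 + v.2| <= 2 * Lam.
Definition bdM {R : realType} (Lam : R) (v : R * R) := `|v.1 + v.2| = 2 * Lam.
Definition Sreg {R : realType} (Lam : R) (v : R * R) :=
  [/\ - Lam < v.1, v.1 <= Lam, - Lam <= v.2 & v.2 < Lam].
Definition Lreg {R : realType} (Lam : R) (v : R * R) :=
  [/\ - (2 * Lam) <= v.1 + v.2, v.1 <= - Lam & v.2 < Lam].
Definition Areg {R : realType} (Lam : R) (v : R * R) :=
  [/\ v.1 + v.2 <= 2 * Lam, - Lam < v.1 & Lam <= v.2].

Definition preceq {R : realType} (v w : R * R) := w.1 <= v.1 /\ v.2 <= w.2.

Definition flowM {R : realType} (Lam : R) (phi : \bar R -> R)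
    (phiinv : R -> \bar R) (e : R) (v : R * R) : R * R :=
  let rh := rho phi phiinv in
  xget v [set z | exists (k : int) (u : R * R), v = Tpow Lam k u /\
    [\/ Sreg Lam u /\ z = Tpow Lam k (rh (- e) u.1, rh e u.2),
        Lreg Lam u /\ z = Tpow Lam k (- (2 * Lam) - rh e (- (2 * Lam) - u.1), rh e u.2)
      | Areg Lam u /\ z = Tpow Lam k (rh (- e) u.1, 2 * Lam - rh (- e) (2 * Lam - u.2))]].

Definition dM {R : realType} (Lam : R) (phi : \bar R -> R)
    (phiinv : R -> \bar R) (v w : R * R) : \bar R :=
  ereal_inf [set e%:E | e in [set e : R | 0 < e /\
     preceq v (flowM Lam phi phiinv e w) /\ preceq w (flowM Lam phi phiinv e v)]].

Definition near_bd {R : realType} (Lam : R) (phi : \bar R -> R)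
    (phiinv : R -> \bar R) (e : R) (p : R * R) :=
  exists b : R * R, bdM Lam b /\ (dM Lam phi phiinv p b <= e%:E)%E.

(* e-matching relative to the boundary between finite multisets P, Q
   (given as sequences): a partial injection f from P to Q *)
Definition matching {R : realType} (Lam : R) (phi : \bar R -> R)
    (phiinv : R -> \bar R) (e : R) (P Q : seq (R * R)) :=
  exists f : 'I_(size P) -> option 'I_(size Q),
    [/\ forall i i' j, f i = Some j -> f i' = Some j -> i = i',
        forall i j, f i = Some j ->
          (dM Lam phi phiinv (nth (0%R, 0%R) P i) (nth (0%R, 0%R) Q j) <= e%:E)%E,
        forall i, f i = None -> near_bd Lam phi phiinv e (nth (0%R, 0%R) P i)
      & forall j : 'I_(size Q), (forall i, f i <> Some j) ->
          near_bd Lam phi phiinv e (nth (0%R, 0%R) Q j)].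

Definition dB {R : realType} (Lam : R) (phi : \bar R -> R)
    (phiinv : R -> \bar R) (P Q : seq (R * R)) : \bar R :=
  ereal_inf [set e%:E | e in [set e : R | 0 <= e /\ matching Lam phi phiinv e P Q]].

Inductive summand (R : realType) :=
| SUp (k : int) (a b : R)
| SDn (k : int) (a b : R)
| SUpInf (k : int) (a : R)
| SDnInf (k : int) (a : R)
| SGt (k : int) (a b : R)
| SSE (k : int) (a : R)
| SNE (k : int) (a : R)
| SBox (k : int).

Definition valid_summand {R : realType} (Lam : R) (s : summand R) :=
  let inI x := - Lam < x < Lam in
  match s with
  | SUp _ a b => [&& inI a, inI b & a < b]
  | SDn _ a b => [&& inI a, inI b & b < a]
  | SUpInf _ a | SDnInf _ a | SSE _ a | SNE _ a => inI a
  | SGt _ a b => inI a && inI b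
  | SBox _ => true
  end.

Definition pt_summand {R : realType} (Lam : R) (s : summand R) : R * R :=
  match s with
  | SUp k a b => Tpow Lam (- k - 1) (- (2 * Lam) - a, b)
  | SUpInf k a => Tpow Lam (- k) (Lam, a)
  | SNE k a => Tpow Lam (- k) (- Lam, a)
  | SDn k a b => Tpow Lam (- k - 1) (b, 2 * Lam - a)
  | SDnInf k a => Tpow Lam (- k) (a, - Lam)
  | SSE k a => Tpow Lam (- k) (a, Lam)
  | SGt k a b => Tpow Lam (- k) (a, b)
  | SBox k => Tpow Lam (- k + 1) (Lam, - Lam)
  end.

Definition zero_gcx (K : fieldType) : gcx K :=
  @GCx K 'rV[K]_0 (fun _ x => x) (fun _ => 0).

Definition one_gcx (K : fieldType) (k : int) : gcx K :=
  @GCx K 'rV[K]_1 (fun j x => if j == k then x else 0) (fun _ => 0).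

Definition two_gcx (K : fieldType) (k : int) : gcx K :=
  @GCx K ('rV[K]_1 * 'rV[K]_1)%type
    (fun j x => (if j == k then x.1 else 0, if j == k + 1 then x.2 else 0))
    (fun x => (x.2, 0)).

Definition lvl {K : fieldType} {R : realType} {n : nat} (a : R) (x : 'rV[K]_n) : \bar R :=
  if x == 0 then -oo%E else a%:E.

Definition elem_cospan (K : fieldType) {R : realType} (s : summand R) : cospan K R :=
  match s with
  | SUp k a b =>
      @Cospan K R (two_gcx K k) (fun x => Order.max (lvl a x.1) (lvl b x.2))
        (zero_gcx K) (fun _ => +oo%E) (zero_gcx K) (fun _ => 0) (fun _ => 0)
  | SDn k a b =>
      @Cospan K R (zero_gcx K) (fun _ => -oo%E)
        (two_gcx K k) (fun x => - Order.max (lvl (- a) x.1) (lvl (- b) x.2))%E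
        (zero_gcx K) (fun _ => 0) (fun _ => 0)
  | SUpInf k a =>
      @Cospan K R (one_gcx K k) (lvl a)
        (zero_gcx K) (fun _ => +oo%E) (zero_gcx K) (fun _ => 0) (fun _ => 0)
  | SDnInf k a =>
      @Cospan K R (zero_gcx K) (fun _ => -oo%E)
        (one_gcx K k) (fun x => - lvl (- a) x)%E (zero_gcx K) (fun _ => 0) (fun _ => 0)
  | SGt k a b =>
      @Cospan K R (one_gcx K k) (lvl b)
        (one_gcx K k) (fun x => - lvl (- a) x)%E (one_gcx K k) id id
  | SSE k a =>
      @Cospan K R (zero_gcx K) (fun _ => -oo%E)
        (one_gcx K k) (fun x => - lvl (- a) x)%E (one_gcx K k) (fun _ => 0) id
  | SNE k a =>
      @Cospan K R (one_gcx K k) (lvl a)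
        (zero_gcx K) (fun _ => +oo%E) (one_gcx K k) id (fun _ => 0)
  | SBox k =>
      @Cospan K R (zero_gcx K) (fun _ => -oo%E)
        (zero_gcx K) (fun _ => +oo%E) (one_gcx K k) (fun _ => 0) (fun _ => 0)
  end.

Definition zero_cospan (K : fieldType) (R : realType) : cospan K R :=
  @Cospan K R (zero_gcx K) (fun _ => -oo%E) (zero_gcx K) (fun _ => +oo%E)
    (zero_gcx K) (fun _ => 0) (fun _ => 0).

Definition sum_gcx {K : fieldType} (A B : gcx K) : gcx K :=
  @GCx K (gsp A * gsp B)%type (fun j x => (gpr A j x.1, gpr B j x.2))
    (fun x => (gbd A x.1, gbd B x.2)).

Definition sum_cospan {K : fieldType} {R : realType} (C X : cospan K R) : cospan K R :=
  @Cospan K R (sum_gcx (Cup C) (Cup X)) (fun x => Order.max (lup C x.1) (lup X x.2))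
    (sum_gcx (Cdn C) (Cdn X)) (fun x => Order.min (ldn C x.1) (ldn X x.2))
    (sum_gcx (Dm C) (Dm X))
    (fun x => (psiUp C x.1, psiUp X x.2)) (fun x => (psiDn C x.1, psiDn X x.2)).

Definition std_cospan (K : fieldType) {R : realType} (s : seq (summand R)) : cospan K R :=
  foldr (fun t acc => sum_cospan (elem_cospan K t) acc) (zero_cospan K R) s.

Definition is_diagram {K : fieldType} {R : realType} (Lam : R) (C : cospan K R)
    (P : seq (R * R)) :=
  exists s : seq (summand R),
    [/\ all (valid_summand Lam) s, hco_iso C (std_cospan K s)
      & P = map (pt_summand Lam) s].

(* Main.v *)
Require Import Defs.
From HB Require Import structures.
From mathcomp Require Import all_boot all_order all_algebra.
From mathcomp Require Import all_classical all_reals.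
From mathcomp Require Import topology normedtype ereal.
From mathcomp Require Import ring lra zify.
Import numFieldNormedType.Exports.
Import Order.TTheory GRing.Theory Num.Theory.
Local Open Scope ring_scope.

(** Isomorphisms in HCO transport interleavings, because [delta] commutes with
    composition by closed morphisms; so both distances may be computed on the standard
    cospans of the two diagrams.  Rescaled by [phiinv], the flow is a translation, two
    points of the strip are at finite distance only if their summands have the same type
    and degree, their distance is then the sup-distance of the parameters, and the only
    summands near the boundary are the cancelling pairs of length at most [2 e].
    An e-matching hence gives an e-interleaving summand by summand, short pairs being
    contracted.

    Conversely let [M], [N] hold the coefficients of an e-interleaving between summands of
    equal type and degree.  A nonzero coefficient raises no parameter by more than [e],
    products through summands of another type vanish, and for persistent summands the
    entry of [N M] at [(i', i)] is that of the identity as soon as the sum of the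
    parameters of [i'] is at least that of [i].  Bjerkevik's rank argument turns this
    triangularity into Hall's condition for the relation of being e-close.  The two
    resulting injections of persistent summands are merged as in the Cantor-Bernstein
    theorem. *)

(** * Hall's theorem and matchings from matrices *)

(** Three obstacles separate an interleaving from a matrix identity. First, its maps commute with
    [psiUp] and [psiDn] only up to [mKUp] and [mKDn]; but the middle complex of a standard cospan
    has zero differential, so on cycles these squares commute strictly, and homotopic morphisms
    agree in the middle. Summands with a middle term are therefore compared there, and their
    parameters are recovered through the structure maps. Second, in the legs a homotopy can disturb
    an entry only by reaching the upper generator of a pair; the order by the sum of the parameters
    puts that generator beyond the shift [2 * e]. Third, a path may pass through a summand of
    another type; but a nonzero coefficient never loses the upper generator of a pair or a link of a
    middle generator, and never leads from an unlinked leg generator to a linked one, so a round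
    trip between equal types cannot leave the type. Only the entries on one side of the order are
    controlled, and only for persistent summands of the source: hence Hall's condition instead of an
    inverse matrix, and two injections to be merged. *)

Section Hall.
Variables (I J : finType) (E : I -> J -> bool).

Definition nbhd (A : {set I}) : {set J} := [set j | [exists i in A, E i j]]%SET.

Lemma nbhdU (A B : {set I}) : nbhd (A :|: B)%SET = (nbhd A :|: nbhd B)%SET.
Proof.
apply/setP=> j; rewrite !inE; apply/existsP/orP.
  by case=> i /andP[]; rewrite inE => /orP[] iA Eij; [left|right];
     apply/existsP; exists i; rewrite iA.
by case=> /existsP[i /andP[iA Eij]]; exists i; rewrite inE iA ?orbT.
Qed.

(** Induction on the size of [S]. If some nonempty proper subset [A] is tight, [A] and its
    complement are matched independently, into [nbhd A] and outside it. Otherwise every such subset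
    has a spare neighbour, and an arbitrary edge may be fixed. Restricting sources to [S] and
    targets to [T] is what lets the induction close. *)
Lemma hall_sub (S : {set I}) (T : {set J}) :
  (forall A : {set I}, A \subset S -> (#|A| <= #|nbhd A :&: T|)%N) ->
  exists f : I -> option J,
    {in S, forall i, exists2 j, f i = Some j & (j \in T) && E i j} /\
    {in S &, injective f}.
Proof.
have [n] := ubnP #|S|; elim: n S T => // n IH S T ltS hall.
case: (set_0Vmem S) => [->|[i0 i0S]].
  by exists (fun _ => None); split=> [i|i i']; rewrite inE.
case: (boolP [exists A : {set I}, [&& A \proper S, A != finset.set0 &
        #|nbhd A :&: T| == #|A|]%SET]) => [/existsP[A /and3P[pA nA /eqP cA]]|tight].
  have sA := proper_sub pA.
  have [||f1 [f1T f1i]] := IH A (nbhd A :&: T)%SET.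
  - by rewrite (leq_trans (proper_card pA)) // -ltnS.
  - move=> B sB; have sN : nbhd B \subset nbhd A.
      apply/fintype.subsetP=> j; rewrite !inE => /existsP[i /andP[iB Eij]].
      by apply/existsP; exists i; rewrite (fintype.subsetP sB).
    by rewrite finset.setIA (finset.setIidPl sN) hall // (fintype.subset_trans sB).
  have [||f2 [f2T f2i]] := IH (S :\: A)%SET (T :\: nbhd A)%SET.
  - have := cardsD S A; rewrite (finset.setIidPr sA) => ->.
    rewrite -ltnS (leq_trans _ ltS) // ltnS ltn_subrL card_gt0 nA /=.
    by rewrite card_gt0; apply/set0Pn; exists i0.
  - move=> B sB.
    have sBS : B \subset S by rewrite (fintype.subset_trans sB) // finset.subsetDl.
    have dBA : [disjoint B & A].
      by move: sB; rewrite finset.subsetD => /andP[].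
    (* Subtracting the equality for [A] from the bound for the disjoint union leaves the bound for
       [B] among the targets outside [nbhd A]. *)
    have := hall (A :|: B)%SET; rewrite finset.subUset sA sBS => /(_ isT).
    have -> : (#|A :|: B| = #|A| + #|B|)%N.
      by rewrite cardsU (_ : (A :&: B)%SET = finset.set0) ?cards0 ?subn0 //;
         apply/eqP; rewrite setI_eq0 disjoint_sym.
    rewrite nbhdU finset.setIUl -cA.
    have -> : ((nbhd A :&: T) :|: (nbhd B :&: T) =
               (nbhd A :&: T) :|: (nbhd B :&: (T :\: nbhd A)))%SET.
      by apply/setP=> j; rewrite !inE; case: [exists _ in A, _]; case: (j \in T);
         rewrite ?andbF ?andbT.
    move=> le1; have := leq_trans le1 (leq_card_setU _ _).
    by rewrite leq_add2l.
  exists (fun i => if i \in A then f1 i else f2 i); split=> [i iS|i i' iS i'S].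
    case: ifPn => iA.
      by have [j -> /andP[]] := f1T i iA; rewrite !inE => /andP[_ jT] Eij; exists j; rewrite ?jT.
    have [|j -> /andP[]] := f2T i; first by rewrite !inE iA.
    by rewrite !inE => /andP[_ jT] Eij; exists j; rewrite ?jT.
  case: ifPn => iA; case: ifPn => i'A.
  - exact: f1i.
  - have [j -> /andP[]] := f1T i iA; rewrite !inE => /andP[jA _] _.
    have [|j' -> /andP[]] := f2T i'; first by rewrite !inE i'A.
    by rewrite !inE => /andP[jA' _] _ [jj']; rewrite jj' (negbTE jA') in jA.
  - have [j -> /andP[]] := f1T i' i'A; rewrite !inE => /andP[jA _] _.
    have [|j' -> /andP[]] := f2T i; first by rewrite !inE iA.
    by rewrite !inE => /andP[jA' _] _ [jj']; rewrite jj' jA in jA'.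
  - by apply: f2i; rewrite !inE ?iA ?i'A.
have /card_gt0P[j0] : (0 < #|nbhd [set i0]%SET :&: T|)%N.
  by apply: leq_trans (hall [set i0]%SET _); rewrite ?cards1 // finset.sub1set.
rewrite !inE => /andP[/existsP[i1 /andP[]]]; rewrite inE => /eqP -> Eij0 j0T.
have [||f [fT fi]] := IH (S :\ i0)%SET (T :\ j0)%SET.
- by have := cardsD1 i0 S; rewrite i0S add1n => eS; rewrite -ltnS -eS.
- move=> A sA; have [->|nA] := eqVneq A finset.set0; first by rewrite cards0.
  have pA : A \proper S by rewrite (sub_proper_trans sA) // properD1.
  have sAS := proper_sub pA.
  (* Without tight subsets the inequality is strict, so it survives the removal of [j0]. *)
  have : (#|A| < #|nbhd A :&: T|)%N.
    rewrite ltn_neqAle hall // andbT eq_sym; apply: contra tight => cA.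
    by apply/existsP; exists A; rewrite pA nA.
  rewrite (cardsD1 j0) => /leq_trans; rewrite -ltnS; apply.
  rewrite -add1n leq_add ?leq_b1 //.
  by apply: subset_leq_card; apply/fintype.subsetP=> j; rewrite !inE => /and3P[-> -> ->].
exists (fun i => if i == i0 then Some j0 else f i); split=> [i iS|i i' iS i'S].
  case: eqP => [->|/eqP ni]; first by exists j0; rewrite ?j0T.
  have [|j -> /andP[]] := fT i; first by rewrite !inE ni.
  by rewrite !inE => /andP[_ jT] Eij; exists j; rewrite ?jT.
case: eqP => [->|/eqP ni]; case: eqP => [->|/eqP ni'] //.
- have [|j -> /andP[]] := fT i'; first by rewrite !inE ni'.
  by rewrite !inE => /andP[/eqP nj _] _ [] /esym.
- have [|j -> /andP[]] := fT i; first by rewrite !inE ni.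
  by rewrite !inE => /andP[/eqP nj _] _ [].
- by apply: fi; rewrite !inE ?ni ?ni'.
Qed.

End Hall.

Section PartialMatchings.
Variables (I J : Type) (f : I -> option J) (g : J -> option I).
Hypothesis f_inj : forall i i' j, f i = Some j -> f i' = Some j -> i = i'.
Hypothesis g_inj : forall j j' i, g j = Some i -> g j' = Some i -> j = j'.

Inductive chain_from_free : I -> Prop :=
| ChainStart i : (forall j, g j <> Some i) -> chain_from_free i
| ChainStep i j i' : chain_from_free i -> f i = Some j -> g j = Some i' ->
    chain_from_free i'.

(* The Cantor-Bernstein exchange: follow [f] on alternating chains that start
   outside the image of [g], and invert [g] everywhere else. *)
Lemma merge_matchings :
  exists h : I -> option J,
    [/\ forall i i' j, h i = Some j -> h i' = Some j -> i = i',
        forall i j, h i = Some j -> f i = Some j \/ g j = Some i,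
        forall i, f i <> None -> h i <> None
      & forall j, g j <> None -> exists i, h i = Some j].
Proof.
pose inv i : option J := if pselect (exists j, g j = Some i) is left e
  then Some (projT1 (cid e)) else None.
have invP i j : inv i = Some j -> g j = Some i.
  by rewrite /inv; case: pselect => // e [<-]; case: cid.
have invE i j : g j = Some i -> inv i = Some j.
  move=> gj; rewrite /inv; case: pselect => [e|[]]; last by exists j.
  by congr Some; case: cid => j' /= gj'; apply: g_inj gj.
exists (fun i => if pselect (chain_from_free i) then f i else inv i); split.
- move=> i i' j; case: pselect => ci; case: pselect => ci' //.
  + exact: f_inj.
  + by move=> fi /invP gj; case: ci'; apply: ChainStep ci fi gj.
  + by move=> /invP gj fi; case: ci; apply: ChainStep ci' fi gj.
  + by move=> /invP gj /invP gj'; rewrite gj in gj'; case: gj'.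
- by move=> i j; case: pselect => ci; [left | move/invP; right].
- move=> i fi; case: pselect => //= ci ni; case: (ci); apply: ChainStart => j gj.
  by rewrite (invE _ _ gj) in ni.
- move=> j; case gj : (g j) => [i|//] _.
  case: (pselect (chain_from_free i)) => ci; last first.
    by exists i; case: pselect => //= ?; apply: invE.
  (* Being the [g]-image of [j], the element [i] is not free, so the chain entered it from some
     [j']; injectivity of [g] gives [j' = j], and the predecessor of [j'] is the required
     preimage. *)
  case: ci gj => [i' free|i' j' i'' ci fi gj'] gj; first by case: (free j).
  exists i'; case: pselect => //= ?; rewrite fi; congr Some.
  exact: g_inj gj' gj.
Qed.

End PartialMatchings.

(** * Matchings from a pair of coefficient matrices *)

Section MatrixMatching.
Variables (K : fieldType) (R : realType) (I J : finType) (L : eqType).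
Variables (labI : I -> L) (labJ : J -> L) (uI vI : I -> R) (uJ vJ : J -> R) (e : R).
Variables (M : J -> I -> K) (N : I -> J -> K) (good : pred I).

Definition close_to i j :=
  [&& labI i == labJ j, uI i <= uJ j + e, uJ j <= uI i + e,
      vI i <= vJ j + e & vJ j <= vI i + e].

Hypothesis M_supp : forall j i, M j i != 0 ->
  [/\ labI i = labJ j, uJ j <= uI i + e & vJ j <= vI i + e].
Hypothesis N_supp : forall i j, N i j != 0 ->
  [/\ labI i = labJ j, uI i <= uJ j + e & vI i <= vJ j + e].
Hypothesis NM_id : forall i i', good i -> good i' -> labI i = labI i' ->
  uI i + vI i <= uI i' + vI i' -> \sum_j N i' j * M j i = (i' == i)%:R.

(** If [i] fails in one coordinate and [i'] in the same or the other one, the support bounds add up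
    to [uI i + vI i > uI i' + vI i']. This is why the sum of the two parameters is the right
    order. *)
Lemma between_close i i' j : uI i + vI i <= uI i' + vI i' ->
  M j i != 0 -> N i' j != 0 -> close_to i j || close_to i' j.
Proof.
move=> le_s /M_supp[lij uji vji] /N_supp[li'j ui'j vi'j].
rewrite /close_to lij li'j eqxx uji vji ui'j vi'j /= !andbT.
by apply/orP; move: (lerP (uI i) (uJ j + e)) (lerP (vI i) (vJ j + e))
  (lerP (uJ j) (uI i' + e)) (lerP (vJ j) (vI i' + e)) => -[h1|h1] [h2|h2] [h3|h3] [h4|h4];
  rewrite ?h1 ?h2 ?h3 ?h4; try (by left); try (by right); exfalso; lra.
Qed.

(* If [A] had fewer close partners than elements, some nonzero vector supported
   on [A] would be killed by every close row of [M]; reading [N M = 1] at a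
   support element with maximal [u + v] gives a contradiction. *)
Lemma close_hall (A : {set I}) : (forall i, i \in A -> good i) ->
  (#|A| <= #|nbhd I J close_to A|)%N.
Proof.
move=> gA; rewrite leqNgt; apply/negP => ltBA; set B := nbhd I J close_to A in ltBA.
pose X : 'M[K]_(#|A|, #|B|) := \matrix_(a, b) M (enum_val b) (enum_val a).
have : kermx X != 0.
  rewrite kermx_eq0 /row_free; apply/eqP => rX.
  by have := rank_leq_col X; rewrite rX leqNgt ltBA.
case/rowV0Pn => x /sub_kermxP xX0 x0.
have [a0 xa0] : exists a, x 0 a != 0.
  apply: contrapT => no; move/eqP: x0; apply; apply/rowP=> a; rewrite mxE.
  by apply/eqP; apply: contrapT => /negP xa; apply: no; exists a.
pose s (a : 'I_#|A|) : R := uI (enum_val a) + vI (enum_val a).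
case: (@Order.TotalTheory.arg_maxP _ _ _ a0 (fun a : 'I_#|A| => x 0 a != 0) s xa0) => a xa amax.
have : \sum_b N (enum_val a) (enum_val b) * (x *m X) 0 b = 0.
  by rewrite xX0 big1 // => b _; rewrite mxE mulr0.
under eq_bigr do rewrite mxE big_distrr /=.
rewrite exchange_big /= => /eqP; apply/negP.
rewrite (_ : \sum_j _ = x 0 a) //.
rewrite (bigD1 a) //= [X in _ + X]big1 ?addr0.
  have sum1 : \sum_(b < #|B|) N (enum_val a) (enum_val b) * M (enum_val b) (enum_val a) = 1.
    rewrite -(big_enum_val (fun j => N (enum_val a) j * M j (enum_val a))) /=.
    rewrite -[RHS](_ : \sum_j N (enum_val a) j * M j (enum_val a) = 1); last first.
      by rewrite NM_id ?eqxx ?gA ?enum_valP.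
    (* Completing the sum from [B] to all rows changes nothing: by [between_close] a nonzero term
       would put its row in [B]. *)
    rewrite big_mkcond; apply: eq_bigr => j _; case: ifPn => // jB.
    apply/esym/eqP; apply: contraNT jB; rewrite mulf_eq0 negb_or => /andP[Nn Mn].
    have := between_close _ _ _ (lexx _) Mn Nn; rewrite orbb => cl.
    by rewrite inE; apply/existsP; exists (enum_val a); rewrite enum_valP.
  under eq_bigr do rewrite mxE mulrCA.
  by rewrite -big_distrr /= sum1 mulr1.
(* The other columns contribute nothing: a different label kills every product, and for equal labels
   maximality of [a] makes [NM_id] applicable to the off-diagonal entry. *)
move=> a' na; have [xa'|xa'] := eqVneq (x 0 a') 0.
  by rewrite big1 // => b _; rewrite xa' mul0r mulr0.
under eq_bigr do rewrite mxE mulrCA.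
rewrite -big_distrr /=.
rewrite -(big_enum_val (fun j => N (enum_val a) j * M j (enum_val a'))) /=.
have sle := amax a' xa'.
rewrite (_ : \sum_(i in B) _ = 0) ?mulr0 //.
have [ll|nl] := eqVneq (labI (enum_val a')) (labI (enum_val a)); last first.
  rewrite big1 // => j _; apply/eqP; apply: contraNT nl.
  by rewrite mulf_eq0 negb_or => /andP[/N_supp[-> _ _] /M_supp[-> _ _]].
rewrite -[RHS](_ : \sum_j N (enum_val a) j * M j (enum_val a') = 0); last first.
  rewrite NM_id ?gA ?enum_valP //; case: eqP => // /enum_val_inj aa.
  by rewrite aa eqxx in na.
rewrite big_mkcond; apply: eq_bigr => j _; case: ifPn => // jB.
apply/esym/eqP; apply: contraNT jB; rewrite mulf_eq0 negb_or => /andP[Nn Mn].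
have /orP[cl|cl] := between_close _ _ _ sle Mn Nn; rewrite inE; apply/existsP.
  by exists (enum_val a'); rewrite enum_valP.
by exists (enum_val a); rewrite enum_valP.
Qed.

Lemma matrix_matching :
  exists f : I -> option J,
    [/\ forall i i' j, f i = Some j -> f i' = Some j -> i = i',
        forall i j, f i = Some j -> close_to i j
      & forall i, good i -> f i <> None].
Proof.
have [|f [fE f_inj]] := @hall_sub I J close_to [set i | good i]%SET finset.setT.
  move=> A sA; rewrite finset.setIT; apply: close_hall => i iA.
  by have := fintype.subsetP sA i iA; rewrite inE.
exists (fun i => if good i then f i else None); split=> [i i' j|i j|i gi].
- case: ifP => // gi; case: ifP => // gi' fi fi'.
  by apply: f_inj; rewrite ?inE // fi fi'.
- case: ifP => // gi fi; have [|j'] := fE i; first by rewrite inE.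
  by rewrite fi => -[->]; rewrite inE.
- by rewrite gi; have [|j ->] := fE i; rewrite ?inE.
Qed.

End MatrixMatching.

(** * Levels as weights *)

(** Meaningful strictly between [- Lam] and [Lam] only: at the endpoints [phiinv] is infinite and
    [fine] returns 0. *)
Definition rescale {R : realType} (phiinv : R -> \bar R) (c : R) : R := fine (phiinv c).

Section Rescaling.
Variables (R : realType) (Lam : R) (phi : \bar R -> R) (phiinv : R -> \bar R).
Hypothesis hphi : incr_homeo Lam phi phiinv.

Local Notation u := (rescale phiinv).
Local Notation rh := (rho phi phiinv).

Lemma phi_le (x y : \bar R) : (phi x <= phi y) = (x <= y)%E.
Proof.
case: hphi => homo _ _ _ _; apply/idP/idP.
  by apply: contraTT; rewrite -ltNge -real_ltNge ?num_real // => /homo.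
by rewrite le_eqVlt => /orP[/eqP->//|/homo/ltW].
Qed.

Lemma phi_fin_bounded (z : R) : - Lam < phi z%:E < Lam.
Proof.
by case: hphi => homo [<- <-] _ _ _; apply/andP; split; apply: homo; rewrite ?ltNyr ?ltry.
Qed.

Lemma phiinvE c : - Lam < c < Lam -> phiinv c = (u c)%:E.
Proof.
move=> /andP[c1 c2]; case: hphi => homo [pm pp] _ [_ canc] _.
have := canc c; rewrite !ltW // => /(_ isT); rewrite /rescale.
case: (phiinv c) => [//||] pc; first by move: c2; rewrite -pc pp ltxx.
by move: c1; rewrite -pc pm ltxx.
Qed.

Lemma phi_rescale c : - Lam < c < Lam -> phi (u c)%:E = c.
Proof.
move=> hc; rewrite -phiinvE //; case: hphi => _ _ _ [_ canc] _; apply: canc.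
by case/andP: hc => /ltW -> /ltW ->.
Qed.

Lemma rescale_phi z : u (phi z%:E) = z.
Proof. by rewrite /rescale; case: hphi => _ _ _ [-> _] _. Qed.

Lemma rescale_le_phi c z : - Lam < c < Lam -> (u c <= z) = (c <= phi z%:E).
Proof. by move=> hc; rewrite -{2}(phi_rescale c hc) phi_le lee_fin. Qed.

Lemma phi_le_rescale c z : - Lam < c < Lam -> (z <= u c) = (phi z%:E <= c).
Proof. by move=> hc; rewrite -{2}(phi_rescale c hc) phi_le lee_fin. Qed.

Lemma rescale_le c c' : - Lam < c < Lam -> - Lam < c' < Lam -> (u c <= u c') = (c <= c').
Proof. by move=> hc hc'; rewrite rescale_le_phi // phi_rescale. Qed.

Lemma rescale_lt c c' : - Lam < c < Lam -> - Lam < c' < Lam -> (u c < u c') = (c < c').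
Proof. by move=> hc hc'; rewrite !ltNge rescale_le. Qed.

Lemma rhoE s c : - Lam < c < Lam -> rh s c = phi (u c + s)%:E.
Proof. by move=> hc; rewrite /rho phiinvE // -EFinD addrC. Qed.

Lemma rho_bounded s c : - Lam < c < Lam -> - Lam < rh s c < Lam.
Proof. by move=> hc; rewrite rhoE // phi_fin_bounded. Qed.

Lemma rho_le s c c' : - Lam < c < Lam -> - Lam < c' < Lam -> (rh s c <= c') = (u c + s <= u c').
Proof. by move=> hc hc'; rewrite rhoE // -phi_le_rescale. Qed.

Lemma le_rho s c c' : - Lam < c < Lam -> - Lam < c' < Lam -> (c' <= rh s c) = (u c' <= u c + s).
Proof. by move=> hc hc'; rewrite rhoE // -rescale_le_phi. Qed.

Lemma rho_top s : rh s Lam = Lam.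
Proof.
by case: hphi => _ [_ pp] _ [canc _] _; rewrite /rho -{1}pp canc addey.
Qed.

Lemma rho_bot s : rh s (- Lam) = - Lam.
Proof.
by case: hphi => _ [pm _] _ [canc _] _; rewrite /rho -{1}pm canc addeNy.
Qed.

End Rescaling.

Section LinearMaps.
Variables (K : fieldType) (V W : lmodType K) (f : V -> W).
Hypothesis lf : lin f.

Lemma lin_zero : f 0 = 0.
Proof. by have := lf (-1) 0 0; rewrite !scaleN1r !addNr. Qed.

Lemma lin_neq0 x : f x != 0 -> x != 0.
Proof. by apply: contra_neq => ->; apply: lin_zero. Qed.

Lemma lin_add x y : f (x + y) = f x + f y.
Proof. by have := lf 1 x y; rewrite !scale1r. Qed.

Lemma lin_scale a x : f (a *: x) = a *: f x.
Proof. by have := lf a x 0; rewrite lin_zero !addr0. Qed.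

Lemma lin_opp x : f (- x) = - f x.
Proof. by rewrite -scaleN1r lin_scale // scaleN1r. Qed.

Lemma lin_sub x y : f (x - y) = f x - f y.
Proof. by rewrite lin_add // lin_opp. Qed.

Lemma lin_bigsum (T : Type) (r : seq T) (F : T -> V) :
  f (\sum_(i <- r) F i) = \sum_(i <- r) f (F i).
Proof. by apply: big_morph; [exact: lin_add | exact: lin_zero]. Qed.

End LinearMaps.

Arguments lin_zero {K V W f} lf.
Arguments lin_neq0 {K V W f} lf {x} _.
Arguments lin_add {K V W f} lf x y.
Arguments lin_scale {K V W f} lf a x.
Arguments lin_opp {K V W f} lf x.
Arguments lin_sub {K V W f} lf x y.
Arguments lin_bigsum {K V W f} lf {T} r F.

(** * Morphisms that raise weights by at most e *)

Section Weights.
Variables (K : fieldType) (R : realType) (Lam : R) (phi : \bar R -> R) (phiinv : R -> \bar R).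
Hypothesis hphi : incr_homeo Lam phi phiinv.

Local Notation u := (rescale phiinv).

(* Levels in the coordinate where the flow is a translation; the descending leg is
   negated so that both legs obey the same inequality.  The value at [0] is junk. *)
Definition weightUp (C : cospan K R) (x : gsp (Cup C)) : R := u (fine (lup C x)).
Definition weightDn (C : cospan K R) (x : gsp (Cdn C)) : R := - u (fine (ldn C x)).

(** The guard keeps the junk weight of 0 out of the bound; for linear [f] it also excludes
    [x = 0]. *)
Definition shifted_by {A B : gcx K} (wA : gsp A -> R) (wB : gsp B -> R) (e : R)
    (f : gsp A -> gsp B) :=
  forall x, f x != 0 -> wB (f x) <= wA x + e.

(** Carrying the shift as a number instead of a change of target covers morphisms into [Tsh] and,
    for shift 0, plain morphisms, and makes shifts additive under composition. *)
Definition shift_mor (m : int) (e : R) (C X : cospan K R) (f : mor C X) :=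
  [/\ gdeg (Cdn C) (Cdn X) m (mDn f), gdeg (Cup C) (Cup X) m (mUp f),
      gdeg (Dm C) (Dm X) m (mD f),
      gdeg (Cdn C) (Dm X) (m - 1) (mKDn f) /\ gdeg (Cup C) (Dm X) (m - 1) (mKUp f)
    & shifted_by (weightUp C) (weightUp X) e (mUp f) /\
      shifted_by (weightDn C) (weightDn X) e (mDn f)].

Definition zero_levels (C : cospan K R) := lup C 0 = -oo%E /\ ldn C 0 = +oo%E.

Lemma fin_level (x : \bar R) : ((- Lam)%:E < x < Lam%:E)%E ->
  x = (fine x)%:E /\ - Lam < fine x < Lam.
Proof. by case: x => [x||] /andP[] //; rewrite !lte_fin => -> ->. Qed.

Lemma Tsh_is_morP (m : int) (e : R) (C X : cospan K R) (f : mor C X) :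
  bounded Lam C -> bounded Lam X ->
  is_mor m C (Tsh phi phiinv e X)
    (@Mor K R C (Tsh phi phiinv e X) (mDn f) (mUp f) (mD f) (mKDn f) (mKUp f)) <->
  shift_mor m e C X f.
Proof.
move=> [bUC bDC] [bUX bDX]; rewrite /is_mor /shift_mor /=.
split=> -[d1 d2 d3 d4 [l1 l2]]; split=> //; split=> x.
- move=> fx; have x0 := lin_neq0 d2.1 fx.
  have := l1 x; rewrite (negbTE fx); have [-> hc] := fin_level _ (bUC x x0).
  have [_ hf] := fin_level _ (bUX _ fx).
  by rewrite lee_fin (rho_le R Lam) // /weightUp; lra.
- move=> fx; have x0 := lin_neq0 d1.1 fx.
  have := l2 x; rewrite (negbTE fx); have [-> hc] := fin_level _ (bDC x x0).
  have [_ hf] := fin_level _ (bDX _ fx).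
  by rewrite lee_fin (le_rho R Lam) // /weightDn; lra.
- case: ifPn => fx; first by rewrite leNye.
  have x0 := lin_neq0 d2.1 fx.
  have := l1 x fx; rewrite /weightUp; have [-> hc] := fin_level _ (bUC x x0).
  have [_ hf] := fin_level _ (bUX _ fx).
  by rewrite lee_fin (rho_le R Lam) //=; lra.
- case: ifPn => fx; first by rewrite leey.
  have x0 := lin_neq0 d1.1 fx.
  have := l2 x fx; rewrite /weightDn; have [-> hc] := fin_level _ (bDC x x0).
  have [_ hf] := fin_level _ (bDX _ fx).
  by rewrite lee_fin (le_rho R Lam) //=; lra.
Qed.

(** Weights say nothing where the image vanishes; there the level inequality comes from
    [zero_levels X]. *)
Lemma is_morP (m : int) (C X : cospan K R) (f : mor C X) :
  bounded Lam C -> bounded Lam X -> zero_levels X ->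
  is_mor m C X f <-> shift_mor m 0 C X f.
Proof.
move=> [bUC bDC] [bUX bDX] [z1 z2]; rewrite /is_mor /shift_mor /=.
split=> -[d1 d2 d3 d4 [l1 l2]]; split=> //; split=> x.
- move=> fx; have x0 := lin_neq0 d2.1 fx.
  have := l1 x; rewrite /weightUp; have [-> hc] := fin_level _ (bUC x x0).
  have [-> hf] := fin_level _ (bUX _ fx).
  by rewrite lee_fin addr0 (rescale_le R Lam phi).
- move=> fx; have x0 := lin_neq0 d1.1 fx.
  have := l2 x; rewrite /weightDn; have [-> hc] := fin_level _ (bDC x x0).
  have [-> hf] := fin_level _ (bDX _ fx).
  by rewrite lee_fin addr0 lerN2 (rescale_le R Lam phi).
- have [->|fx] := eqVneq (mUp f x) 0; first by rewrite z1 leNye.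
  have x0 := lin_neq0 d2.1 fx.
  have := l1 x fx; rewrite /weightUp; have [-> hc] := fin_level _ (bUC x x0).
  have [-> hf] := fin_level _ (bUX _ fx).
  by rewrite lee_fin addr0 /= (rescale_le R Lam phi).
- have [->|fx] := eqVneq (mDn f x) 0; first by rewrite z2 leey.
  have x0 := lin_neq0 d1.1 fx.
  have := l2 x fx; rewrite /weightDn; have [-> hc] := fin_level _ (bDC x x0).
  have [-> hf] := fin_level _ (bDX _ fx).
  by rewrite lee_fin addr0 lerN2 /= (rescale_le R Lam phi).
Qed.

Lemma shift_mor_le m e e' (C X : cospan K R) (f : mor C X) : e <= e' ->
  shift_mor m e C X f -> shift_mor m e' C X f.
Proof.
move=> le_e [d1 d2 d3 d4 [l1 l2]]; split=> //; split=> x fx.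
  by apply: le_trans (l1 x fx) _; rewrite lerD2l.
by apply: le_trans (l2 x fx) _; rewrite lerD2l.
Qed.

Definition linear_complex (A : gcx K) := lin (gbd A) /\ forall k, lin (gpr A k).
Definition linear_cospan (C : cospan K R) :=
  [/\ linear_complex (Cup C), linear_complex (Cdn C), linear_complex (Dm C),
      lin (psiUp C) & lin (psiDn C)].

Definition closed_mor (C X : cospan K R) (f : mor C X) := meq (delta 0 f) (mzero C X).

Definition homotopic e (C X : cospan K R) (f g : mor C X) :=
  exists h : mor C X, shift_mor (-1) e C X h /\ meq (msub f g) (delta (-1) h).

Definition idmor (C : cospan K R) : mor C C := idm C C id id id.

Lemma lin_comp {V W Z : lmodType K} (g : W -> Z) (f : V -> W) :
  lin g -> lin f -> lin (fun x => g (f x)).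
Proof. by move=> lg lf a x y; rewrite lf lg. Qed.

Lemma gdeg_comp (A B D : gcx K) m n (g : gsp B -> gsp D) (f : gsp A -> gsp B) :
  gdeg A B m f -> gdeg B D n g -> gdeg A D (m + n) (fun x => g (f x)).
Proof.
move=> [lf df] [lg dg]; split; first exact: lin_comp.
by move=> k x; rewrite -df opprD addrA dg.
Qed.

Lemma gdeg_add (A B : gcx K) m (f g : gsp A -> gsp B) : linear_complex B ->
  gdeg A B m f -> gdeg A B m g -> gdeg A B m (fun x => f x + g x).
Proof.
move=> [_ lB] [lf df] [lg dg]; split.
  by move=> a x y; rewrite lf lg scalerDr addrACA.
by move=> k x; rewrite (lin_add (lB _)) df dg.
Qed.

Lemma shift_mor_comp m n e e' (C X Y : cospan K R) (g : mor X Y) (f : mor C X) :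
  linear_cospan Y -> shift_mor m e C X f -> shift_mor n e' X Y g ->
  shift_mor (m + n) (e + e') C Y (Defs.comp g f).
Proof.
move=> [_ _ lD _ _] [d1 d2 d3 [k1 k2] [l1 l2]] [d1' d2' d3' [k1' k2'] [l1' l2']].
split=> /=; try exact: gdeg_comp d1 d1'; try exact: gdeg_comp d2 d2'; try exact: gdeg_comp d3 d3'.
  split; apply: gdeg_add => //; rewrite ?addrA -1?addrA ?[-1 + n]addrC ?addrA.
  - by rewrite -addrA; apply: gdeg_comp d1 k1'.
  - by rewrite addrAC; apply: gdeg_comp k1 d3'.
  - by rewrite -addrA; apply: gdeg_comp d2 k2'.
  - by rewrite addrAC; apply: gdeg_comp k2 d3'.
split=> x fx.
  have fx0 := lin_neq0 d2'.1 fx.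
  by have := l1 _ fx0; have := l1' _ fx; lra.
have fx0 := lin_neq0 d1'.1 fx.
by have := l2 _ fx0; have := l2' _ fx; lra.
Qed.

End Weights.

Arguments weightUp {K R} phiinv C x.
Arguments weightDn {K R} phiinv C x.
Arguments shifted_by {K R A B} wA wB e f.
Arguments shift_mor {K R} phiinv m e {C X} f.
Arguments zero_levels {K R} C.
Arguments linear_complex {K} A.
Arguments linear_cospan {K R} C.
Arguments closed_mor {K R C X} f.
Arguments homotopic {K R} phiinv e {C X} f g.
Arguments idmor {K R} C.

(** * Homotopies and transport along isomorphisms *)

Ltac zmod_cancel :=
  lazymatch goal with
  | |- - ?a + _ = 0 => rewrite ![_ + (a + _)]addrCA addNKr
  | |- ?a + _ = 0 => rewrite ![_ + (- a + _)]addrCA addKr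
  end.
(* Decides identities between sums of pairwise distinct atoms in an abelian group. *)
Ltac zmod_tac :=
  apply/eqP; rewrite -subr_eq0; apply/eqP;
  rewrite -[LHS]addr0 ?opprB ?opprD ?opprK ?oppr0 -?addrA ?add0r;
  repeat zmod_cancel; try reflexivity.

Section Homotopies.
Variables (K : fieldType) (R : realType) (phiinv : R -> \bar R).

Lemma sign_m1 : ((-1 : K) ^ (-1 : int)) = -1.
Proof. by rewrite /exprz /= invrN1. Qed.

Lemma deltam1E (C X : cospan K R) (h : mor C X) :
  delta (-1) h = Mor (fun x => - gbd (Cdn X) (mDn h x) - mDn h (gbd (Cdn C) x))
   (fun x => - gbd (Cup X) (mUp h x) - mUp h (gbd (Cup C) x))
   (fun x => gbd (Dm X) (mD h x) + mD h (gbd (Dm C) x))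
   (fun x => psiDn X (mDn h x) + mD h (psiDn C x)
             + gbd (Dm X) (mKDn h x) - mKDn h (gbd (Cdn C) x))
   (fun x => psiUp X (mUp h x) + mD h (psiUp C x)
             + gbd (Dm X) (mKUp h x) - mKUp h (gbd (Cup C) x)).
Proof.
by rewrite /delta sign_m1; congr Mor; apply/funext => x; rewrite !scaleN1r ?opprK.
Qed.

Lemma closed_morP (C X : cospan K R) (f : mor C X) : closed_mor f <->
  [/\ forall x, gbd (Cdn X) (mDn f x) = mDn f (gbd (Cdn C) x),
      forall x, gbd (Cup X) (mUp f x) = mUp f (gbd (Cup C) x),
      forall x, gbd (Dm X) (mD f x) = mD f (gbd (Dm C) x),
      forall x, mD f (psiDn C x) =
        psiDn X (mDn f x) + gbd (Dm X) (mKDn f x) + mKDn f (gbd (Cdn C) x)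
    & forall x, mD f (psiUp C x) =
        psiUp X (mUp f x) + gbd (Dm X) (mKUp f x) + mKUp f (gbd (Cup C) x)].
Proof.
have tr (V : zmodType) (p q r s : V) : (p - q + r + s = 0) <-> (q = p + r + s).
  split=> [|->]; last by zmod_tac.
  by move=> h; rewrite -[LHS]add0r -h; zmod_tac.
rewrite /closed_mor /meq /delta /= expr0z.
split=> -[h1 h2 h3 h4 h5]; split=> x.
- by have := h1 x; rewrite scale1r addrC => /eqP; rewrite subr_eq0 => /eqP.
- by have := h2 x; rewrite scale1r addrC => /eqP; rewrite subr_eq0 => /eqP.
- by have := h3 x; rewrite scale1r => /eqP; rewrite subr_eq0 => /eqP.
- by have := h4 x; rewrite !scale1r => /tr.
- by have := h5 x; rewrite !scale1r => /tr.
- by rewrite h1 scale1r addNr.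
- by rewrite h2 scale1r addNr.
- by rewrite h3 scale1r subrr.
- by rewrite !scale1r; apply/tr.
- by rewrite !scale1r; apply/tr.
Qed.

Lemma mor_eq (C X : cospan K R) (f g : mor C X) : meq f g -> f = g.
Proof.
case: f g => [f1 f2 f3 f4 f5] [g1 g2 g3 g4 g5] [/= h1 h2 h3 h4 h5].
by congr Mor; apply/funext.
Qed.

Lemma mor_compA (C X Y Z : cospan K R) (h : mor Y Z) (g : mor X Y) (f : mor C X) :
  lin (mD h) -> Defs.comp h (Defs.comp g f) = Defs.comp (Defs.comp h g) f.
Proof.
by move=> lh; apply: mor_eq; split=> x //=; rewrite (lin_add lh) addrA.
Qed.

Lemma comp_idl (C X : cospan K R) (f : mor C X) : Defs.comp (idmor X) f = f.
Proof. by apply: mor_eq; split=> x //=; rewrite add0r. Qed.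

Lemma delta_comp_l (C X Y : cospan K R) (g : mor X Y) (h : mor C X) :
  linear_cospan Y -> lin (mDn g) -> lin (mUp g) -> lin (mD g) -> lin (mKDn g) -> lin (mKUp g) ->
  closed_mor g -> delta (-1) (Defs.comp g h) = Defs.comp g (delta (-1) h).
Proof.
move=> [_ _ [lbY _] _ _] l1 l2 l3 l4 l5 /closed_morP[c1 c2 c3 c4 c5]; rewrite !deltam1E.
apply: mor_eq; split=> x /=.
- by rewrite (lin_sub l1) (lin_opp l1) c1.
- by rewrite (lin_sub l2) (lin_opp l2) c2.
- by rewrite (lin_add l3) c3.
- rewrite (lin_sub l4) (lin_opp l4) (lin_sub l3) !(lin_add l3) (lin_add lbY) c4 c3.
  by zmod_tac.
- rewrite (lin_sub l5) (lin_opp l5) (lin_sub l3) !(lin_add l3) (lin_add lbY) c5 c3.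
  by zmod_tac.
Qed.

Lemma delta_comp_r (C X Y : cospan K R) (h : mor X Y) (f : mor C X) :
  linear_cospan Y -> lin (mD h) ->
  closed_mor f -> delta (-1) (Defs.comp h f) = Defs.comp (delta (-1) h) f.
Proof.
move=> [_ _ [lbY _] _ _] l3 /closed_morP[c1 c2 c3 c4 c5]; rewrite !deltam1E.
apply: mor_eq; split=> x /=.
- by rewrite c1.
- by rewrite c2.
- by rewrite c3.
- by rewrite c4 c1 !(lin_add l3) (lin_add lbY); zmod_tac.
- by rewrite c5 c2 !(lin_add l3) (lin_add lbY); zmod_tac.
Qed.

Lemma homotopic_comp_l e e' (C X Y : cospan K R) (g : mor X Y) (f f' : mor C X) :
  linear_cospan Y -> shift_mor phiinv 0 e' g -> closed_mor g ->
  homotopic phiinv e f f' ->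
  homotopic phiinv (e + e') (Defs.comp g f) (Defs.comp g f').
Proof.
move=> lY sg cg [h [sh /mor_eq dh]]; exists (Defs.comp g h); split.
  exact: (shift_mor_comp _ _ _ (-1) 0).
case: (sg) => [[l1 _] [l2 _] [l3 _] [[l4 _] [l5 _]] _].
rewrite delta_comp_l // -dh; split=> x /=; rewrite ?(lin_sub l1, lin_sub l2) //.
- by rewrite (lin_sub l3).
- by rewrite (lin_sub l4) (lin_sub l3); zmod_tac.
- by rewrite (lin_sub l5) (lin_sub l3); zmod_tac.
Qed.

Lemma homotopic_comp_r e e' (C X Y : cospan K R) (g g' : mor X Y) (f : mor C X) :
  linear_cospan Y -> shift_mor phiinv 0 e' f -> closed_mor f ->
  homotopic phiinv e g g' ->
  homotopic phiinv (e' + e) (Defs.comp g f) (Defs.comp g' f).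
Proof.
move=> lY sf cf [h [sh /mor_eq dh]]; exists (Defs.comp h f); split.
  exact: (shift_mor_comp _ _ _ 0 (-1)).
case: (sh) => [_ _ [l3 _] _ _].
by rewrite delta_comp_r // -dh; split=> x //=; zmod_tac.
Qed.

(** The two homotopies are added; the ultrametric inequality for weights is what keeps the shift of
    the sum at [e]. *)
Lemma homotopic_trans e (C X : cospan K R) (f g k : mor C X) :
  linear_cospan X -> (forall x y : gsp (Cup X), x != 0 -> y != 0 -> x + y != 0 ->
    weightUp phiinv X (x + y) <= Num.max (weightUp phiinv X x) (weightUp phiinv X y)) ->
  (forall x y : gsp (Cdn X), x != 0 -> y != 0 -> x + y != 0 ->
    weightDn phiinv X (x + y) <= Num.max (weightDn phiinv X x) (weightDn phiinv X y)) ->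
  homotopic phiinv e f g -> homotopic phiinv e g k -> homotopic phiinv e f k.
Proof.
move=> lX ultU ultD [h [sh /mor_eq dh]] [h' [sh' /mor_eq dh']].
exists (Mor (fun x => mDn h x + mDn h' x) (fun x => mUp h x + mUp h' x)
   (fun x => mD h x + mD h' x) (fun x => mKDn h x + mKDn h' x)
   (fun x => mKUp h x + mKUp h' x)).
case: (lX) => [lU lN lD lpU lpN].
split.
  case: sh => [d1 d2 d3 [k1 k2] [l1 l2]]; case: sh' => [d1' d2' d3' [k1' k2'] [l1' l2']].
  split=> /=; try exact: gdeg_add; first by split; exact: gdeg_add.
  split=> x /=.
    have [->|n1] := eqVneq (mUp h x) 0; first by rewrite add0r; apply: l1'.
    have [->|n2] := eqVneq (mUp h' x) 0; first by rewrite addr0; apply: l1.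
    move=> n; apply: le_trans (ultU _ _ n1 n2 n) _.
    by rewrite ge_max l1 // l1'.
  have [->|n1] := eqVneq (mDn h x) 0; first by rewrite add0r; apply: l2'.
  have [->|n2] := eqVneq (mDn h' x) 0; first by rewrite addr0; apply: l2.
  move=> n; apply: le_trans (ultD _ _ n1 n2 n) _.
  by rewrite ge_max l2 // l2'.
have -> : msub f k = Mor (fun x => mDn (msub f g) x + mDn (msub g k) x)
   (fun x => mUp (msub f g) x + mUp (msub g k) x)
   (fun x => mD (msub f g) x + mD (msub g k) x)
   (fun x => mKDn (msub f g) x + mKDn (msub g k) x)
   (fun x => mKUp (msub f g) x + mKUp (msub g k) x).
  by apply: mor_eq; split=> x /=; zmod_tac.
case: lU lN lD => [lU _] [lN _] [lD _].
by rewrite dh dh' !deltam1E; split=> x /=;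
  rewrite ?(lin_add lU) ?(lin_add lN) ?(lin_add lD) ?(lin_add lpU) ?(lin_add lpN); zmod_tac.
Qed.

End Homotopies.

Section Transport.
Variables (K : fieldType) (R : realType) (Lam : R) (phi : \bar R -> R) (phiinv : R -> \bar R).
Hypothesis hphi : incr_homeo Lam phi phiinv.

(** The common interface for the given bounded cospans ([is_cospan_tame]) and the standard ones
    ([std_tame]), on which transport along isomorphisms operates. *)
Definition tame (C : cospan K R) :=
  [/\ linear_cospan C, zero_levels C, bounded Lam C,
      forall x y, (lup C (x + y)%R <= Order.max (lup C x) (lup C y))%E
    & forall x y, (Order.min (ldn C x) (ldn C y) <= ldn C (x + y)%R)%E].

Lemma ascending_ultra (A : gcx K) (l : gsp A -> \bar R) : ascending l ->
  l 0 = -oo%E /\ forall x y, (l (x + y)%R <= Order.max (l x) (l y))%E.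
Proof.
move=> [l0 _ lsum _ _]; split=> [|x y]; first by apply/eqP; rewrite l0.
have := lsum 2%N (fun _ => 1) (fun i => if i == ord0 then x else y).
rewrite big_ord_recl big_ord1 /= !scale1r => /le_trans; apply.
rewrite big_mkcond /= big_ord_recl big_ord1 /= oner_eq0 /=.
exact: lexx.
Qed.

Lemma is_cospan_tame C : is_cospan C -> bounded Lam C -> tame C.
Proof.
case=> [[cU [cD cM]] [aU aD] [[pU _] [pD _]] _] bC.
have lc (A : gcx K) : chain_complex A -> linear_complex A.
  by move=> [[g1 _] [[g2 _] _]]; split.
have [zU uU] := ascending_ultra _ _ aU; have [zD uD] := ascending_ultra _ _ aD.
split=> //; first by split=> //; apply: lc.
  by split=> //; apply: oppe_inj; rewrite zD.
by move=> x y; have := uD x y; rewrite /= leeNl oppe_max !oppeK.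
Qed.

Lemma weightUp_ultra C : tame C -> forall x y : gsp (Cup C),
  x != 0 -> y != 0 -> x + y != 0 ->
  weightUp phiinv C (x + y) <= Num.max (weightUp phiinv C x) (weightUp phiinv C y).
Proof.
move=> [_ _ [bU _] ul _] x y x0 y0 xy0; have := ul x y; rewrite /weightUp.
have [-> h1] := fin_level _ _ _ (bU x x0); have [-> h2] := fin_level _ _ _ (bU y y0).
have [-> h3] := fin_level _ _ _ (bU _ xy0); rewrite /= le_max le_max !lee_fin.
by rewrite !(rescale_le _ _ _ _ hphi).
Qed.

Lemma weightDn_ultra C : tame C -> forall x y : gsp (Cdn C),
  x != 0 -> y != 0 -> x + y != 0 ->
  weightDn phiinv C (x + y) <= Num.max (weightDn phiinv C x) (weightDn phiinv C y).
Proof.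
move=> [_ _ [_ bU] _ ul] x y x0 y0 xy0; have := ul x y; rewrite /weightDn.
have [-> h1] := fin_level _ _ _ (bU x x0); have [-> h2] := fin_level _ _ _ (bU y y0).
have [-> h3] := fin_level _ _ _ (bU _ xy0); rewrite /= le_max ge_min !lee_fin !lerN2.
by rewrite !(rescale_le _ _ _ _ hphi).
Qed.

(** Interleavings with all four maps between [C] and [X] themselves: since [Tsh] alters only levels,
    shifts become numbers and [Tmor] disappears. An isomorphism is then the case of shift 0. *)
Definition interleaved e (C X : cospan K R) :=
  exists (a : mor C X) (b : mor X C),
    [/\ shift_mor phiinv 0 e a /\ closed_mor a, shift_mor phiinv 0 e b /\ closed_mor b,
        homotopic phiinv (2 * e) (Defs.comp b a) (idmor C)
      & homotopic phiinv (2 * e) (Defs.comp a b) (idmor X)].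

Definition unshift {e} {C X : cospan K R} (f : mor C (Tsh phi phiinv e X)) : mor C X :=
  @Mor K R C X (mDn f) (mUp f) (mD f) (mKDn f) (mKUp f).

Definition addshift e {C X : cospan K R} (f : mor C X) : mor C (Tsh phi phiinv e X) :=
  @Mor K R C (Tsh phi phiinv e X) (mDn f) (mUp f) (mD f) (mKDn f) (mKUp f).

Lemma interleavingP e (C X : cospan K R) : tame C -> tame X ->
  interleaving phi phiinv e C X <-> interleaved e C X.
Proof.
move=> [_ _ bC _ _] [_ _ bX _ _]; split.
  move=> [a [b [[ma ca] [mb cb] [h [mh dh]] [k [mk dk]]]]].
  exists (unshift a), (unshift b); split.
  - by split; [apply/(Tsh_is_morP _ _ _ _ _ hphi _ _ _ _ _ bC bX); case: (a) ma | exact: ca].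
  - by split; [apply/(Tsh_is_morP _ _ _ _ _ hphi _ _ _ _ _ bX bC); case: (b) mb | exact: cb].
  - exists (unshift h); split; last exact: dh.
    by apply/(Tsh_is_morP _ _ _ _ _ hphi _ _ _ _ _ bC bC); case: (h) mh.
  - exists (unshift k); split; last exact: dk.
    by apply/(Tsh_is_morP _ _ _ _ _ hphi _ _ _ _ _ bX bX); case: (k) mk.
move=> [a [b [[ma ca] [mb cb] [h [mh dh]] [k [mk dk]]]]].
exists (addshift e a), (addshift e b); split.
- by split; [apply/(Tsh_is_morP _ _ _ _ _ hphi _ _ _ _ _ bC bX) | exact: ca].
- by split; [apply/(Tsh_is_morP _ _ _ _ _ hphi _ _ _ _ _ bX bC) | exact: cb].
- exists (addshift (2 * e) h); split; last exact: dh.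
  by apply/(Tsh_is_morP _ _ _ _ _ hphi _ _ _ _ _ bC bC).
- exists (addshift (2 * e) k); split; last exact: dk.
  by apply/(Tsh_is_morP _ _ _ _ _ hphi _ _ _ _ _ bX bX).
Qed.

Lemma interleaved_sym e (C X : cospan K R) : interleaved e C X -> interleaved e X C.
Proof. by case=> a [b [ha hb hab hba]]; exists b, a. Qed.

Lemma hco_isoP (C X : cospan K R) : tame C -> tame X ->
  hco_iso C X <-> interleaved 0 C X.
Proof.
move=> [_ zC bC _ _] [_ zX bX _ _]; rewrite /interleaved mulr0; split.
  move=> [a [b [[ma ca] [mb cb] [h [mh dh]] [k [mk dk]]]]]; exists a, b.
  split; [split=> //|split=> //|exists h; split=> //|exists k; split=> //];
  by apply/(is_morP _ _ _ _ _ hphi).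
move=> [a [b [[ma ca] [mb cb] [h [mh dh]] [k [mk dk]]]]]; exists a, b.
split; [split=> //|split=> //|exists h; split=> //|exists k; split=> //];
by apply/(is_morP _ _ _ _ _ hphi).
Qed.

Lemma closed_comp (C X Y : cospan K R) (g : mor X Y) (f : mor C X) :
  linear_cospan Y -> lin (mD g) -> closed_mor g -> closed_mor f ->
  closed_mor (Defs.comp g f).
Proof.
move=> [_ _ [lbY _] _ _] l3 /closed_morP[c1 c2 c3 c4 c5] /closed_morP[d1 d2 d3 d4 d5].
apply/closed_morP; split=> x /=.
- by rewrite c1 d1.
- by rewrite c2 d2.
- by rewrite c3 d3.
- by rewrite d4 !(lin_add l3) c4 (lin_add lbY) c3 d1; zmod_tac.
- by rewrite d5 !(lin_add l3) c5 (lin_add lbY) c3 d2; zmod_tac.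
Qed.

(** Contract from the inside: [q' p'], then [b a], then [p q]. The homotopies of the isomorphisms
    have shift 0, so the three stages cost [e + 0 + e], [0 + 2 * e + 0] and 0, and none exceeds
    [2 * e]. *)
Lemma transport_homotopy e (C X S T : cospan K R) (a : mor C X) (b : mor X C)
    (p : mor C S) (q : mor S C) (p' : mor X T) (q' : mor T X) :
  0 <= e -> tame C -> tame X -> tame S -> tame T ->
  shift_mor phiinv 0 e a -> closed_mor a -> shift_mor phiinv 0 e b -> closed_mor b ->
  shift_mor phiinv 0 0 p -> closed_mor p -> shift_mor phiinv 0 0 q -> closed_mor q ->
  shift_mor phiinv 0 0 p' -> closed_mor p' -> shift_mor phiinv 0 0 q' -> closed_mor q' ->
  homotopic phiinv (2 * e) (Defs.comp b a) (idmor C) ->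
  homotopic phiinv 0 (Defs.comp p q) (idmor S) ->
  homotopic phiinv 0 (Defs.comp q' p') (idmor X) ->
  homotopic phiinv (2 * e)
    (Defs.comp (Defs.comp p (Defs.comp b q')) (Defs.comp p' (Defs.comp a q))) (idmor S).
Proof.
move=> e0 tC tX tS tT sa ca sb cb sp cp sq cq sp' cp' sq' cq' hba hpq hqp.
have lC : linear_cospan C by case: tC.
have lX : linear_cospan X by case: tX.
have lS : linear_cospan S by case: tS.
have lT : linear_cospan T by case: tT.
have linD (A B : cospan K R) d (f : mor A B) : shift_mor phiinv 0 d f -> lin (mD f).
  by case=> _ _ [].
have saq : shift_mor phiinv 0 e (Defs.comp a q).
  by rewrite -[e]add0r; apply: (shift_mor_comp _ _ _ 0 0).
have caq : closed_mor (Defs.comp a q) by apply: closed_comp => //; apply: linD sa.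
have spb : shift_mor phiinv 0 e (Defs.comp p b).
  by rewrite -[e]addr0; apply: (shift_mor_comp _ _ _ 0 0).
have cpb : closed_mor (Defs.comp p b) by apply: closed_comp => //; apply: linD sp.
have trS (g f k : mor S S) : homotopic phiinv (2 * e) f g ->
    homotopic phiinv (2 * e) g k -> homotopic phiinv (2 * e) f k.
  by apply: homotopic_trans => //; [exact: weightUp_ultra | exact: weightDn_ultra].
have weaken (A B : cospan K R) d (f g : mor A B) : d = 2 * e \/ d = 0 ->
    homotopic phiinv d f g -> homotopic phiinv (2 * e) f g.
  move=> de [h [sh dh]]; exists h; split=> //; apply: shift_mor_le sh.
  by case: de => ->; lra.
apply: (trS (Defs.comp (Defs.comp p b) (Defs.comp a q))).
  rewrite (_ : Defs.comp (Defs.comp p (Defs.comp b q')) (Defs.comp p' (Defs.comp a q)) =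
    Defs.comp (Defs.comp p b) (Defs.comp (Defs.comp q' p') (Defs.comp a q))); last first.
    by rewrite !mor_compA //=; do ?[apply: linD; eassumption | apply: lin_comp].
  rewrite -{2}(comp_idl _ _ _ _ (Defs.comp a q)).
  apply: (weaken _ _ (e + 0 + e)); first by left; lra.
  apply: homotopic_comp_l => //; exact: homotopic_comp_r.
apply: (trS (Defs.comp p q)).
  rewrite (_ : Defs.comp (Defs.comp p b) (Defs.comp a q) =
     Defs.comp p (Defs.comp (Defs.comp b a) q)); last first.
    by rewrite !mor_compA //=; do ?[apply: linD; eassumption | apply: lin_comp].
  rewrite -{2}(comp_idl _ _ _ _ q).
  apply: (weaken _ _ (0 + 2 * e + 0)); first by left; lra.
  apply: homotopic_comp_l => //; exact: homotopic_comp_r.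
by apply: (weaken _ _ 0) => //; right.
Qed.

Lemma interleaved_transport e (C X S T : cospan K R) :
  0 <= e -> tame C -> tame X -> tame S -> tame T ->
  interleaved 0 C S -> interleaved 0 X T ->
  interleaved e C X -> interleaved e S T.
Proof.
move=> e0 tC tX tS tT [p [q [[sp cp] [sq cq] hqp hpq]]]
  [p' [q' [[sp' cp'] [sq' cq'] hqp' hpq']]] [a [b [[sa ca] [sb cb] hba hab]]].
rewrite mulr0 in hqp hpq hqp' hpq'.
have linC (A : cospan K R) : tame A -> linear_cospan A by case.
exists (Defs.comp p' (Defs.comp a q)), (Defs.comp p (Defs.comp b q')).
split.
- split.
    rewrite -[e]addr0 -[e]add0r.
    apply: (shift_mor_comp _ _ _ 0 0 (0 + e) 0) => //; first exact: linC.
    by apply: (shift_mor_comp _ _ _ 0 0) => //; apply: linC.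
  apply: closed_comp => //; [exact: linC|by case: sp' => _ _ []|].
  by apply: closed_comp => //; [exact: linC|case: sa => _ _ []].
- split.
    rewrite -[e]addr0 -[e]add0r.
    apply: (shift_mor_comp _ _ _ 0 0 (0 + e) 0) => //; first exact: linC.
    by apply: (shift_mor_comp _ _ _ 0 0) => //; apply: linC.
  apply: closed_comp => //; [exact: linC|by case: sp => _ _ []|].
  by apply: closed_comp => //; [exact: linC|case: sb => _ _ []].
- exact: transport_homotopy.
- exact: transport_homotopy.
Qed.

End Transport.

Arguments tame {K R} Lam C.
Arguments interleaved {K R} phiinv e C X.

(** * Coordinates on standard cospans *)

(* What a standard summand contributes to one of the three complexes: nothing,
   a cycle, or a cancelling pair whose lower-degree generator comes first. *)
Inductive leg (R : Type) := L0 | L1 of int & R | L2 of int & R & R.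
Arguments L0 {R}.
Arguments L1 {R} _ _.
Arguments L2 {R} _ _ _.

Section Legs.
Variable R : realType.

Definition has1 (g : leg R) := if g is L0 then false else true.
Definition has2 (g : leg R) := if g is L2 _ _ _ then true else false.
Definition deg1 (g : leg R) : int :=
  match g with L0 => 0 | L1 k _ => k | L2 k _ _ => k end.
Definition lev1 (g : leg R) : R :=
  match g with L0 => 0 | L1 _ a => a | L2 _ a _ => a end.
Definition lev2 (g : leg R) : R := if g is L2 _ _ b then b else 0.
Definition map_leg (f : R -> R) (g : leg R) : leg R :=
  match g with L0 => L0 | L1 k a => L1 k (f a) | L2 k a b => L2 k (f a) (f b) end.

Definition legUp (t : summand R) : leg R :=
  match t with
  | SUp k a b => L2 k a b | SUpInf k a => L1 k a
  | SGt k a b => L1 k b | SNE k a => L1 k a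
  | _ => L0
  end.
(** Levels are negated, so that in a valid summand the lower-degree generator of a pair has the
    smaller level, as in the ascending leg. *)
Definition legDn (t : summand R) : leg R :=
  match t with
  | SDn k a b => L2 k (- a) (- b) | SDnInf k a => L1 k (- a)
  | SGt k a b => L1 k (- a) | SSE k a => L1 k (- a)
  | _ => L0
  end.
(** The middle complex has no filtration; the level 0 is a placeholder. *)
Definition legD (t : summand R) : leg R :=
  match t with
  | SGt k _ _ => L1 k 0 | SSE k _ => L1 k 0 | SNE k _ => L1 k 0 | SBox k => L1 k 0
  | _ => L0
  end.
Definition linkUp (t : summand R) :=
  match t with SGt _ _ _ | SNE _ _ => true | _ => false end.
Definition linkDn (t : summand R) :=
  match t with SGt _ _ _ | SSE _ _ => true | _ => false end.

End Legs.

Arguments has1 {R} g.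
Arguments has2 {R} g.
Arguments deg1 {R} g.
Arguments lev1 {R} g.
Arguments lev2 {R} g.
Arguments map_leg {R} f g.
Arguments legUp {R} t.
Arguments legDn {R} t.
Arguments legD {R} t.
Arguments linkUp {R} t.
Arguments linkDn {R} t.

(** A standard complex is a nested product whose type depends on the list of summands; coordinate
    functions give uniform access to it. [co1] reads the lower or only generator at an index, [co2]
    the upper one, and [mkv] builds a vector with prescribed coordinates wherever the generators
    exist. *)
Record coords {K : fieldType} (I : Type) (A : gcx K) := Coords {
  co1 : I -> gsp A -> K;
  co2 : I -> gsp A -> K;
  mkv : (I -> K) -> (I -> K) -> gsp A
}.
Arguments co1 {K I A} c _ _.
Arguments co2 {K I A} c _ _.
Arguments mkv {K I A} c _ _.
Arguments Coords {K I A} _ _ _.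

Record coords_of {K : fieldType} {R : realType} {I : Type} {A : gcx K}
    (c : coords I A) (g : I -> leg R) : Prop := CoordsOf {
  co1_lin : forall n, lin (co1 c n : gsp A -> K^o);
  co2_lin : forall n, lin (co2 c n : gsp A -> K^o);
  co1_mk : forall n x y, co1 c n (mkv c x y) = if has1 (g n) then x n else 0;
  co2_mk : forall n x y, co2 c n (mkv c x y) = if has2 (g n) then y n else 0;
  co1_out : forall n v, has1 (g n) = false -> co1 c n v = 0;
  co2_out : forall n v, has2 (g n) = false -> co2 c n v = 0;
  co_ext : forall v w, (forall n, co1 c n v = co1 c n w) ->
    (forall n, co2 c n v = co2 c n w) -> v = w;
  co1_pr : forall n k v, co1 c n (gpr A k v) = if k == deg1 (g n) then co1 c n v else 0;
  co2_pr : forall n k v, co2 c n (gpr A k v) = if k == deg1 (g n) + 1 then co2 c n v else 0;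
  co1_bd : forall n v, co1 c n (gbd A v) = co2 c n v;
  co2_bd : forall n v, co2 c n (gbd A v) = 0
}.

(** The level is the maximum over the generators that occur; characterising its upper bounds avoids
    a maximum over the possibly infinite index type. *)
Definition levels_of {K : fieldType} {R : realType} {I : Type} {A : gcx K}
    (c : coords I A) (g : I -> leg R) (l : gsp A -> \bar R) :=
  forall v z, (l v <= z)%E <->
    forall n, (co1 c n v != 0 -> ((lev1 (g n))%:E <= z)%E) /\
              (co2 c n v != 0 -> ((lev2 (g n))%:E <= z)%E).

Section StandardCoordinates.
Variables (K : fieldType) (R : realType).

Definition zero_coords {I : Type} : coords I (zero_gcx K) :=
  @Coords K I (zero_gcx K) (fun _ _ => 0) (fun _ _ => 0) (fun _ _ => 0).
Definition one_coords k : coords unit (one_gcx K k) :=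
  @Coords K unit (one_gcx K k) (fun _ (v : 'rV[K]_1) => v 0 0) (fun _ _ => 0)
    (fun x _ => (x tt)%:M).
Definition two_coords k : coords unit (two_gcx K k) :=
  @Coords K unit (two_gcx K k) (fun _ (v : 'rV[K]_1 * 'rV[K]_1) => v.1 0 0)
    (fun _ (v : 'rV[K]_1 * 'rV[K]_1) => v.2 0 0)
    (fun x y => ((x tt)%:M, (y tt)%:M)).
Definition cons_coords {A B : gcx K} (c : coords unit A) (d : coords nat B) :
    coords nat (sum_gcx A B) :=
  @Coords K nat (sum_gcx A B)
    (fun n (v : gsp A * gsp B) => if n is n'.+1 then co1 d n' v.2 else co1 c tt v.1)
    (fun n (v : gsp A * gsp B) => if n is n'.+1 then co2 d n' v.2 else co2 c tt v.1)
    (fun x y => (mkv c (fun _ => x 0%N) (fun _ => y 0%N),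
                 mkv d (fun n => x n.+1) (fun n => y n.+1))).

Definition elemUp (t : summand R) : coords unit (Cup (elem_cospan K t)) :=
  match t return coords unit (Cup (elem_cospan K t)) with
  | SUp k _ _ => two_coords k
  | SUpInf k _ => one_coords k | SGt k _ _ => one_coords k | SNE k _ => one_coords k
  | _ => zero_coords
  end.
Definition elemDn (t : summand R) : coords unit (Cdn (elem_cospan K t)) :=
  match t return coords unit (Cdn (elem_cospan K t)) with
  | SDn k _ _ => two_coords k
  | SDnInf k _ => one_coords k | SGt k _ _ => one_coords k | SSE k _ => one_coords k
  | _ => zero_coords
  end.
Definition elemD (t : summand R) : coords unit (Dm (elem_cospan K t)) :=
  match t return coords unit (Dm (elem_cospan K t)) with
  | SGt k _ _ => one_coords k | SSE k _ => one_coords k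
  | SNE k _ => one_coords k | SBox k => one_coords k
  | _ => zero_coords
  end.

Fixpoint stdUp (s : seq (summand R)) : coords nat (Cup (std_cospan K s)) :=
  match s return coords nat (Cup (std_cospan K s)) with
  | [::] => zero_coords
  | t :: s' => cons_coords (elemUp t) (stdUp s')
  end.
Fixpoint stdDn (s : seq (summand R)) : coords nat (Cdn (std_cospan K s)) :=
  match s return coords nat (Cdn (std_cospan K s)) with
  | [::] => zero_coords
  | t :: s' => cons_coords (elemDn t) (stdDn s')
  end.
Fixpoint stdD (s : seq (summand R)) : coords nat (Dm (std_cospan K s)) :=
  match s return coords nat (Dm (std_cospan K s)) with
  | [::] => zero_coords
  | t :: s' => cons_coords (elemD t) (stdD s')
  end.

(** The default [L0] puts no generator beyond the end of the list, so indices may range over all of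
    [nat]. *)
Definition legs_at (f : summand R -> leg R) (s : seq (summand R)) (n : nat) : leg R :=
  nth L0 (map f s) n.

Lemma row0_eq (v w : 'rV[K]_0) : v = w.
Proof. by apply/rowP => -[]. Qed.

Lemma row1_eq (v w : 'rV[K]_1) : v 0 0 = w 0 0 -> v = w.
Proof. by move=> h; apply/rowP => i; rewrite ord1. Qed.

Lemma zero_coordsP (I : Type) (g : I -> leg R) : (forall n, g n = L0) ->
  coords_of (@zero_coords I) g.
Proof.
move=> g0; split=> //=; try (by move=> *; rewrite ?g0 //= ?if_same).
- by move=> n a x y; rewrite /= scaler0 addr0.
- by move=> n a x y; rewrite /= scaler0 addr0.
- by move=> v w _ _; apply: row0_eq.
Qed.

Lemma one_coordsP k a : coords_of (one_coords k) (fun _ => L1 k a : leg R).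
Proof.
split=> //=.
- by move=> n b x y; rewrite !mxE.
- by move=> n b x y; rewrite /= scaler0 addr0.
- by move=> [] x y; rewrite mxE eqxx mulr1n.
- by move=> v w h _; apply: row1_eq; apply: (h tt).
- by move=> n j v; case: ifP => // _; rewrite mxE.
- by move=> *; rewrite if_same.
- by move=> *; rewrite mxE.
Qed.

Lemma two_coordsP k a b : coords_of (two_coords k) (fun _ => L2 k a b : leg R).
Proof.
split=> //=.
- by move=> n c x y; rewrite /= !mxE.
- by move=> n c x y; rewrite /= !mxE.
- by move=> [] x y; rewrite mxE eqxx mulr1n.
- by move=> [] x y; rewrite mxE eqxx mulr1n.
- by move=> [v1 v2] [w1 w2] h1 h2; congr (_, _); apply: row1_eq; [apply: (h1 tt)|apply: (h2 tt)].
- by move=> n j v; case: ifP => // _; rewrite mxE.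
- by move=> n j v; case: ifP => // _; rewrite mxE.
- by move=> *; rewrite mxE.
Qed.

Lemma cons_coordsP (A B : gcx K) (c : coords unit A) (d : coords nat B) (a : leg R)
    (l : seq (leg R)) : coords_of c (fun _ => a) -> coords_of d (nth L0 l) ->
  coords_of (cons_coords c d) (nth L0 (a :: l)).
Proof.
move=> hc hd; split=> /=.
- by case=> [|n] b x y; [apply: (co1_lin _ _ hc) | apply: (co1_lin _ _ hd)].
- by case=> [|n] b x y; [apply: (co2_lin _ _ hc) | apply: (co2_lin _ _ hd)].
- by case=> [|n] x y; [rewrite (co1_mk _ _ hc) | rewrite (co1_mk _ _ hd)].
- by case=> [|n] x y; [rewrite (co2_mk _ _ hc) | rewrite (co2_mk _ _ hd)].
- by case=> [|n] v; [apply: (co1_out _ _ hc) | apply: (co1_out _ _ hd)].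
- by case=> [|n] v; [apply: (co2_out _ _ hc) | apply: (co2_out _ _ hd)].
- move=> [v1 v2] [w1 w2] h1 h2; congr (_, _).
    by apply: (co_ext _ _ hc) => -[]; [apply: (h1 0%N)|apply: (h2 0%N)].
  by apply: (co_ext _ _ hd) => n; [apply: (h1 n.+1)|apply: (h2 n.+1)].
- by case=> [|n] k v; [rewrite (co1_pr _ _ hc) | rewrite (co1_pr _ _ hd)].
- by case=> [|n] k v; [rewrite (co2_pr _ _ hc) | rewrite (co2_pr _ _ hd)].
- by case=> [|n] v; [rewrite (co1_bd _ _ hc) | rewrite (co1_bd _ _ hd)].
- by case=> [|n] v; [rewrite (co2_bd _ _ hc) | rewrite (co2_bd _ _ hd)].
Qed.

Lemma stdUpP s : coords_of (stdUp s) (legs_at legUp s).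
Proof.
elim: s => [|t s IH] /=; first by apply: zero_coordsP => n; rewrite /legs_at nth_nil.
apply: cons_coordsP => //; case: t => *; do ?[apply: one_coordsP | apply: two_coordsP];
by apply: zero_coordsP.
Qed.

Lemma stdDnP s : coords_of (stdDn s) (legs_at legDn s).
Proof.
elim: s => [|t s IH] /=; first by apply: zero_coordsP => n; rewrite /legs_at nth_nil.
apply: cons_coordsP => //; case: t => *; do ?[apply: one_coordsP | apply: two_coordsP];
by apply: zero_coordsP.
Qed.

Lemma stdDP s : coords_of (stdD s) (legs_at legD s).
Proof.
elim: s => [|t s IH] /=; first by apply: zero_coordsP => n; rewrite /legs_at nth_nil.
apply: cons_coordsP => //; case: t => *; do ?[apply: one_coordsP | apply: two_coordsP];
by apply: zero_coordsP.
Qed.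

Lemma lvl_le (a : R) (x : 'rV[K]_1) z :
  (lvl a x <= z)%E <-> (x 0 0 != 0 -> (a%:E <= z)%E).
Proof.
rewrite /lvl; case: eqP => [->|nx]; first by rewrite mxE eqxx leNye.
split=> [//|]; apply; apply/eqP => h; apply: nx; apply: row1_eq; rewrite h mxE //.
Qed.

Lemma zero_levelsP (I : Type) (g : I -> leg R) (l : gsp (zero_gcx K) -> \bar R) :
  (forall v, l v = -oo%E) -> levels_of (@zero_coords I) g l.
Proof. by move=> l0 v z; rewrite l0 leNye; split=> // _ n /=; rewrite eqxx. Qed.

Lemma one_levelsP k (a : R) (l : gsp (one_gcx K k) -> \bar R) :
  (forall v, l v = lvl a (v : 'rV[K]_1)) -> levels_of (one_coords k) (fun _ => L1 k a) l.
Proof.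
move=> lE v z; rewrite lE; split=> [/lvl_le h []|/(_ tt)[h _]]; last exact/lvl_le.
by split=> //=; rewrite eqxx.
Qed.

Lemma two_levelsP k (a b : R) (l : gsp (two_gcx K k) -> \bar R) :
  (forall v, l v = Order.max (lvl a (v.1 : 'rV[K]_1)) (lvl b (v.2 : 'rV[K]_1))) ->
  levels_of (two_coords k) (fun _ => L2 k a b) l.
Proof.
move=> lE v z; rewrite lE ge_max; split=> [/andP[/lvl_le h /lvl_le h'] []//|/(_ tt)[h h']].
by apply/andP; split; apply/lvl_le.
Qed.

Lemma cons_levelsP (A B : gcx K) (c : coords unit A) (d : coords nat B) (a : leg R)
    (r : seq (leg R)) lA lB (l : gsp (sum_gcx A B) -> \bar R) :
  (forall v, l v = Order.max (lA v.1) (lB v.2)) ->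
  levels_of c (fun _ => a) lA -> levels_of d (nth L0 r) lB ->
  levels_of (cons_coords c d) (nth L0 (a :: r)) l.
Proof.
move=> lE hA hB v z; rewrite lE ge_max; split=> [/andP[/hA h /hB h']|h].
  by case=> [|n] /=; [apply: (h tt)|apply: h'].
by apply/andP; split; [apply/hA => -[]; apply: (h 0%N)|apply/hB => n; apply: (h n.+1)].
Qed.

Lemma stdUp_levels s : levels_of (stdUp s) (legs_at legUp s) (lup (std_cospan K s)).
Proof.
elim: s => [|t s IH] /=; first exact: zero_levelsP.
apply: cons_levelsP IH => //; case: t => *;
  [apply: two_levelsP|apply: zero_levelsP|apply: one_levelsP|apply: zero_levelsP
  |apply: one_levelsP|apply: zero_levelsP|apply: one_levelsP|apply: zero_levelsP] => //.
Qed.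

Lemma stdDn_levels s :
  levels_of (stdDn s) (legs_at legDn s) (fun v => - ldn (std_cospan K s) v)%E.
Proof.
elim: s => [|t s IH] /=; first exact: zero_levelsP.
apply: (@cons_levelsP _ _ _ _ _ _ (fun v => - ldn (elem_cospan K t) v)%E) IH.
  by move=> v /=; rewrite oppe_min.
case: t => *;
  [apply: zero_levelsP|apply: two_levelsP|apply: zero_levelsP|apply: one_levelsP
  |apply: one_levelsP|apply: one_levelsP|apply: zero_levelsP|apply: zero_levelsP] => //= v;
  by rewrite oppeK.
Qed.

Lemma std_psiUp s n v :
  co1 (stdD s) n (psiUp (std_cospan K s) v) =
    if nth false (map linkUp s) n then co1 (stdUp s) n v else 0.
Proof.
elim: s n v => [|t s IH] n v /=; first by rewrite nth_nil.
case: n => [|n] /=; last exact: IH.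
by case: t v => * //=; rewrite mxE.
Qed.

Lemma std_psiDn s n v :
  co1 (stdD s) n (psiDn (std_cospan K s) v) =
    if nth false (map linkDn s) n then co1 (stdDn s) n v else 0.
Proof.
elim: s n v => [|t s IH] n v /=; first by rewrite nth_nil.
case: n => [|n] /=; last exact: IH.
by case: t v => * //=; rewrite mxE.
Qed.

End StandardCoordinates.

Section CoordinateConsequences.
Variables (K : fieldType) (R : realType) (I : Type) (A : gcx K).
Variables (c : coords I A) (g : I -> leg R).
Hypothesis hc : coords_of c g.

Lemma coords_linear : linear_complex A.
Proof.
split=> [a v w|k a v w]; apply: (co_ext _ _ hc) => n.
- by rewrite (co1_lin _ _ hc) !(co1_bd _ _ hc) (co2_lin _ _ hc).
- by rewrite (co2_lin _ _ hc) !(co2_bd _ _ hc) scaler0 addr0.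
- rewrite (co1_lin _ _ hc) !(co1_pr _ _ hc) (co1_lin _ _ hc).
  by case: ifP => // _; rewrite scaler0 addr0.
- rewrite (co2_lin _ _ hc) !(co2_pr _ _ hc) (co2_lin _ _ hc).
  by case: ifP => // _; rewrite scaler0 addr0.
Qed.

Lemma co1_zero n : co1 c n 0 = 0.
Proof. exact: lin_zero (co1_lin _ _ hc n). Qed.

Lemma co2_zero n : co2 c n 0 = 0.
Proof. exact: lin_zero (co2_lin _ _ hc n). Qed.

Lemma coords_neq0 v : v != 0 -> exists n, co1 c n v != 0 \/ co2 c n v != 0.
Proof.
move=> v0; apply: contrapT => no; move/eqP: v0; apply; apply: (co_ext _ _ hc) => n.
  by rewrite co1_zero; apply/eqP; apply: contrapT => /negP h; apply: no; exists n; left.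
by rewrite co2_zero; apply/eqP; apply: contrapT => /negP h; apply: no; exists n; right.
Qed.

Lemma co1_has1 n v : co1 c n v != 0 -> has1 (g n).
Proof. by apply: contraNT => /negbTE h; rewrite (co1_out _ _ hc). Qed.

Lemma co2_has2 n v : co2 c n v != 0 -> has2 (g n).
Proof. by apply: contraNT => /negbTE h; rewrite (co2_out _ _ hc). Qed.

Lemma co1_neq0 n v : co1 c n v != 0 -> v != 0.
Proof. by apply: contra_neq => ->; rewrite co1_zero. Qed.

Lemma co2_neq0 n v : co2 c n v != 0 -> v != 0.
Proof. by apply: contra_neq => ->; rewrite co2_zero. Qed.

(** [coords_of] sees the shapes and degrees of the legs but not their levels, so the same
    coordinates serve the rescaled legs. *)
Lemma coords_of_map f : coords_of c (fun n => map_leg f (g n)).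
Proof.
have e1 n : has1 (map_leg f (g n)) = has1 (g n) by case: (g n).
have e2 n : has2 (map_leg f (g n)) = has2 (g n) by case: (g n).
have e3 n : deg1 (map_leg f (g n)) = deg1 (g n) by case: (g n).
case: hc => *; split=> [n|n|n x y|n x y|n v|n v|v w|n k v|n k v|n v|n v];
  by rewrite ?e1 ?e2 ?e3; auto.
Qed.

Variable l : gsp A -> \bar R.
Hypothesis hl : levels_of c g l.

Lemma level_zero : l 0 = -oo%E.
Proof.
apply/eqP; rewrite -leeNy_eq; apply/hl => n.
by rewrite co1_zero co2_zero eqxx.
Qed.

Lemma level_ultra x y : (l (x + y)%R <= Order.max (l x) (l y))%E.
Proof.
have hx := (hl x (l x)).1 (lexx _); have hy := (hl y (l y)).1 (lexx _).
apply/hl => n; have [x1 x2] := hx n; have [y1 y2] := hy n; split.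
  rewrite (lin_add (co1_lin _ _ hc n)) le_max => xy.
  have [x0|/x1->//] := eqVneq (co1 c n x) 0.
  by rewrite (y1 _) ?orbT //; move: xy; rewrite x0 add0r.
rewrite (lin_add (co2_lin _ _ hc n)) le_max => xy.
have [x0|/x2->//] := eqVneq (co2 c n x) 0.
by rewrite (y2 _) ?orbT //; move: xy; rewrite x0 add0r.
Qed.

Variable Lam : R.
Hypothesis lev1_in : forall n, has1 (g n) -> - Lam < lev1 (g n) < Lam.
Hypothesis lev2_in : forall n, has2 (g n) -> - Lam < lev2 (g n) < Lam.

(** [levels_of] tests only non-strict bounds, hence the intermediate [z], which [legs_at_bound]
    supplies as a maximum over the list. The lower bound comes from any one nonzero coordinate. *)
Lemma level_bounded z : z < Lam ->
  (forall n, (has1 (g n) -> lev1 (g n) <= z) /\ (has2 (g n) -> lev2 (g n) <= z)) ->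
  forall x, x != 0 -> ((- Lam)%:E < l x < Lam%:E)%E.
Proof.
move=> zL hz x x0; apply/andP; split; last first.
  apply: (@le_lt_trans _ _ z%:E); last by rewrite lte_fin.
  apply/hl => n; split=> h; rewrite lee_fin; first by apply: (hz n).1; apply: co1_has1 h.
  by apply: (hz n).2; apply: co2_has2 h.
have [n [h|h]] := coords_neq0 _ x0; have [h1 h2] := (hl x (l x)).1 (lexx _) n.
  by apply: lt_le_trans (h1 h); rewrite lte_fin; case/andP: (lev1_in n (co1_has1 _ _ h)).
by apply: lt_le_trans (h2 h); rewrite lte_fin; case/andP: (lev2_in n (co2_has2 _ _ h)).
Qed.

End CoordinateConsequences.

Arguments co1_zero {K R I A c g} hc n.
Arguments co2_zero {K R I A c g} hc n.
Arguments co1_has1 {K R I A c g} hc {n v} _.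
Arguments co2_has2 {K R I A c g} hc {n v} _.
Arguments co1_neq0 {K R I A c g} hc {n v} _.
Arguments co2_neq0 {K R I A c g} hc {n v} _.
Arguments co1_lin {K R I A c g} _.
Arguments co2_lin {K R I A c g} _.
Arguments co1_mk {K R I A c g} _.
Arguments co2_mk {K R I A c g} _.
Arguments co1_out {K R I A c g} _.
Arguments co2_out {K R I A c g} _.
Arguments co_ext {K R I A c g} _.
Arguments co1_pr {K R I A c g} _.
Arguments co2_pr {K R I A c g} _.
Arguments co1_bd {K R I A c g} _.
Arguments co2_bd {K R I A c g} _.

Definition weights_of {K : fieldType} {R : realType} {I : Type} {A : gcx K}
    (c : coords I A) (g : I -> leg R) (w : gsp A -> R) :=
  forall v z, v != 0 -> w v <= z <->
    forall n, (co1 c n v != 0 -> lev1 (g n) <= z) /\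
              (co2 c n v != 0 -> lev2 (g n) <= z).

Section WeightBounds.
Variables (K : fieldType) (R : realType) (I : Type) (A : gcx K).
Variables (c : coords I A) (g : I -> leg R) (w : gsp A -> R).
Hypotheses (hc : coords_of c g) (hw : weights_of c g w).

Lemma weight_ge1 n v : co1 c n v != 0 -> lev1 (g n) <= w v.
Proof. by move=> h; apply: ((hw v (w v) (co1_neq0 hc h)).1 (lexx _) n).1. Qed.

Lemma weight_ge2 n v : co2 c n v != 0 -> lev2 (g n) <= w v.
Proof. by move=> h; apply: ((hw v (w v) (co2_neq0 hc h)).1 (lexx _) n).2. Qed.

End WeightBounds.

Arguments weight_ge1 {K R I A c g w} hc hw {n v} _.
Arguments weight_ge2 {K R I A c g w} hc hw {n v} _.

(** * Standard cospans in rescaled coordinates *)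

Section StandardWeights.
Variables (K : fieldType) (R : realType) (Lam : R) (phi : \bar R -> R) (phiinv : R -> \bar R).
Hypothesis Lam_gt0 : 0 < Lam.
Hypothesis hphi : incr_homeo Lam phi phiinv.
Local Notation u := (rescale phiinv).

Definition wlegUp (t : summand R) : leg R := map_leg u (legUp t).
(** [legDn] stores negated levels and [phi] need not be odd, so the sign is undone before rescaling
    and restored afterwards. *)
Definition wlegDn (t : summand R) : leg R := map_leg (fun c => - u (- c)) (legDn t).

Lemma legs_at_map (f : R -> R) (h : summand R -> leg R) s n :
  legs_at R (fun t => map_leg f (h t)) s n = map_leg f (legs_at R h s n).
Proof. by rewrite /legs_at; elim: s n => [|t s IH] [|n] //=. Qed.

Lemma legs_atE (h : summand R -> leg R) s n : (n < size s)%N ->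
  legs_at R h s n = h (nth (SBox R 0) s n).
Proof. by move=> ltn; rewrite /legs_at (nth_map (SBox R 0)). Qed.

Lemma legs_at_out (h : summand R -> leg R) s n : (size s <= n)%N -> legs_at R h s n = L0.
Proof. by move=> len; rewrite /legs_at nth_default // size_map. Qed.

Definition leg_inside (x : leg R) :=
  (has1 x -> - Lam < lev1 x < Lam) /\ (has2 x -> - Lam < lev2 x < Lam).

Lemma legUp_inside t : valid_summand Lam t -> leg_inside (legUp t).
Proof. by case: t => [k a b|k a b|k a|k a|k a b|k a|k a|k] //= h; split=> //= _; move: h; lra. Qed.

Lemma legDn_inside t : valid_summand Lam t -> leg_inside (legDn t).
Proof. by case: t => [k a b|k a b|k a|k a|k a b|k a|k a|k] //= h; split=> //= _; move: h; lra. Qed.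

Lemma legs_at_inside (h : summand R -> leg R) s :
  (forall t, valid_summand Lam t -> leg_inside (h t)) ->
  all (valid_summand Lam) s -> forall n, leg_inside (legs_at R h s n).
Proof.
move=> hin vs n; case: (ltnP n (size s)) => hn; last by rewrite legs_at_out //; split.
by rewrite legs_atE //; apply: hin; apply: (all_nthP (SBox R 0) vs).
Qed.

Lemma legs_at_bound (h : summand R -> leg R) s :
  (forall t, valid_summand Lam t -> leg_inside (h t)) ->
  all (valid_summand Lam) s -> exists2 z, z < Lam &
  forall n, (has1 (legs_at R h s n) -> lev1 (legs_at R h s n) <= z) /\
            (has2 (legs_at R h s n) -> lev2 (legs_at R h s n) <= z).
Proof.
move=> hin; elim: s => [|t s IH] /=; first by exists 0 => // n; rewrite legs_at_out.
case/andP=> vt /IH[z zL hz]; have [t1 t2] := hin t vt.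
exists (Num.max z (Num.max (if has1 (h t) then lev1 (h t) else z)
                           (if has2 (h t) then lev2 (h t) else z))).
  rewrite !gt_max zL /=; apply/andP; split.
    by case: ifP => // /t1/andP[].
  by case: ifP => // /t2/andP[].
case=> [|n]; rewrite /legs_at /=.
  by split=> ->; rewrite !le_max lexx ?orbT.
by have [h1 h2] := hz n; split=> h'; rewrite le_max ?h1 ?h2.
Qed.

Lemma co2_stdD s n v : co2 (stdD K R s) n v = 0.
Proof.
rewrite (co2_out (stdDP K R s)) //.
case: (ltnP n (size s)) => hn; last by rewrite legs_at_out.
by rewrite legs_atE //; case: (nth _ _ _).
Qed.

Lemma stdD_ext s v w : (forall n, co1 (stdD K R s) n v = co1 (stdD K R s) n w) -> v = w.
Proof. by move=> h; apply: (co_ext (stdDP K R s)) => // n; rewrite !co2_stdD. Qed.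

Lemma std_gbdD (s : seq (summand R)) v : gbd (Dm (std_cospan K s)) v = 0.
Proof.
by apply: stdD_ext => n; rewrite (co1_bd (stdDP K R s)) co2_stdD (co1_zero (stdDP K R s)).
Qed.

Lemma std_tame s : all (valid_summand Lam) s -> tame Lam (std_cospan K s).
Proof.
move=> vs.
have hU := stdUpP K R s; have hN := stdDnP K R s; have hD := stdDP K R s.
have lU := stdUp_levels K R s; have lN := stdDn_levels K R s.
have iU := legs_at_inside _ _ legUp_inside vs.
have iN := legs_at_inside _ _ legDn_inside vs.
have [zU zUL hzU] := legs_at_bound _ _ legUp_inside vs.
have [zN zNL hzN] := legs_at_bound _ _ legDn_inside vs.
split.
- split; [exact: coords_linear hU|exact: coords_linear hN|exact: coords_linear hD| |];
    move=> a x y; apply: stdD_ext => n.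
    rewrite (co1_lin hD) !std_psiUp (co1_lin hU); case: ifP => // _.
    by rewrite scaler0 addr0.
  rewrite (co1_lin hD) !std_psiDn (co1_lin hN); case: ifP => // _.
  by rewrite scaler0 addr0.
- split; first exact: level_zero hU _ lU.
  by apply: oppe_inj; rewrite (level_zero _ _ _ _ _ _ hN _ lN).
- split=> x x0.
    by apply: (level_bounded _ _ _ _ _ _ hU _ lU _ _ _ zU) => // n; case: (iU n).
  have : ((- Lam)%:E < - ldn (std_cospan K s) x < Lam%:E)%E.
    by apply: (level_bounded _ _ _ _ _ _ hN _ lN _ _ _ zN) => // n; case: (iN n).
  by rewrite lteNr lteNl -!EFinN opprK andbC.
- exact: level_ultra hU _ lU.
- by move=> x y; have := level_ultra _ _ _ _ _ _ hN _ lN x y; rewrite leeNl oppe_max !oppeK.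
Qed.

Lemma lev1_map f (x : leg R) : has1 x -> lev1 (map_leg f x) = f (lev1 x).
Proof. by case: x. Qed.

Lemma lev2_map f (x : leg R) : has2 x -> lev2 (map_leg f x) = f (lev2 x).
Proof. by case: x. Qed.

Definition legsUp s n := legs_at R wlegUp s n.
Definition legsDn s n := legs_at R wlegDn s n.

Lemma legsUpP s : coords_of (stdUp K R s) (legsUp s).
Proof.
rewrite (_ : legsUp s = fun n => map_leg u (legs_at R legUp s n)).
  exact: coords_of_map (stdUpP K R s) u.
by apply/funext => n; rewrite -legs_at_map.
Qed.

Lemma legsDnP s : coords_of (stdDn K R s) (legsDn s).
Proof.
rewrite (_ : legsDn s = fun n => map_leg (fun c => - u (- c)) (legs_at R legDn s n)).
  exact: coords_of_map (stdDnP K R s) (fun c => - u (- c)).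
by apply/funext => n; rewrite -legs_at_map.
Qed.

Lemma stdUp_weights s : all (valid_summand Lam) s ->
  weights_of (stdUp K R s) (legsUp s) (weightUp phiinv (std_cospan K s)).
Proof.
move=> vs v z v0; have [_ _ [bU _] _ _] := std_tame s vs.
have iU := legs_at_inside _ _ legUp_inside vs.
have hU := stdUpP K R s; have lU := stdUp_levels K R s.
have [lE lin] := fin_level _ _ _ (bU v v0).
rewrite /weightUp (rescale_le_phi _ _ _ _ hphi) // -lee_fin -lE lU.
split=> h n; have [h1 h2] := h n; have [i1 i2] := iU n; rewrite ?/legsUp.
  rewrite /wlegUp legs_at_map; split=> cn.
    have hn := co1_has1 hU cn; rewrite lev1_map // (rescale_le_phi _ _ _ _ hphi) ?i1 //.
    by rewrite -lee_fin h1.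
  have hn := co2_has2 hU cn; rewrite lev2_map // (rescale_le_phi _ _ _ _ hphi) ?i2 //.
  by rewrite -lee_fin h2.
move: h1 h2; rewrite /legsUp /wlegUp legs_at_map => h1 h2; split=> cn.
  have hn := co1_has1 hU cn; move: (h1 cn).
  by rewrite lev1_map // (rescale_le_phi _ _ _ _ hphi) ?i1 // lee_fin.
have hn := co2_has2 hU cn; move: (h2 cn).
by rewrite lev2_map // (rescale_le_phi _ _ _ _ hphi) ?i2 // lee_fin.
Qed.

Lemma stdDn_weights s : all (valid_summand Lam) s ->
  weights_of (stdDn K R s) (legsDn s) (weightDn phiinv (std_cospan K s)).
Proof.
move=> vs v z v0; have [_ _ [_ bN] _ _] := std_tame s vs.
have iN := legs_at_inside _ _ legDn_inside vs.
have hN := stdDnP K R s; have lN := stdDn_levels K R s.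
have [lE lin] := fin_level _ _ _ (bN v v0).
have lev (x : R) : - Lam < x < Lam -> (- u (- x) <= z) = (x <= - phi (- z)%:E).
  move=> hx; rewrite lerNl (phi_le_rescale _ _ _ _ hphi (- x)); last by lra.
  exact: lerNr.
rewrite /weightDn lerNl (phi_le_rescale _ _ _ _ hphi _ _ lin) -lee_fin -lE.
rewrite -leeN2 -[X in (_ <= X)%E]EFinN lN.
split=> h n; have [h1 h2] := h n; have [i1 i2] := iN n; rewrite ?/legsDn.
  rewrite /wlegDn legs_at_map; split=> cn.
    have hn := co1_has1 hN cn; rewrite lev1_map // lev ?i1 //.
    by rewrite -lee_fin h1.
  have hn := co2_has2 hN cn; rewrite lev2_map // lev ?i2 //.
  by rewrite -lee_fin h2.
move: h1 h2; rewrite /legsDn /wlegDn legs_at_map => h1 h2; split=> cn.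
  have hn := co1_has1 hN cn; move: (h1 cn).
  by rewrite lev1_map // lev ?i1 // lee_fin.
have hn := co2_has2 hN cn; move: (h2 cn).
by rewrite lev2_map // lev ?i2 // lee_fin.
Qed.

End StandardWeights.

(** * From matchings to interleavings *)

(** One-sided in the levels: it says that sending the generators of [x] to those of [y] is a chain
    map of shift [e]. *)
Definition leg_close {R : realType} (e : R) (x y : leg R) :=
  [/\ has1 x = has1 y, has2 x = has2 y, (has1 x -> deg1 x = deg1 y),
      (has1 x -> lev1 y <= lev1 x + e) & (has2 x -> lev2 y <= lev2 x + e)].

(** An empty leg passes, while a lone cycle never does, having nothing to cancel against. The bound
    [2 * e] is the shift granted to the homotopies of an e-interleaving. *)
Definition leg_small {R : realType} (e : R) (x : leg R) :=
  has1 x -> has2 x /\ lev2 x <= lev1 x + 2 * e.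

(** The index map runs against the linear map: each target index names its source, unmatched targets
    receive 0 and unmatched sources are dropped. *)
Definition pull {K : fieldType} {I J : Type} {A B : gcx K} (c : coords I A) (d : coords J B)
    (h : J -> option I) (v : gsp A) : gsp B :=
  mkv d (fun j => if h j is Some i then co1 c i v else 0)
        (fun j => if h j is Some i then co2 c i v else 0).

(** The contracting homotopy of the unmatched pairs, taking each lower generator to the upper one
    that bounds it. *)
Definition contract {K : fieldType} {I J : Type} {A : gcx K} (c : coords I A)
    (h : I -> option J) (v : gsp A) : gsp A :=
  mkv c (fun _ => 0) (fun i => if h i is Some _ then 0 else co1 c i v).

Section Pull.
Variables (K : fieldType) (R : realType) (I J : Type) (A B : gcx K) (e : R).
Variables (c : coords I A) (d : coords J B) (g : I -> leg R) (g' : J -> leg R).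
Variables (h : J -> option I).
Hypotheses (hc : coords_of c g) (hd : coords_of d g').
Hypothesis h_close : forall i j, h j = Some i -> leg_close e (g i) (g' j).

Lemma co1_pull j v : co1 d j (pull c d h v) = if h j is Some i then co1 c i v else 0.
Proof.
rewrite (co1_mk hd); case hj : (h j) => [i|]; last by rewrite if_same.
case: (h_close _ _ hj) => e1 _ _ _ _; case: ifPn => // /negbTE n1.
by rewrite (co1_out hc) // e1.
Qed.

Lemma co2_pull j v : co2 d j (pull c d h v) = if h j is Some i then co2 c i v else 0.
Proof.
rewrite (co2_mk hd); case hj : (h j) => [i|]; last by rewrite if_same.
case: (h_close _ _ hj) => _ e1 _ _ _; case: ifPn => // /negbTE n1.
by rewrite (co2_out hc) // e1.
Qed.

Lemma pull_gdeg : gdeg A B 0 (pull c d h).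
Proof.
split=> [a v w|k v]; apply: (co_ext hd) => j.
- rewrite (co1_lin hd) !co1_pull; case: (h j) => [i|]; last by rewrite scaler0 addr0.
  by rewrite (co1_lin hc).
- rewrite (co2_lin hd) !co2_pull; case: (h j) => [i|]; last by rewrite scaler0 addr0.
  by rewrite (co2_lin hc).
- rewrite subr0 (co1_pr hd) co1_pull; case hj : (h j) => [i|]; last by rewrite if_same.
  rewrite (co1_pr hc); case: (h_close _ _ hj) => e1 e2 e3 _ _.
  case h1 : (has1 (g i)); first by rewrite e3 //; case: (k == _).
  by rewrite (co1_out hc) // !if_same.
- rewrite subr0 (co2_pr hd) co2_pull; case hj : (h j) => [i|]; last by rewrite if_same.
  rewrite (co2_pr hc); case: (h_close _ _ hj) => e1 e2 e3 _ _.
  case h1 : (has1 (g i)); first by rewrite e3 //; case: (k == _).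
  by rewrite (co2_out hc) ?if_same //; move: h1; case: (g i).
Qed.

Lemma pull_gbd v : gbd B (pull c d h v) = pull c d h (gbd A v).
Proof.
apply: (co_ext hd) => j.
  by rewrite (co1_bd hd) co2_pull co1_pull; case: (h j) => // i; rewrite (co1_bd hc).
by rewrite (co2_bd hd) co2_pull; case: (h j) => // i; rewrite (co2_bd hc).
Qed.

Lemma pull_shift (wA : gsp A -> R) (wB : gsp B -> R) :
  weights_of c g wA -> weights_of d g' wB -> shifted_by wA wB e (pull c d h).
Proof.
move=> hwA hwB v pv; apply/hwB => // j; split.
  rewrite co1_pull; case hj : (h j) => [i|]; last by rewrite eqxx.
  move=> cv; case: (h_close _ _ hj) => _ _ _ l1 _.
  by have := l1 (co1_has1 hc cv); have := weight_ge1 hc hwA cv; lra.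
rewrite co2_pull; case hj : (h j) => [i|]; last by rewrite eqxx.
move=> cv; case: (h_close _ _ hj) => _ _ _ _ l2.
by have := l2 (co2_has2 hc cv); have := weight_ge2 hc hwA cv; lra.
Qed.

End Pull.

Section Contract.
Variables (K : fieldType) (R : realType) (I J : Type) (A B : gcx K) (e : R).
Variables (c : coords I A) (d : coords J B) (g : I -> leg R) (g' : J -> leg R).
Variables (h : J -> option I) (h' : I -> option J).
Hypotheses (hc : coords_of c g) (hd : coords_of d g').
Hypothesis h_close : forall i j, h j = Some i -> leg_close e (g i) (g' j).
Hypothesis h'_close : forall j i, h' i = Some j -> leg_close e (g' j) (g i).
Hypothesis hK : forall i j, h' i = Some j -> h j = Some i.

Lemma co1_pullpull i v : co1 c i (pull d c h' (pull c d h v)) =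
  if h' i is Some _ then co1 c i v else 0.
Proof.
rewrite (co1_pull _ _ _ _ _ _ _ _ _ _ _ _ hd hc h'_close).
case hi: (h' i) => [j|] //.
by rewrite (co1_pull _ _ _ _ _ _ _ _ _ _ _ _ hc hd h_close) (hK _ _ hi).
Qed.

Lemma co2_pullpull i v : co2 c i (pull d c h' (pull c d h v)) =
  if h' i is Some _ then co2 c i v else 0.
Proof.
rewrite (co2_pull _ _ _ _ _ _ _ _ _ _ _ _ hd hc h'_close).
case hi: (h' i) => [j|] //.
by rewrite (co2_pull _ _ _ _ _ _ _ _ _ _ _ _ hc hd h_close) (hK _ _ hi).
Qed.

Hypothesis h_small : forall i, h' i = None -> leg_small e (g i).

Lemma co1_contract i v : co1 c i (contract c h' v) = 0.
Proof. by rewrite (co1_mk hc) if_same. Qed.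

Lemma co2_contract i v : co2 c i (contract c h' v) = if h' i is Some _ then 0 else co1 c i v.
Proof.
rewrite (co2_mk hc); case hi : (h' i) => [j|]; first by rewrite if_same.
case h2 : (has2 (g i)) => //; case h1 : (has1 (g i)); last by rewrite (co1_out hc).
by have [] := h_small _ hi h1; rewrite h2.
Qed.

Lemma contract_gdeg : gdeg A A (-1) (contract c h').
Proof.
split=> [a v w|k v]; apply: (co_ext hc) => i.
- by rewrite (co1_lin hc) !co1_contract scaler0 addr0.
- rewrite (co2_lin hc) !co2_contract; case: (h' i) => [_|]; first by rewrite scaler0 addr0.
  by rewrite (co1_lin hc).
- by rewrite (co1_pr hc) co1_contract if_same.
- rewrite (co2_pr hc) co2_contract; case: (h' i) => [_|]; first by rewrite if_same.
  rewrite (co1_pr hc) opprK; have -> : (k + 1 == deg1 (g i) + 1) = (k == deg1 (g i)).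
    by apply/eqP/eqP => [/addIr|->].
  by case: (k == _).
Qed.

Lemma contract_shift (wA : gsp A -> R) :
  weights_of c g wA -> shifted_by wA wA (2 * e) (contract c h').
Proof.
move=> hw v kv; apply/hw => // i; split; first by rewrite co1_contract eqxx.
rewrite co2_contract; case hi : (h' i) => [j|]; first by rewrite eqxx.
move=> cv; have [_] := h_small _ hi (co1_has1 hc cv).
by have := weight_ge1 hc hw cv; lra.
Qed.

(** At matched indices both sides vanish. At unmatched ones the double pull is 0 and [contract] is a
    contracting homotopy, so both sides have the coordinates of [- v]. *)
Lemma pullpull_contract v : pull d c h' (pull c d h v) - v =
  - gbd A (contract c h' v) - contract c h' (gbd A v).
Proof.
have l1 i := co1_lin hc i; have l2 i := co2_lin hc i.
apply: (co_ext hc) => i.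
  rewrite !(lin_sub (l1 i)) (lin_opp (l1 i)) co1_pullpull (co1_bd hc) co2_contract co1_contract.
  by case: (h' i) => [_|]; rewrite ?subrr ?sub0r ?oppr0 ?addr0.
rewrite !(lin_sub (l2 i)) (lin_opp (l2 i)) co2_pullpull (co2_bd hc) co2_contract.
case: (h' i) => [_|]; first by rewrite subrr oppr0 addr0.
by rewrite (co1_bd hc) oppr0.
Qed.

End Contract.

(** * Types and rescaled parameters of summands *)

Section Labels.
Variables (R : realType) (phiinv : R -> \bar R).
Local Notation u := (rescale phiinv).

(** The numbers merely separate the constructors; pairing them with the degree puts labels in a type
    with decidable equality. *)
Definition label (t : summand R) : nat * int :=
  match t with
  | SUp k _ _ => (0%N, k) | SDn k _ _ => (1%N, k) | SUpInf k _ => (2%N, k)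
  | SDnInf k _ => (3%N, k) | SGt k _ _ => (4%N, k) | SSE k _ => (5%N, k)
  | SNE k _ => (6%N, k) | SBox k => (7%N, k)
  end.

(* Rescaled parameters, oriented so that a nonzero coefficient of an e-shifted
   morphism can raise neither of them by more than e. *)
Definition par1 (t : summand R) : R :=
  match t with
  | SUp _ a _ | SUpInf _ a | SNE _ a => u a
  | SDn _ a _ | SDnInf _ a | SGt _ a _ | SSE _ a => - u a
  | SBox _ => 0
  end.
Definition par2 (t : summand R) : R :=
  match t with
  | SUp _ _ b => u b | SDn _ _ b => - u b | SGt _ _ b => u b | _ => 0
  end.

Definition persistent (e : R) (t : summand R) :=
  match t with
  | SUp _ _ _ | SDn _ _ _ => par1 t + 2 * e < par2 t
  | _ => true
  end.

Definition summand_close (e : R) (t t' : summand R) :=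
  [/\ label t = label t', par1 t <= par1 t' + e, par1 t' <= par1 t + e,
      par2 t <= par2 t' + e & par2 t' <= par2 t + e].

Lemma summand_close_sym e t t' : summand_close e t t' -> summand_close e t' t.
Proof. by case=> *; split. Qed.

Lemma summand_close_legs e t t' : 0 <= e -> summand_close e t t' ->
  [/\ leg_close e (wlegUp R phiinv t) (wlegUp R phiinv t'),
      leg_close e (wlegDn R phiinv t) (wlegDn R phiinv t'),
      leg_close e (legD t) (legD t'),
      linkUp t = linkUp t' & linkDn t = linkDn t'].
Proof.
move=> e0; case: t => [k a b|k a b|k a|k a|k a b|k a|k a|k];
  case: t' => [k' a' b'|k' a' b'|k' a'|k' a'|k' a' b'|k' a'|k' a'|k'];
  case=> //= -[] // kk h1 h2 h3 h4; split=> //; split=> //= _; rewrite ?opprK //; lra.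
Qed.

Lemma persistentN_legs e t : ~~ persistent e t ->
  [/\ leg_small e (wlegUp R phiinv t), leg_small e (wlegDn R phiinv t)
    & has1 (legD t) = false].
Proof.
by case: t => [k a b|k a b|k a|k a|k a b|k a|k a|k] //=; rewrite -leNgt => h; split=> //= _;
  split=> //=; rewrite ?opprK.
Qed.

End Labels.

Arguments label {R} t.
Arguments par1 {R} phiinv t.
Arguments par2 {R} phiinv t.
Arguments persistent {R} phiinv e t.
Arguments summand_close {R} phiinv e t t'.

Section MatchingToInterleaving.
Variables (K : fieldType) (R : realType) (Lam : R) (phi : \bar R -> R) (phiinv : R -> \bar R).
Hypothesis Lam_gt0 : 0 < Lam.
Hypothesis hphi : incr_homeo Lam phi phiinv.
Local Notation at_ s := (nth (SBox R 0) s).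

(** Both partial inverses are kept as data because [pull] needs an index map for each of the two
    directions. *)
Definition summand_matching (e : R) (s s' : seq (summand R)) (h : nat -> option nat)
    (h' : nat -> option nat) :=
  [/\ forall i j, h i = Some j <-> h' j = Some i,
      forall i j, h i = Some j -> [/\ (i < size s)%N, (j < size s')%N
        & summand_close phiinv e (at_ s i) (at_ s' j)],
      forall i, (i < size s)%N -> h i = None -> ~~ persistent phiinv e (at_ s i)
    & forall j, (j < size s')%N -> h' j = None -> ~~ persistent phiinv e (at_ s' j)].

Lemma summand_matching_sym e s s' h h' :
  summand_matching e s s' h h' -> summand_matching e s' s h' h.
Proof.
case=> m1 m2 m3 m4; split=> // [i j|i j]; first by split=> /m1.
by move=> /m1/m2[h1 h2 h3]; split=> //; apply: summand_close_sym.
Qed.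

(** The last two components can be 0: matched summands have the same links, so the pulls commute
    strictly with the structure maps. *)
Definition pull_mor (s s' : seq (summand R)) (h' : nat -> option nat) :
    mor (std_cospan K s) (std_cospan K s') :=
  @Mor K R (std_cospan K s) (std_cospan K s')
    (pull (stdDn K R s) (stdDn K R s') h') (pull (stdUp K R s) (stdUp K R s') h')
    (pull (stdD K R s) (stdD K R s') h') (fun _ => 0) (fun _ => 0).

Section OneSide.
Variables (e : R) (s s' : seq (summand R)) (h h' : nat -> option nat).
Hypotheses (e_ge0 : 0 <= e) (vs : all (valid_summand Lam) s) (vs' : all (valid_summand Lam) s').
Hypothesis hm : summand_matching e s s' h h'.

Lemma matched_legs i j : h' j = Some i ->
  [/\ leg_close e (legsUp R phiinv s i) (legsUp R phiinv s' j),
      leg_close e (legsDn R phiinv s i) (legsDn R phiinv s' j),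
      leg_close e (legs_at R legD s i) (legs_at R legD s' j),
      nth false (map linkUp s) i = nth false (map linkUp s') j
    & nth false (map linkDn s) i = nth false (map linkDn s') j].
Proof.
case: hm => m1 m2 _ _ /m1/m2[hi hj hij].
rewrite /legsUp /legsDn !legs_atE // !(nth_map (SBox R 0)) //.
exact: summand_close_legs.
Qed.

Lemma unmatched_legs i : h i = None ->
  [/\ leg_small e (legsUp R phiinv s i), leg_small e (legsDn R phiinv s i)
    & has1 (legs_at R legD s i) = false].
Proof.
case: hm => _ _ m3 _ hi; rewrite /legsUp /legsDn.
case: (ltnP i (size s)) => si; last by rewrite !legs_at_out.
by rewrite !legs_atE //; apply: persistentN_legs; apply: m3.
Qed.

Lemma gdeg_zero (A B : gcx K) m : linear_complex B -> gdeg A B m (fun _ => 0).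
Proof.
move=> [_ lB]; split=> [a x y|k x]; first by rewrite scaler0 addr0.
exact: lin_zero (lB _).
Qed.

Lemma pull_mor_shift : shift_mor phiinv 0 e (pull_mor s s' h').
Proof.
have [lU lN lD _ _] : linear_cospan (std_cospan K s').
  by case: (std_tame K R _ Lam_gt0 _ vs').
have cU i j : h' j = Some i -> leg_close e (legsUp R phiinv s i) (legsUp R phiinv s' j).
  by case/matched_legs.
have cN i j : h' j = Some i -> leg_close e (legsDn R phiinv s i) (legsDn R phiinv s' j).
  by case/matched_legs.
have cD i j : h' j = Some i -> leg_close e (legs_at R legD s i) (legs_at R legD s' j).
  by case/matched_legs.
split=> /=.
- exact: pull_gdeg (legsDnP K R phiinv s) (legsDnP K R phiinv s') cN.
- exact: pull_gdeg (legsUpP K R phiinv s) (legsUpP K R phiinv s') cU.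
- exact: pull_gdeg (stdDP K R s) (stdDP K R s') cD.
- by split; apply: gdeg_zero.
- split.
    apply: pull_shift (legsUpP K R phiinv s) (legsUpP K R phiinv s') cU _ _ _ _;
      exact: stdUp_weights hphi _ _.
  apply: pull_shift (legsDnP K R phiinv s) (legsDnP K R phiinv s') cN _ _ _ _;
    exact: stdDn_weights hphi _ _.
Qed.

Lemma pull_mor_closed : closed_mor (pull_mor s s' h').
Proof.
have cU i j : h' j = Some i -> leg_close e (legsUp R phiinv s i) (legsUp R phiinv s' j).
  by case/matched_legs.
have cN i j : h' j = Some i -> leg_close e (legsDn R phiinv s i) (legsDn R phiinv s' j).
  by case/matched_legs.
have cD i j : h' j = Some i -> leg_close e (legs_at R legD s i) (legs_at R legD s' j).
  by case/matched_legs.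
apply/closed_morP; split=> x /=.
- exact: pull_gbd (legsDnP K R phiinv s) (legsDnP K R phiinv s') cN _.
- exact: pull_gbd (legsUpP K R phiinv s) (legsUpP K R phiinv s') cU _.
- exact: pull_gbd (stdDP K R s) (stdDP K R s') cD _.
- rewrite std_gbdD !addr0; apply: stdD_ext => j.
  rewrite (co1_pull _ _ _ _ _ _ _ _ _ _ _ _ (stdDP K R s) (stdDP K R s') cD) std_psiDn.
  rewrite (co1_pull _ _ _ _ _ _ _ _ _ _ _ _ (legsDnP K R phiinv s) (legsDnP K R phiinv s') cN).
  case hj : (h' j) => [i|]; last by rewrite if_same.
  by rewrite std_psiDn; case: (matched_legs _ _ hj) => _ _ _ _ ->.
- rewrite std_gbdD !addr0; apply: stdD_ext => j.
  rewrite (co1_pull _ _ _ _ _ _ _ _ _ _ _ _ (stdDP K R s) (stdDP K R s') cD) std_psiUp.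
  rewrite (co1_pull _ _ _ _ _ _ _ _ _ _ _ _ (legsUpP K R phiinv s) (legsUpP K R phiinv s') cU).
  case hj : (h' j) => [i|]; last by rewrite if_same.
  by rewrite std_psiUp; case: (matched_legs _ _ hj) => _ _ _ -> _.
Qed.

End OneSide.

(** Unmatched summands are short pairs, which live in a single leg and have no middle term.
    Contracting them in the legs is the whole homotopy, and in the middle the composite is already
    the identity. *)
Lemma pull_mor_homotopic e s s' h h' :
  0 <= e -> all (valid_summand Lam) s -> all (valid_summand Lam) s' ->
  summand_matching e s s' h h' ->
  homotopic phiinv (2 * e) (Defs.comp (pull_mor s' s h) (pull_mor s s' h'))
    (idmor (std_cospan K s)).
Proof.
move=> e0 vs vs' hm; have hm' := summand_matching_sym _ _ _ _ _ hm.
have [lU lN lD lpU lpN] : linear_cospan (std_cospan K s).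
  by case: (std_tame K R _ Lam_gt0 _ vs).
have hK i j : h i = Some j -> h' j = Some i by case: hm => m1 _ _ _ /m1.
have cU i j : h' j = Some i -> leg_close e (legsUp R phiinv s i) (legsUp R phiinv s' j).
  by case/(matched_legs _ _ _ _ _ e0 hm).
have cN i j : h' j = Some i -> leg_close e (legsDn R phiinv s i) (legsDn R phiinv s' j).
  by case/(matched_legs _ _ _ _ _ e0 hm).
have cD i j : h' j = Some i -> leg_close e (legs_at R legD s i) (legs_at R legD s' j).
  by case/(matched_legs _ _ _ _ _ e0 hm).
have cU' j i : h i = Some j -> leg_close e (legsUp R phiinv s' j) (legsUp R phiinv s i).
  by case/(matched_legs _ _ _ _ _ e0 hm').
have cN' j i : h i = Some j -> leg_close e (legsDn R phiinv s' j) (legsDn R phiinv s i).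
  by case/(matched_legs _ _ _ _ _ e0 hm').
have cD' j i : h i = Some j -> leg_close e (legs_at R legD s' j) (legs_at R legD s i).
  by case/(matched_legs _ _ _ _ _ e0 hm').
have smU i : h i = None -> leg_small e (legsUp R phiinv s i).
  by case/(unmatched_legs _ _ _ _ _ hm).
have smN i : h i = None -> leg_small e (legsDn R phiinv s i).
  by case/(unmatched_legs _ _ _ _ _ hm).
have hU := legsUpP K R phiinv s; have hU' := legsUpP K R phiinv s'.
have hN := legsDnP K R phiinv s; have hN' := legsDnP K R phiinv s'.
exists (@Mor K R (std_cospan K s) (std_cospan K s) (contract (stdDn K R s) h)
   (contract (stdUp K R s) h) (fun _ => 0) (fun _ => 0) (fun _ => 0)); split.
  split=> /=.
  - exact: contract_gdeg hN smN.
  - exact: contract_gdeg hU smU.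
  - exact: gdeg_zero.
  - by split; apply: gdeg_zero.
  - split; first by apply: contract_shift hU smU _ _; apply: stdUp_weights hphi _ _.
    by apply: contract_shift hN smN _ _; apply: stdDn_weights hphi _ _.
have lpull : lin (pull (stdD K R s') (stdD K R s) h).
  by case: (pull_gdeg _ _ _ _ _ _ _ _ _ _ _ _ (stdDP K R s') (stdDP K R s) cD').
rewrite deltam1E; split=> x /=.
- exact: pullpull_contract hN hN' cN cN' hK smN x.
- exact: pullpull_contract hU hU' cU cU' hK smU x.
- rewrite std_gbdD addr0; apply/eqP; rewrite subr_eq0; apply/eqP.
  apply: stdD_ext => i.
  rewrite (co1_pullpull _ _ _ _ _ _ _ _ _ _ _ _ _ (stdDP K R s) (stdDP K R s') cD cD' hK).
  case hi : (h i) => [//|]; rewrite (co1_out (stdDP K R s)) //.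
  by case: (unmatched_legs _ _ _ _ _ hm i hi).
(* The contraction has only upper coordinates, whereas the structure maps read only lower ones. *)
- rewrite (lin_zero lpull) std_gbdD !addr0 !subr0; apply/esym; apply: stdD_ext => i.
  by rewrite std_psiDn (co1_contract _ _ _ _ _ _ _ _ hN) (co1_zero (stdDP K R s)) if_same.
- rewrite (lin_zero lpull) std_gbdD !addr0 !subr0; apply/esym; apply: stdD_ext => i.
  by rewrite std_psiUp (co1_contract _ _ _ _ _ _ _ _ hU) (co1_zero (stdDP K R s)) if_same.
Qed.

Lemma matching_interleaved e s s' h h' :
  0 <= e -> all (valid_summand Lam) s -> all (valid_summand Lam) s' ->
  summand_matching e s s' h h' ->
  interleaved phiinv e (std_cospan K s) (std_cospan K s').
Proof.
move=> e0 vs vs' hm; have hm' := summand_matching_sym _ _ _ _ _ hm.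
exists (pull_mor s s' h'), (pull_mor s' s h); split.
- by split; [apply: pull_mor_shift hm|apply: pull_mor_closed hm].
- by split; [apply: pull_mor_shift hm'|apply: pull_mor_closed hm'].
- exact: pull_mor_homotopic hm.
- exact: pull_mor_homotopic hm'.
Qed.

End MatchingToInterleaving.

(** * From interleavings to matchings *)

Definition gen1 {K : fieldType} {A : gcx K} (c : coords nat A) (i : nat) : gsp A :=
  mkv c (fun n => (n == i)%:R) (fun _ => 0).
Definition gen2 {K : fieldType} {A : gcx K} (c : coords nat A) (i : nat) : gsp A :=
  mkv c (fun _ => 0) (fun n => (n == i)%:R).

Section Generators.
Variables (K : fieldType) (R : realType) (A : gcx K) (c : coords nat A) (g : nat -> leg R).
Hypothesis hc : coords_of c g.

Lemma co1_gen1 i n : has1 (g i) -> co1 c n (gen1 c i) = (n == i)%:R.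
Proof. by move=> hi; rewrite (co1_mk hc); case: eqP => [->|_]; rewrite ?hi ?if_same. Qed.

Lemma co2_gen1 i n : co2 c n (gen1 c i) = 0.
Proof. by rewrite (co2_mk hc) if_same. Qed.

Lemma co1_gen2 i n : co1 c n (gen2 c i) = 0.
Proof. by rewrite (co1_mk hc) if_same. Qed.

Lemma co2_gen2 i n : has2 (g i) -> co2 c n (gen2 c i) = (n == i)%:R.
Proof. by move=> hi; rewrite (co2_mk hc); case: eqP => [->|_]; rewrite ?hi ?if_same. Qed.

Lemma has2_has1 (x : leg R) : has2 x -> has1 x.
Proof. by case: x. Qed.

Lemma gbd_gen1 i : gbd A (gen1 c i) = 0.
Proof.
by apply: (co_ext hc) => n;
  rewrite ?(co1_bd hc) ?(co2_bd hc) ?co2_gen1 ?(co1_zero hc) ?(co2_zero hc).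
Qed.

Lemma gbd_gen2 i : has2 (g i) -> gbd A (gen2 c i) = gen1 c i.
Proof.
move=> hi; apply: (co_ext hc) => n; last by rewrite (co2_bd hc) co2_gen1.
by rewrite (co1_bd hc) co2_gen2 // co1_gen1 // has2_has1.
Qed.

Lemma gpr_gen1 i : has1 (g i) -> gpr A (deg1 (g i)) (gen1 c i) = gen1 c i.
Proof.
move=> hi; apply: (co_ext hc) => n; last by rewrite (co2_pr hc) !co2_gen1 if_same.
rewrite (co1_pr hc) !co1_gen1 //; case: (eqVneq n i) => [->|_]; first by rewrite eqxx.
by rewrite if_same.
Qed.

Lemma expand_gen1 N (W : lmodType K) (f : gsp A -> W) v : lin f ->
  (forall n, (N <= n)%N -> g n = L0) -> (forall n, co2 c n v = 0) ->
  f v = \sum_(n < N) co1 c n v *: f (gen1 c n).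
Proof.
move=> lf gN v2; have {1}-> : v = \sum_(n < N) co1 c n v *: gen1 c n.
  apply: (co_ext hc) => n.
    rewrite (lin_bigsum (co1_lin hc n)); case: (boolP (has1 (g n))) => hn; last first.
      rewrite (co1_out hc) ?big1 // ?(negbTE hn) // => i _.
      by rewrite (co1_out hc) // (negbTE hn).
    have nN : (n < N)%N by rewrite ltnNge; apply: contraL hn => /gN ->.
    rewrite (bigD1 (Ordinal nN)) //= big1 ?addr0.
      by rewrite (lin_scale (co1_lin hc n)) co1_gen1 // eqxx /= /GRing.scale /= mulr1.
    move=> i /eqP ni; rewrite (lin_scale (co1_lin hc n)) (co1_mk hc) hn.
    case: eqP => [e|_]; first by case: ni; apply: val_inj.
    by rewrite scaler0.
  rewrite v2 (lin_bigsum (co2_lin hc n)) big1 // => i _.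
  by rewrite (lin_scale (co2_lin hc n)) co2_gen1 scaler0.
by rewrite (lin_bigsum lf); apply: eq_bigr => n _; rewrite (lin_scale lf).
Qed.

Variable w : gsp A -> R.
Hypothesis hw : weights_of c g w.

Lemma weight_gen1 i : has1 (g i) -> w (gen1 c i) <= lev1 (g i).
Proof.
move=> hi; apply/hw => [|n].
  by apply: (co1_neq0 hc (n := i)); rewrite co1_gen1 // eqxx oner_eq0.
by rewrite co1_gen1 // co2_gen1 eqxx; split=> //; case: (eqVneq n i) => [->//|_]; rewrite eqxx.
Qed.

Lemma weight_gen2 i : has2 (g i) -> w (gen2 c i) <= lev2 (g i).
Proof.
move=> hi; apply/hw => [|n].
  by apply: (co2_neq0 hc (n := i)); rewrite co2_gen2 // eqxx oner_eq0.
by rewrite co2_gen2 // co1_gen2 eqxx; split=> //; case: (eqVneq n i) => [->//|_]; rewrite eqxx.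
Qed.

End Generators.

Section LegMaps.
Variables (K : fieldType) (R : realType) (A B : gcx K).
Variables (c : coords nat A) (d : coords nat B) (g g' : nat -> leg R).
Variables (wA : gsp A -> R) (wB : gsp B -> R).
Hypotheses (hc : coords_of c g) (hd : coords_of d g').
Hypotheses (hwA : weights_of c g wA) (hwB : weights_of d g' wB).

(** Degree and lower level are read off the image of [gen1]. When the source is a pair, [gen1] is
    the boundary of [gen2], so the same coefficient is an upper coordinate of [f (gen2 c i)]; this
    forces a pair in the target and bounds its upper level. *)
Lemma leg_coef_supp e (f : gsp A -> gsp B) i j :
  gdeg A B 0 f -> (forall x, gbd B (f x) = f (gbd A x)) -> shifted_by wA wB e f ->
  has1 (g i) -> co1 d j (f (gen1 c i)) != 0 ->
  [/\ has1 (g' j), deg1 (g i) = deg1 (g' j), lev1 (g' j) <= lev1 (g i) + e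
    & has2 (g i) -> has2 (g' j) /\ lev2 (g' j) <= lev2 (g i) + e].
Proof.
move=> [lf df] bf sf hi nz; split.
- exact: (co1_has1 hd nz).
- move: nz; rewrite -{1}(gpr_gen1 _ _ _ _ _ hc i hi) -df (co1_pr hd) subr0.
  by case: (eqVneq (deg1 (g i)) _) => // _; rewrite eqxx.
- have := weight_ge1 hd hwB nz; have := weight_gen1 _ _ _ _ _ hc _ hwA i hi.
  by have := sf _ (co1_neq0 hd nz); lra.
- move=> hi2; rewrite -(gbd_gen2 _ _ _ _ _ hc i hi2) -bf (co1_bd hd) in nz.
  split; first exact: (co2_has2 hd nz).
  have := weight_ge2 hd hwB nz; have := weight_gen2 _ _ _ _ _ hc _ hwA i hi2.
  by have := sf _ (co2_neq0 hd nz); lra.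
Qed.

(** The image of the cycle [gen1] is a cycle, hence has no upper coordinates; so lower generators
    alone multiply like matrices. *)
Lemma leg_coef_comp N (f : gsp A -> gsp B) (f' : gsp B -> gsp A) i i' :
  (forall x, gbd B (f x) = f (gbd A x)) -> lin f -> lin f' ->
  (forall n, (N <= n)%N -> g' n = L0) ->
  co1 c i' (f' (f (gen1 c i))) =
    \sum_(j < N) co1 c i' (f' (gen1 d j)) * co1 d j (f (gen1 c i)).
Proof.
move=> bf lf lf' gN.
rewrite (expand_gen1 _ _ _ _ _ hd N _ f' _ lf' gN); last first.
  by move=> n; rewrite -(co1_bd hd) bf (gbd_gen1 _ _ _ _ _ hc) (lin_zero lf) (co1_zero hd).
rewrite (lin_bigsum (co1_lin hc i')); apply: eq_bigr => j _.
by rewrite (lin_scale (co1_lin hc i')) mulrC.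
Qed.

(** On the cycle [gen1] the homotopy contributes only a boundary, whose coordinate at [i'] is an
    upper coordinate of [h (gen1 c i)]. The last hypothesis puts that upper generator out of reach
    of the shift. *)
Lemma leg_homotopy e (h : gsp A -> gsp A) (f : gsp A -> gsp A) i i' :
  lin h -> shifted_by wA wA e h ->
  (forall x, f x - x = - gbd A (h x) - h (gbd A x)) -> has1 (g i) ->
  (has2 (g i') -> lev1 (g i) + e < lev2 (g i')) ->
  co1 c i' (f (gen1 c i)) = (i' == i)%:R.
Proof.
move=> lh sh hf hi far.
have := hf (gen1 c i); rewrite (gbd_gen1 _ _ _ _ _ hc) (lin_zero lh) subr0 => /(congr1 (co1 c i')).
rewrite (lin_sub (co1_lin hc i')) (lin_opp (co1_lin hc i')) (co1_bd hc).
rewrite (co1_gen1 _ _ _ _ _ hc) //.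
have [->|nz] := eqVneq (co2 c i' (h (gen1 c i))) 0.
  by rewrite oppr0 => /eqP; rewrite subr_eq0 => /eqP.
move=> _; exfalso.
have := weight_ge2 hc hwA nz; have := weight_gen1 _ _ _ _ _ hc _ hwA i hi.
by have := sh _ (co2_neq0 hc nz); have := far (co2_has2 hc nz); lra.
Qed.

End LegMaps.

(** * Coefficient matrices of an interleaving *)

Section Coefficients.
Variables (K : fieldType) (R : realType) (Lam : R) (phi : \bar R -> R) (phiinv : R -> \bar R).
Hypothesis Lam_gt0 : 0 < Lam.
Hypothesis hphi : incr_homeo Lam phi phiinv.
Local Notation at_ s := (nth (SBox R 0) s).

Section OneMorphism.
Variables (e : R) (s s' : seq (summand R)) (f : mor (std_cospan K s) (std_cospan K s')).
Hypotheses (e_ge0 : 0 <= e) (vs : all (valid_summand Lam) s) (vs' : all (valid_summand Lam) s').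
Hypotheses (sf : shift_mor phiinv 0 e f) (cf : closed_mor f).

Definition coefUp j i := co1 (stdUp K R s') j (mUp f (gen1 (stdUp K R s) i)).
Definition coefDn j i := co1 (stdDn K R s') j (mDn f (gen1 (stdDn K R s) i)).
Definition coefD j i := co1 (stdD K R s') j (mD f (gen1 (stdD K R s) i)).

(** Summands without a middle term are read in their only leg; all others in the middle, where
    homotopic maps coincide. *)
Definition coef_class (t : summand R) j i :=
  match t with
  | SUp _ _ _ | SUpInf _ _ => coefUp j i
  | SDn _ _ _ | SDnInf _ _ => coefDn j i
  | _ => coefD j i
  end.

(** Entries between different labels are cut off so that the support condition holds; [coef_comp]
    shows that the products concerned do not notice. *)
Definition coef j i :=
  if label (at_ s i) == label (at_ s' j) then coef_class (at_ s i) j i else 0.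

Lemma coefUp_supp i j : (i < size s)%N -> has1 (wlegUp R phiinv (at_ s i)) -> coefUp j i != 0 ->
  [/\ (j < size s')%N, has1 (wlegUp R phiinv (at_ s' j)),
      deg1 (wlegUp R phiinv (at_ s i)) = deg1 (wlegUp R phiinv (at_ s' j)),
      lev1 (wlegUp R phiinv (at_ s' j)) <= lev1 (wlegUp R phiinv (at_ s i)) + e
    & has2 (wlegUp R phiinv (at_ s i)) -> has2 (wlegUp R phiinv (at_ s' j)) /\
      lev2 (wlegUp R phiinv (at_ s' j)) <= lev2 (wlegUp R phiinv (at_ s i)) + e].
Proof.
move=> si hi nz; have [_ cU _ _ _] := (closed_morP _ _ _ _ _).1 cf.
have [_ dU _ _ [sU _]] := sf.
have hi' : has1 (legsUp R phiinv s i) by rewrite /legsUp legs_atE.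
have := leg_coef_supp _ _ _ _ _ _ _ _ _ _ (legsUpP K R phiinv s) (legsUpP K R phiinv s')
  (stdUp_weights K R Lam phi phiinv Lam_gt0 hphi s vs)
  (stdUp_weights K R Lam phi phiinv Lam_gt0 hphi s' vs') e _ i j dU cU sU hi' nz.
have sj : (j < size s')%N.
  rewrite ltnNge; apply/negP => js; have := co1_has1 (legsUpP K R phiinv s') nz.
  by rewrite /legsUp legs_at_out.
by rewrite /legsUp !legs_atE // => -[*]; split.
Qed.

Lemma coefDn_supp i j : (i < size s)%N -> has1 (wlegDn R phiinv (at_ s i)) -> coefDn j i != 0 ->
  [/\ (j < size s')%N, has1 (wlegDn R phiinv (at_ s' j)),
      deg1 (wlegDn R phiinv (at_ s i)) = deg1 (wlegDn R phiinv (at_ s' j)),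
      lev1 (wlegDn R phiinv (at_ s' j)) <= lev1 (wlegDn R phiinv (at_ s i)) + e
    & has2 (wlegDn R phiinv (at_ s i)) -> has2 (wlegDn R phiinv (at_ s' j)) /\
      lev2 (wlegDn R phiinv (at_ s' j)) <= lev2 (wlegDn R phiinv (at_ s i)) + e].
Proof.
move=> si hi nz; have [cN _ _ _ _] := (closed_morP _ _ _ _ _).1 cf.
have [dN _ _ _ [_ sN]] := sf.
have hi' : has1 (legsDn R phiinv s i) by rewrite /legsDn legs_atE.
have := leg_coef_supp _ _ _ _ _ _ _ _ _ _ (legsDnP K R phiinv s) (legsDnP K R phiinv s')
  (stdDn_weights K R Lam phi phiinv Lam_gt0 hphi s vs)
  (stdDn_weights K R Lam phi phiinv Lam_gt0 hphi s' vs') e _ i j dN cN sN hi' nz.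
have sj : (j < size s')%N.
  rewrite ltnNge; apply/negP => js; have := co1_has1 (legsDnP K R phiinv s') nz.
  by rewrite /legsDn legs_at_out.
by rewrite /legsDn !legs_atE // => -[*]; split.
Qed.

(** Both homotopy terms of closedness vanish: [mKUp f] is applied to the zero boundary of [v], and
    the middle differential is zero. *)
Lemma psiUp_coef v j : gbd _ v = 0 ->
  co1 (stdD K R s') j (mD f (psiUp (std_cospan K s) v)) =
  if nth false (map linkUp s') j then co1 (stdUp K R s') j (mUp f v) else 0.
Proof.
move=> bv; have [_ _ _ _ ->] := (closed_morP _ _ _ _ _).1 cf.
have [_ _ _ [_ [lK _]] _] := sf.
by rewrite bv (lin_zero lK) std_gbdD !addr0 std_psiUp.
Qed.

Lemma psiDn_coef v j : gbd _ v = 0 ->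
  co1 (stdD K R s') j (mD f (psiDn (std_cospan K s) v)) =
  if nth false (map linkDn s') j then co1 (stdDn K R s') j (mDn f v) else 0.
Proof.
move=> bv; have [_ _ _ -> _] := (closed_morP _ _ _ _ _).1 cf.
have [_ _ _ [[lK _] _] _] := sf.
by rewrite bv (lin_zero lK) std_gbdD !addr0 std_psiDn.
Qed.

Lemma linkUp_has1 (t : summand R) : linkUp t -> has1 (wlegUp R phiinv t) /\ has1 (legD t).
Proof. by case: t. Qed.

Lemma linkDn_has1 (t : summand R) : linkDn t -> has1 (wlegDn R phiinv t) /\ has1 (legD t).
Proof. by case: t. Qed.

Lemma psiUp_gen1 i : (i < size s)%N -> linkUp (at_ s i) ->
  psiUp (std_cospan K s) (gen1 (stdUp K R s) i) = gen1 (stdD K R s) i.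
Proof.
move=> si li; have [h1 h2] := linkUp_has1 _ li; apply: stdD_ext => n.
rewrite std_psiUp (co1_gen1 _ _ _ _ _ (legsUpP K R phiinv s)) ?/legsUp ?legs_atE //.
rewrite (co1_gen1 _ _ _ _ _ (stdDP K R s)) ?legs_atE //.
by case: eqP => [->|_]; rewrite ?if_same // (nth_map (SBox R 0)) // li.
Qed.

Lemma psiDn_gen1 i : (i < size s)%N -> linkDn (at_ s i) ->
  psiDn (std_cospan K s) (gen1 (stdDn K R s) i) = gen1 (stdD K R s) i.
Proof.
move=> si li; have [h1 h2] := linkDn_has1 _ li; apply: stdD_ext => n.
rewrite std_psiDn (co1_gen1 _ _ _ _ _ (legsDnP K R phiinv s)) ?/legsDn ?legs_atE //.
rewrite (co1_gen1 _ _ _ _ _ (stdDP K R s)) ?legs_atE //.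
by case: eqP => [->|_]; rewrite ?if_same // (nth_map (SBox R 0)) // li.
Qed.

(** An unlinked generator dies in the middle complex, so its image must die there too, while a
    linked coordinate would survive. *)
Lemma coefUp_unlinked i j : (i < size s)%N -> has1 (wlegUp R phiinv (at_ s i)) ->
  ~~ linkUp (at_ s i) -> coefUp j i != 0 -> ~~ linkUp (at_ s' j).
Proof.
move=> si hi li nz; have [sj _ _ _ _] := coefUp_supp i j si hi nz.
apply: contra nz => lj.
have b0 := gbd_gen1 _ _ _ _ _ (legsUpP K R phiinv s) i.
have := psiUp_coef _ j b0; rewrite (nth_map (SBox R 0)) // lj /coefUp => <-.
rewrite (_ : psiUp _ _ = 0).
  by have [_ _ [l _] _ _] := sf; rewrite (lin_zero l) (co1_zero (stdDP K R s')).
apply: stdD_ext => n; rewrite std_psiUp (co1_zero (stdDP K R s)).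
rewrite (co1_gen1 _ _ _ _ _ (legsUpP K R phiinv s)) ?/legsUp ?legs_atE //.
by case: eqP => [->|_]; rewrite ?if_same // (nth_map (SBox R 0)) // (negbTE li).
Qed.

Lemma coefDn_unlinked i j : (i < size s)%N -> has1 (wlegDn R phiinv (at_ s i)) ->
  ~~ linkDn (at_ s i) -> coefDn j i != 0 -> ~~ linkDn (at_ s' j).
Proof.
move=> si hi li nz; have [sj _ _ _ _] := coefDn_supp i j si hi nz.
apply: contra nz => lj.
have b0 := gbd_gen1 _ _ _ _ _ (legsDnP K R phiinv s) i.
have := psiDn_coef _ j b0; rewrite (nth_map (SBox R 0)) // lj /coefDn => <-.
rewrite (_ : psiDn _ _ = 0).
  by have [_ _ [l _] _ _] := sf; rewrite (lin_zero l) (co1_zero (stdDP K R s')).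
apply: stdD_ext => n; rewrite std_psiDn (co1_zero (stdDP K R s)).
rewrite (co1_gen1 _ _ _ _ _ (legsDnP K R phiinv s)) ?/legsDn ?legs_atE //.
by case: eqP => [->|_]; rewrite ?if_same // (nth_map (SBox R 0)) // (negbTE li).
Qed.

(** The unfiltered middle yields no level bound by itself. A linked middle generator lifts to a leg,
    where the coefficient is the same and the leg bounds apply. *)
Lemma coefD_supp i j : (i < size s)%N -> has1 (legD (at_ s i)) -> coefD j i != 0 ->
  [/\ (j < size s')%N, has1 (legD (at_ s' j)), deg1 (legD (at_ s i)) = deg1 (legD (at_ s' j)),
      linkUp (at_ s i) -> linkUp (at_ s' j) /\
        lev1 (wlegUp R phiinv (at_ s' j)) <= lev1 (wlegUp R phiinv (at_ s i)) + e
    & linkDn (at_ s i) -> linkDn (at_ s' j) /\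
        lev1 (wlegDn R phiinv (at_ s' j)) <= lev1 (wlegDn R phiinv (at_ s i)) + e].
Proof.
move=> si hi nz; have hj := co1_has1 (stdDP K R s') nz.
have sj : (j < size s')%N.
  by rewrite ltnNge; apply/negP => js; move: hj; rewrite legs_at_out.
rewrite legs_atE // in hj; split=> //.
- have [_ _ [_ df] _ _] := sf.
  have gi := gpr_gen1 _ _ _ _ _ (stdDP K R s) i; rewrite legs_atE // in gi.
  move: nz; rewrite /coefD -{1}(gi hi) -df (co1_pr (stdDP K R s')) subr0 legs_atE //.
  by case: (eqVneq (deg1 (legD (at_ s i))) _) => // _; rewrite eqxx.
- move=> li; have [h1 _] := linkUp_has1 _ li.
  move: nz; rewrite /coefD -psiUp_gen1 // psiUp_coef; last first.
    exact: gbd_gen1 (legsUpP K R phiinv s) i.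
  rewrite (nth_map (SBox R 0)) //; case: ifP; last by rewrite eqxx.
  by move=> _ nz; case: (coefUp_supp i j si h1 nz).
- move=> li; have [h1 _] := linkDn_has1 _ li.
  move: nz; rewrite /coefD -psiDn_gen1 // psiDn_coef; last first.
    exact: gbd_gen1 (legsDnP K R phiinv s) i.
  rewrite (nth_map (SBox R 0)) //; case: ifP; last by rewrite eqxx.
  by move=> _ nz; case: (coefDn_supp i j si h1 nz).
Qed.

Lemma coef_supp i j : (i < size s)%N -> coef j i != 0 ->
  [/\ label (at_ s i) = label (at_ s' j), par1 phiinv (at_ s' j) <= par1 phiinv (at_ s i) + e
    & par2 phiinv (at_ s' j) <= par2 phiinv (at_ s i) + e].
Proof.
move=> si; rewrite /coef; case: (eqVneq (label (at_ s i)) _) => [lab|_]; last by rewrite eqxx.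
move=> nz; split=> //.
all: have uS := coefUp_supp i j si; have nS := coefDn_supp i j si; have dS := coefD_supp i j si.
all: move: nz lab uS nS dS; case: (at_ s i) => [k a b|k a b|k a|k a|k a b|k a|k a|k];
  case: (at_ s' j) => [k' a' b'|k' a' b'|k' a'|k' a'|k' a' b'|k' a'|k' a'|k'] //= nz _ uS nS dS;
  rewrite ?add0r ?e_ge0 //;
  try (by case: (uS isT nz) => _ _ _ l1 l2 //; case: (l2 isT));
  try (by case: (nS isT nz) => _ _ _; rewrite !opprK => l1 l2 //; case: (l2 isT));
  case: (dS isT nz) => _ _ _ l1 l2;
  try (by case: (l1 isT)); by case: (l2 isT) => _; rewrite !opprK.
Qed.

End OneMorphism.

Lemma homotopic_components e (s : seq (summand R)) (F : mor (std_cospan K s) (std_cospan K s)) :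
  homotopic phiinv e F (idmor _) ->
  [/\ exists h, [/\ lin h, shifted_by (weightUp phiinv _) (weightUp phiinv _) e h &
        forall x, mUp F x - x = - gbd _ (h x) - h (gbd _ x)],
      exists h, [/\ lin h, shifted_by (weightDn phiinv _) (weightDn phiinv _) e h &
        forall x, mDn F x - x = - gbd _ (h x) - h (gbd _ x)]
    & forall x, mD F x = x].
Proof.
case=> h [[[l1 _] [l2 _] [l3 _] _ [sU sN]]]; rewrite deltam1E => -[/= e1 e2 e3 _ _].
split; [by exists (mUp h)|by exists (mDn h)|].
move=> x; have := e3 x; rewrite !std_gbdD (lin_zero l3) addr0 => /eqP.
by rewrite subr_eq0 => /eqP.
Qed.

(** Without the cut-off in [coef] the sum is an entry of the composite. It remains to see that the
    homotopy does not touch this entry and that the terms through other labels vanish. *)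
Lemma coef_comp e s s' (a : mor (std_cospan K s) (std_cospan K s'))
    (b : mor (std_cospan K s') (std_cospan K s)) :
  0 <= e -> all (valid_summand Lam) s -> all (valid_summand Lam) s' ->
  shift_mor phiinv 0 e a -> closed_mor a -> shift_mor phiinv 0 e b -> closed_mor b ->
  homotopic phiinv (2 * e) (Defs.comp b a) (idmor _) ->
  forall i i' : 'I_(size s),
  persistent phiinv e (at_ s i) -> persistent phiinv e (at_ s i') ->
  label (at_ s i) = label (at_ s i') ->
  par1 phiinv (at_ s i) + par2 phiinv (at_ s i) <= par1 phiinv (at_ s i') + par2 phiinv (at_ s i') ->
  \sum_(j < size s') coef s' s b i' j * coef s s' a j i = (i' == i)%:R.
Proof.
move=> e0 vs vs' sa ca sb cb hba i i' pi pi' lab les.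
have [[hU [lhU shU eqU]] [hN [lhN shN eqN]] eqD] := homotopic_components _ _ _ hba.
have [[laN _] [laU _] [laD _] _ _] := sa; have [[lbN _] [lbU _] [lbD _] _ _] := sb.
have [caN caU caD _ _] := (closed_morP _ _ _ _ _).1 ca.
have si := ltn_ord i; have si' := ltn_ord i'.
have outU n : (size s' <= n)%N -> legsUp R phiinv s' n = L0 by apply: legs_at_out.
have outN n : (size s' <= n)%N -> legsDn R phiinv s' n = L0 by apply: legs_at_out.
have outD n : (size s' <= n)%N -> legs_at R legD s' n = L0 by apply: legs_at_out.
have UW := stdUp_weights K R Lam phi phiinv Lam_gt0 hphi s vs.
have NW := stdDn_weights K R Lam phi phiinv Lam_gt0 hphi s vs.
have compU := leg_coef_comp _ _ _ _ _ _ _ _ (legsUpP K R phiinv s) (legsUpP K R phiinv s')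
  (size s') _ _ i i' caU laU lbU outU.
have compN := leg_coef_comp _ _ _ _ _ _ _ _ (legsDnP K R phiinv s) (legsDnP K R phiinv s')
  (size s') _ _ i i' caN laN lbN outN.
have compD := leg_coef_comp _ _ _ _ _ _ _ _ (stdDP K R s) (stdDP K R s')
  (size s') _ _ i i' caD laD lbD outD.
have htU := leg_homotopy _ _ _ _ _ _ (legsUpP K R phiinv s) UW (2 * e) _ _ i i' lhU shU eqU.
have htN := leg_homotopy _ _ _ _ _ _ (legsDnP K R phiinv s) NW (2 * e) _ _ i i' lhN shN eqN.
rewrite /legsUp /legsDn !legs_atE //= in htU htN.
have caseU : has1 (wlegUp R phiinv (at_ s i)) -> ~~ linkUp (at_ s i) ->
    (forall j, coef_class s s' a (at_ s i) j i = coefUp s s' a j i) ->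
    (forall j, label (at_ s i) = label (at_ s' j) ->
      coef_class s' s b (at_ s' j) i' j = coefUp s' s b i' j) ->
    \sum_(j < size s') coef s' s b i' j * coef s s' a j i = (i' == i)%:R.
  move=> h1 nl ea eb.
  have h1' : has1 (wlegUp R phiinv (at_ s i')).
    by move: lab h1 nl; case: (at_ s i) => [? ? ?|? ? ?|? ?|? ?|? ? ?|? ?|? ?|?];
       case: (at_ s i') => [? ? ?|? ? ?|? ?|? ?|? ? ?|? ?|? ?|?] //= [].
  (* If the homotopy reached the pair [i'], then [par2] at [i'] would be at most [par1] at [i] plus
     [2 * e]; persistence of [i] and [i'] would make both parameters of [i'] strictly smaller than
     those of [i], against the order of the sums. *)
  rewrite -htU // ?compU; last first.
    move: lab les pi pi' h1 h1' nl; case: (at_ s i) => [? ? ?|? ? ?|? ?|? ?|? ? ?|? ?|? ?|?];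
    case: (at_ s i') => [? ? ?|? ? ?|? ?|? ?|? ? ?|? ?|? ?|?] //= [] // *; lra.
  apply: eq_bigr => j _; rewrite /coef ea.
  case: (eqVneq (label (at_ s i)) (label (at_ s' j))) => lij.
    by rewrite -lab -lij eqxx eb.
  rewrite mulr0; apply/esym/eqP; apply: contraNT lij; rewrite mulf_eq0 negb_or => /andP[nb na].
  (* Pairs map only to pairs, so a pair cannot pass through a lone cycle, nor can a cycle pass
     through a pair and come back as a cycle; linked types are excluded by [coefUp_unlinked]. *)
  have [sj hj dj _ h2j] := coefUp_supp _ _ _ _ vs vs' sa ca i j si h1 na.
  have nlj := coefUp_unlinked _ _ _ _ vs vs' sa ca i j si h1 nl na.
  have [_ _ _ _ h2i] := coefUp_supp _ _ _ _ vs' vs sb cb j i' sj hj nb.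
  move: h1 nl lab hj dj h2j nlj h2i; case: (at_ s i) => [? ? ?|? ? ?|? ?|? ?|? ? ?|? ?|? ?|?];
  case: (at_ s i') => [? ? ?|? ? ?|? ?|? ?|? ? ?|? ?|? ?|?] //=;
  case: (at_ s' j) => [? ? ?|? ? ?|? ?|? ?|? ? ?|? ?|? ?|?] //= _ _ _ _ -> h2j _ h2i;
  by [rewrite eqxx | case: (h2j isT) | case: (h2i isT)].
have caseN : has1 (wlegDn R phiinv (at_ s i)) -> ~~ linkDn (at_ s i) ->
    (forall j, coef_class s s' a (at_ s i) j i = coefDn s s' a j i) ->
    (forall j, label (at_ s i) = label (at_ s' j) ->
      coef_class s' s b (at_ s' j) i' j = coefDn s' s b i' j) ->
    \sum_(j < size s') coef s' s b i' j * coef s s' a j i = (i' == i)%:R.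
  move=> h1 nl ea eb.
  have h1' : has1 (wlegDn R phiinv (at_ s i')).
    by move: lab h1 nl; case: (at_ s i) => [? ? ?|? ? ?|? ?|? ?|? ? ?|? ?|? ?|?];
       case: (at_ s i') => [? ? ?|? ? ?|? ?|? ?|? ? ?|? ?|? ?|?] //= [].
  rewrite -htN // ?compN; last first.
    move: lab les pi pi' h1 h1' nl; case: (at_ s i) => [? ? ?|? ? ?|? ?|? ?|? ? ?|? ?|? ?|?];
    case: (at_ s i') => [? ? ?|? ? ?|? ?|? ?|? ? ?|? ?|? ?|?] //= [] // *; rewrite !opprK; lra.
  apply: eq_bigr => j _; rewrite /coef ea.
  case: (eqVneq (label (at_ s i)) (label (at_ s' j))) => lij.
    by rewrite -lab -lij eqxx eb.
  rewrite mulr0; apply/esym/eqP; apply: contraNT lij; rewrite mulf_eq0 negb_or => /andP[nb na].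
  have [sj hj dj _ h2j] := coefDn_supp _ _ _ _ vs vs' sa ca i j si h1 na.
  have nlj := coefDn_unlinked _ _ _ _ vs vs' sa ca i j si h1 nl na.
  have [_ _ _ _ h2i] := coefDn_supp _ _ _ _ vs' vs sb cb j i' sj hj nb.
  move: h1 nl lab hj dj h2j nlj h2i; case: (at_ s i) => [? ? ?|? ? ?|? ?|? ?|? ? ?|? ?|? ?|?];
  case: (at_ s i') => [? ? ?|? ? ?|? ?|? ?|? ? ?|? ?|? ?|?] //=;
  case: (at_ s' j) => [? ? ?|? ? ?|? ?|? ?|? ? ?|? ?|? ?|?] //= _ _ _ _ -> h2j _ h2i;
  by [rewrite eqxx | case: (h2j isT) | case: (h2i isT)].
have caseD : has1 (legD (at_ s i)) ->
    (forall j, coef_class s s' a (at_ s i) j i = coefD s s' a j i) ->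
    (forall j, label (at_ s i) = label (at_ s' j) ->
      coef_class s' s b (at_ s' j) i' j = coefD s' s b i' j) ->
    \sum_(j < size s') coef s' s b i' j * coef s s' a j i = (i' == i)%:R.
  move=> h1 ea eb.
  have -> : (i' == i)%:R = co1 (stdD K R s) i' (mD b (mD a (gen1 (stdD K R s) i))).
    by have /= -> := eqD (gen1 (stdD K R s) i);
       rewrite (co1_gen1 _ _ _ _ _ (stdDP K R s)) // legs_atE.
  rewrite compD; apply: eq_bigr => j _; rewrite /coef ea.
  case: (eqVneq (label (at_ s i)) (label (at_ s' j))) => lij.
    by rewrite -lab -lij eqxx eb.
  rewrite mulr0; apply/esym/eqP; apply: contraNT lij; rewrite mulf_eq0 negb_or => /andP[nb na].
  (* Links survive each of the two steps, and [i'] has exactly those of [i], so [j] can have neither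
     fewer nor more. *)
  have [sj hj dj uj nj] := coefD_supp _ _ _ _ vs vs' sa ca i j si h1 na.
  have [_ _ _ ui ni] := coefD_supp _ _ _ _ vs' vs sb cb j i' sj hj nb.
  move: h1 lab hj dj uj nj ui ni; case: (at_ s i) => [? ? ?|? ? ?|? ?|? ?|? ? ?|? ?|? ?|?];
  case: (at_ s i') => [? ? ?|? ? ?|? ?|? ?|? ? ?|? ?|? ?|?] //=;
  case: (at_ s' j) => [? ? ?|? ? ?|? ?|? ?|? ? ?|? ?|? ?|?] //= _ _ _ -> uj nj ui ni;
  by [rewrite eqxx | case: (uj isT) | case: (nj isT) | case: (ui isT) | case: (ni isT)].
case E : (at_ s i) => [k x y|k x y|k x|k x|k x y|k x|k x|k];
  [apply: caseU|apply: caseN|apply: caseU|apply: caseN|apply: caseD|apply: caseD|apply: caseD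
  |apply: caseD]; rewrite E //= => j; case: (at_ s' j) => //=.
Qed.

Lemma interleaved_matching e s s' :
  0 <= e -> all (valid_summand Lam) s -> all (valid_summand Lam) s' ->
  interleaved phiinv e (std_cospan K s) (std_cospan K s') ->
  exists h : 'I_(size s) -> option 'I_(size s'),
    [/\ forall i i' j, h i = Some j -> h i' = Some j -> i = i',
        forall i j, h i = Some j -> summand_close phiinv e (at_ s i) (at_ s' j),
        forall i, h i = None -> ~~ persistent phiinv e (at_ s i)
      & forall j, (forall i, h i <> Some j) -> ~~ persistent phiinv e (at_ s' j)].
Proof.
move=> e0 vs vs' [a [b [[sa ca] [sb cb] hba hab]]].
have main (t t' : seq (summand R)) (f : mor (std_cospan K t) (std_cospan K t'))
    (f' : mor (std_cospan K t') (std_cospan K t)) :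
    all (valid_summand Lam) t -> all (valid_summand Lam) t' ->
    shift_mor phiinv 0 e f -> closed_mor f -> shift_mor phiinv 0 e f' -> closed_mor f' ->
    homotopic phiinv (2 * e) (Defs.comp f' f) (idmor _) ->
    exists h : 'I_(size t) -> option 'I_(size t'),
    [/\ forall i i' j, h i = Some j -> h i' = Some j -> i = i',
        forall i j, h i = Some j -> summand_close phiinv e (at_ t i) (at_ t' j)
      & forall i : 'I_(size t), persistent phiinv e (at_ t i) -> h i <> None].
  move=> vt vt' sf cf sf' cf' hff.
  have [|||h [h1 h2 h3]] := matrix_matching K R 'I_(size t) 'I_(size t') (nat * int)%type
    (fun i => label (at_ t i)) (fun j => label (at_ t' j))
    (fun i => par1 phiinv (at_ t i)) (fun i => par2 phiinv (at_ t i))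
    (fun j => par1 phiinv (at_ t' j)) (fun j => par2 phiinv (at_ t' j)) e
    (fun j i => coef t t' f j i) (fun i j => coef t' t f' i j)
    (fun i => persistent phiinv e (at_ t i)).
  - by move=> j i nz; apply: (coef_supp e _ _ f).
  - by move=> i j nz; have [] := coef_supp e _ _ f' e0 vt' vt sf' cf' j i (ltn_ord j) nz.
  - exact: coef_comp.
  by exists h; split=> // i j /h2/and5P[/eqP ? ? ? ? ?]; split.
have [h [h1 h2 h3]] := main _ _ _ _ vs vs' sa ca sb cb hba.
have [h' [h1' h2' h3']] := main _ _ _ _ vs' vs sb cb sa ca hab.
have [m [m1 m2 m3 m4]] := merge_matchings _ _ h h' h1 h1'.
exists m; split=> //.
- by move=> i j /m2[/h2//|/h2']; apply: summand_close_sym.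
- by move=> i mi; apply/negP => /h3/m3.
- by move=> j mj; apply/negP => /h3'/m4[i mi]; apply: (mj i).
Qed.

End Coefficients.

(** * Geometry of the strip *)

Section Strip.
Variables (R : realType) (Lam : R) (phi : \bar R -> R) (phiinv : R -> \bar R).
Hypothesis Lam_gt0 : 0 < Lam.
Hypothesis hphi : incr_homeo Lam phi phiinv.
Ltac lraL := have := Lam_gt0; lra.
Local Notation u := (rescale phiinv).
Local Notation rh := (rho phi phiinv).
Local Notation T := (Tst Lam).
Local Notation Tinv := (Tstinv Lam).

Lemma pair_ext (v w : R * R) : v.1 = w.1 -> v.2 = w.2 -> v = w.
Proof. by case: v w => [? ?] [? ?] /= -> ->. Qed.

Lemma TstK v : Tinv (T v) = v.
Proof. by apply: pair_ext; rewrite /Tst /Tstinv /=; ring. Qed.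

Lemma TstinvK v : T (Tinv v) = v.
Proof. by apply: pair_ext; rewrite /Tst /Tstinv /=; ring. Qed.

Lemma Tpow1 k v : Tpow Lam (k + 1) v = Tpow Lam k (T v).
Proof.
case: k => [n|[|n]].
- by rewrite -PoszD addn1 /Tpow iterSr.
- by rewrite NegzE addNr /= TstK.
- rewrite NegzE (_ : - n.+2%:Z + 1 = Negz n); last by rewrite NegzE; lia.
  by rewrite -NegzE /Tpow [in RHS]iterSr TstK.
Qed.

Lemma TpowD k m v : Tpow Lam (k + m%:Z) v = Tpow Lam k (iter m T v).
Proof.
elim: m v => [|m IH] v; first by rewrite addr0.
by rewrite -addn1 PoszD addrA Tpow1 IH addn1 -iterSr.
Qed.

Lemma preceq_Tst v w : preceq (T v) (T w) <-> preceq v w.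
Proof. by rewrite /preceq /Tst /=; split=> -[? ?]; split; lraL. Qed.

Lemma preceq_Tstinv v w : preceq (Tinv v) (Tinv w) <-> preceq v w.
Proof. by rewrite /preceq /Tstinv /=; split=> -[? ?]; split; lraL. Qed.

Lemma preceq_Tpow k v w : preceq (Tpow Lam k v) (Tpow Lam k w) <-> preceq v w.
Proof.
case: k => n; rewrite /Tpow; elim: n => [|n IH] //=; last by rewrite preceq_Tstinv.
  by rewrite preceq_Tst.
by rewrite preceq_Tstinv.
Qed.

Lemma Tpow_inj k v w : Tpow Lam k v = Tpow Lam k w -> v = w.
Proof.
move=> e; have [] : preceq v w /\ preceq w v.
  by split; apply/(preceq_Tpow k); rewrite e; split.
by move=> [? ?] [? ?]; apply: pair_ext; lraL.
Qed.

Lemma bdM_Tpow k v : bdM Lam (Tpow Lam k v) <-> bdM Lam v.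
Proof.
have step w : (T w).1 + (T w).2 = - (w.1 + w.2) by rewrite /Tst /=; ring.
have step' w : (Tinv w).1 + (Tinv w).2 = - (w.1 + w.2) by rewrite /Tstinv /=; ring.
have it n : `|(iter n T v).1 + (iter n T v).2| = `|v.1 + v.2|.
  by elim: n => // n IH; rewrite iterS step normrN.
have it' n : `|(iter n Tinv v).1 + (iter n Tinv v).2| = `|v.1 + v.2|.
  by elim: n => // n IH; rewrite iterS step' normrN.
by rewrite /bdM; case: k => n; rewrite /Tpow ?it ?it'.
Qed.

Lemma Tpow_surj k v : exists w, v = Tpow Lam k w.
Proof.
case: k => n.
  exists (iter n Tinv v); rewrite /Tpow; elim: n => //= n IH.
  by rewrite -iterS iterSr /= TstinvK.
exists (iter n.+1 T v); rewrite /Tpow; elim: n => [|n IH]; first by rewrite /= TstK.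
by rewrite iterSr [in X in iter _ _ (Tinv X)]iterS TstK.
Qed.

(** The clauses of [flowM] on the fundamental cell, as a relation: it also records that [v] lies in
    the cell, and uniqueness of the cell representative turns the choice in [flowM] into a
    computation. *)
Definition cell_flow e (v z : R * R) :=
  [\/ Sreg Lam v /\ z = (rh (- e) v.1, rh e v.2),
      Lreg Lam v /\ z = (- (2 * Lam) - rh e (- (2 * Lam) - v.1), rh e v.2)
    | Areg Lam v /\ z = (rh (- e) v.1, 2 * Lam - rh (- e) (2 * Lam - v.2))].

Lemma rho_gt s x : - Lam < x -> x <= Lam -> - Lam < rh s x.
Proof.
move=> x1; rewrite le_eqVlt => /orP[/eqP ->|x2]; first by rewrite (rho_top _ _ _ _ hphi); lraL.
have hx : - Lam < x < Lam by rewrite x1.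
by case/andP: (rho_bounded _ _ _ _ hphi s x hx).
Qed.

Lemma rho_lt s x : - Lam <= x -> x < Lam -> rh s x < Lam.
Proof.
rewrite le_eqVlt => /orP[/eqP <-|x2] x1; first by rewrite (rho_bot _ _ _ _ hphi); lraL.
have hx : - Lam < x < Lam by rewrite x2.
by case/andP: (rho_bounded _ _ _ _ hphi s x hx).
Qed.

(** The quadrant [x <= - Lam], [Lam <= y] separates the translates: every positive power of [Tst]
    moves the cell into it ([iter_Tst_range]), whereas neither the cell nor its flow meets it. Hence
    translates are disjoint, and points in different ones are never flow-close. *)
Lemma cell_flow_outside e v z : cell_flow e v z -> ~ (z.1 <= - Lam /\ Lam <= z.2).
Proof.
case=> -[] [] /= h1 h2 h3.
- move=> h4 -> /= [z1 _]; have := rho_gt (- e) v.1 h1 h2; lraL.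
- move=> -> /= [_ z2]; have := rho_lt e v.2; lraL.
- move=> -> /= [z1 _]; have := rho_gt (- e) v.1; lraL.
Qed.

Lemma cell_flow_range e v z : cell_flow e v z -> v.1 <= Lam /\ - Lam <= v.2.
Proof. by case=> -[] [] *; split; lraL. Qed.

Lemma cell_outside e v z : cell_flow e v z -> ~ (v.1 <= - Lam /\ Lam <= v.2).
Proof. by case=> -[] [] *; lraL. Qed.

Lemma iter_Tst_range m v : v.1 <= Lam /\ - Lam <= v.2 ->
  (iter m.+1 T v).1 <= - Lam /\ Lam <= (iter m.+1 T v).2.
Proof.
move=> hv; elim: m => [|m]; first by rewrite /Tst /=; lraL.
by rewrite [iter m.+2 _ _]iterS; set w := iter m.+1 T v; rewrite /Tst /=; lraL.
Qed.

Lemma int_trichotomy (k k' : int) :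
  [\/ k = k', exists m : nat, k' = k + m.+1%:Z | exists m : nat, k = k' + m.+1%:Z].
Proof.
case: (ltrgtP k k') => h; last by apply: Or31.
- by apply: Or32; exists (absz (k' - k - 1)%R); lia.
- by apply: Or33; exists (absz (k - k' - 1)%R); lia.
Qed.

Lemma cell_unique e v z e' v' z' k k' : cell_flow e v z -> cell_flow e' v' z' ->
  Tpow Lam k v = Tpow Lam k' v' -> k = k' /\ v = v'.
Proof.
move=> cv cv'; have [->|[m ->]|[m ->]] := int_trichotomy k k'.
- by move/Tpow_inj.
- rewrite TpowD => /Tpow_inj ev; case: (cell_outside _ _ _ cv); rewrite ev.
  exact: iter_Tst_range (cell_flow_range _ _ _ cv').
- rewrite TpowD => /Tpow_inj ev; case: (cell_outside _ _ _ cv'); rewrite -ev.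
  exact: iter_Tst_range (cell_flow_range _ _ _ cv).
Qed.

Lemma cell_flow_fun e v z z' : cell_flow e v z -> cell_flow e v z' -> z = z'.
Proof.
by case=> -[] [] *; [|..]; match goal with H : cell_flow _ _ _ |- _ => move: H end;
  case=> -[] [] *; subst => //; exfalso; lraL.
Qed.

Lemma flowM_cell e k v z : cell_flow e v z ->
  flowM Lam phi phiinv e (Tpow Lam k v) = Tpow Lam k z.
Proof.
move=> cv; apply: xget_unique.
  exists k, v; split=> //; case: cv => -[h ->]; [apply: Or31|apply: Or32|apply: Or33] => //.
move=> y [k' [v' [ev cy]]].
have [z' cv' ->] : exists2 z', cell_flow e v' z' & y = Tpow Lam k' z'.
  case: cy => -[h ->]; eexists; try reflexivity.
  - by apply: Or31.
  - by apply: Or32.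
  - by apply: Or33.
have [kk vv] := cell_unique _ _ _ _ _ _ _ _ cv cv' ev; subst k' v'.
by rewrite (cell_flow_fun _ _ _ _ cv cv').
Qed.

Lemma flowM_nocell e v : (forall k w z, cell_flow e w z -> v <> Tpow Lam k w) ->
  flowM Lam phi phiinv e v = v.
Proof.
move=> no; apply: xgetPN => y [k [w [ev]]].
by case=> -[h _]; apply: (no k w _ _ ev); [apply: Or31|apply: Or32|apply: Or33]; split.
Qed.

Definition flow_close e (p q : R * R) :=
  preceq p (flowM Lam phi phiinv e q) /\ preceq q (flowM Lam phi phiinv e p).

Lemma flow_close_cell e v z v' z' k k' : cell_flow e v z -> cell_flow e v' z' ->
  flow_close e (Tpow Lam k v) (Tpow Lam k' v') <-> [/\ k = k', preceq v z' & preceq v' z].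
Proof.
move=> cv cv'; rewrite /flow_close !(flowM_cell e _ _ _ cv) (flowM_cell e _ _ _ cv').
split=> [[]|[-> h1 h2]]; last by split; apply/preceq_Tpow.
have [->|[m ->]|[m ->]] := int_trichotomy k k'.
- by move=> /preceq_Tpow h1 /preceq_Tpow h2.
- rewrite TpowD => _; rewrite TpowD => /preceq_Tpow[h1 h2].
  case: (cell_flow_outside _ _ _ cv).
  by have := iter_Tst_range m _ (cell_flow_range _ _ _ cv'); lraL.
- rewrite TpowD => /preceq_Tpow[h1 h2] _.
  case: (cell_flow_outside _ _ _ cv').
  by have := iter_Tst_range m _ (cell_flow_range _ _ _ cv); lraL.
Qed.

Definition pt_index (t : summand R) : int :=
  match t with
  | SUp k _ _ | SDn k _ _ => - k - 1
  | SBox k => - k + 1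
  | SUpInf k _ | SDnInf k _ | SGt k _ _ | SSE k _ | SNE k _ => - k
  end.
Definition pt_base (t : summand R) : R * R :=
  match t with
  | SUp _ a b => (- (2 * Lam) - a, b)
  | SUpInf _ a => (Lam, a)
  | SNE _ a => (- Lam, a)
  | SDn _ a b => (b, 2 * Lam - a)
  | SDnInf _ a => (a, - Lam)
  | SSE _ a => (a, Lam)
  | SGt _ a b => (a, b)
  | SBox _ => (Lam, - Lam)
  end.
Definition pt_flow e (t : summand R) : R * R :=
  match t with
  | SUp _ a b => (- (2 * Lam) - rh e a, rh e b)
  | SUpInf _ a => (Lam, rh e a)
  | SNE _ a => (- Lam, rh e a)
  | SDn _ a b => (rh (- e) b, 2 * Lam - rh (- e) a)
  | SDnInf _ a => (rh (- e) a, - Lam)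
  | SSE _ a => (rh (- e) a, Lam)
  | SGt _ a b => (rh (- e) a, rh e b)
  | SBox _ => (Lam, - Lam)
  end.

Lemma pt_summandE t : pt_summand Lam t = Tpow Lam (pt_index t) (pt_base t).
Proof. by case: t. Qed.

(** The constant coordinates of the box and of the one-parameter points are [Lam] or [- Lam], which
    [rho] fixes; such points therefore never leave their line. *)
Lemma pt_cell_flow e t : valid_summand Lam t -> cell_flow e (pt_base t) (pt_flow e t).
Proof.
have top s : rh s Lam = Lam by exact: rho_top hphi s.
have bot s : rh s (- Lam) = - Lam by exact: rho_bot hphi s.
case: t => [k a b|k a b|k a|k a|k a b|k a|k a|k] /=.
- move=> /and3P[h1 h2 h3]; apply: Or32; split; first by split=> /=; lraL.
  by rewrite /= (_ : - (2 * Lam) - (- (2 * Lam) - a) = a) //; ring.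
- move=> /and3P[h1 h2 h3]; apply: Or33; split; first by split=> /=; lraL.
  by rewrite /= (_ : 2 * Lam - (2 * Lam - a) = a) //; ring.
- by move=> h1; apply: Or31; split; [split=> /=; lraL|rewrite /= top].
- by move=> h1; apply: Or31; split; [split=> /=; lraL|rewrite /= bot].
- by move=> /andP[h1 h2]; apply: Or31; split; first by split=> /=; lraL.
- move=> h1; apply: Or33; split; first by split=> /=; lraL.
  rewrite /= (_ : 2 * Lam - Lam = Lam) ?top; last by ring.
  by congr (_, _); ring.
- move=> h1; apply: Or32; split; first by split=> /=; lraL.
  rewrite /= (_ : - (2 * Lam) - - Lam = - Lam) ?bot; last by ring.
  by congr (_, _); ring.
- by move=> _; apply: Or31; split; [split=> /=; lraL|rewrite /= top bot].
Qed.

Lemma flow_close_summand e t t' : valid_summand Lam t -> valid_summand Lam t' ->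
  flow_close e (pt_summand Lam t) (pt_summand Lam t') <->
  [/\ pt_index t = pt_index t', preceq (pt_base t) (pt_flow e t') &
      preceq (pt_base t') (pt_flow e t)].
Proof.
move=> vt vt'; rewrite !pt_summandE.
exact: flow_close_cell (pt_cell_flow e t vt) (pt_cell_flow e t' vt').
Qed.

Lemma le_rhoP e a a' : - Lam < a < Lam -> - Lam < a' < Lam ->
  (a <= rh e a') = (u a <= u a' + e).
Proof. by move=> va va'; apply: (le_rho _ _ _ _ hphi). Qed.

Lemma rho_leP e a a' : - Lam < a < Lam -> - Lam < a' < Lam ->
  (rh (- e) a' <= a) = (u a' - e <= u a).
Proof. by move=> va va'; apply: (rho_le _ _ _ _ hphi). Qed.

Lemma summand_close_flow e t t' : valid_summand Lam t -> valid_summand Lam t' ->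
  summand_close phiinv e t t' -> flow_close e (pt_summand Lam t) (pt_summand Lam t').
Proof.
move=> vt vt' cl; apply/flow_close_summand => //; move: vt vt' cl.
case: t => [k a b|k a b|k a|k a|k a b|k a|k a|k];
case: t' => [k' a' b'|k' a' b'|k' a'|k' a'|k' a' b'|k' a'|k' a'|k'] //= vt vt' [] //= [->] h1 h2 h3 h4;
  split=> //; rewrite /preceq /= ?lerD2l ?lerN2 ?lexx.
- case/and3P: vt vt' => va vb _ /and3P[va' vb' _].
  by rewrite !le_rhoP.
- case/and3P: vt vt' => va vb _ /and3P[va' vb' _].
  by rewrite !le_rhoP.
- case/and3P: vt vt' => va vb _ /and3P[va' vb' _].
  by rewrite !rho_leP //; split; lraL.
- case/and3P: vt vt' => va vb _ /and3P[va' vb' _].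
  by rewrite !rho_leP //; split; lraL.
- by rewrite le_rhoP.
- by rewrite le_rhoP.
- by rewrite rho_leP //; split=> //; lraL.
- by rewrite rho_leP //; split=> //; lraL.
- by case/andP: vt vt' => va vb /andP[va' vb']; rewrite rho_leP // le_rhoP //; split; lraL.
- by case/andP: vt vt' => va vb /andP[va' vb']; rewrite rho_leP // le_rhoP //; split; lraL.
- by rewrite rho_leP //; split=> //; lraL.
- by rewrite rho_leP //; split=> //; lraL.
- by rewrite le_rhoP.
- by rewrite le_rhoP.
Qed.

(** Gathers every bound on levels and flowed levels, so that the long case analyses become linear
    arithmetic with [rho] as an opaque function. *)
Lemma valid_bounds e t : valid_summand Lam t ->
  let inside x := (- Lam < x < Lam) /\ (- Lam < rh e x < Lam) /\ (- Lam < rh (- e) x < Lam) in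
  match t with
  | SUp _ a b | SDn _ a b | SGt _ a b => inside a /\ inside b
  | SUpInf _ a | SDnInf _ a | SSE _ a | SNE _ a => inside a
  | SBox _ => True
  end.
Proof.
have B s x := rho_bounded _ _ _ _ hphi s x.
by case: t => [k a b|k a b|k a|k a|k a b|k a|k a|k] //=;
  [case/and3P=> va vb _|case/and3P=> va vb _|move=> va|move=> va|case/andP=> va vb|move=> va|move=> va];
  do ?split=> //; apply: B.
Qed.

Ltac split_hyps := repeat match goal with H : _ /\ _ |- _ => destruct H end.

(** Different types may share a translate, but then their positions in the cell tell them apart: a
    level strictly between [- Lam] and [Lam] stays so under the flow, and the endpoints stay
    fixed. *)
Lemma flow_close_label e t t' : valid_summand Lam t -> valid_summand Lam t' ->
  flow_close e (pt_summand Lam t) (pt_summand Lam t') -> label t = label t'.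
Proof.
move=> vt vt' /(flow_close_summand e t t' vt vt') [ei].
move: (valid_bounds e t vt) (valid_bounds e t' vt') ei; clear vt vt'; rewrite /preceq.
case: t => [k a b|k a b|k a|k a|k a b|k a|k a|k] /= bt;
case: t' => [k' a' b'|k' a' b'|k' a'|k' a'|k' a' b'|k' a'|k' a'|k'] /= bt' ei h1 h2;
  try (by move: ei; clear => ei; congr (_, _); lia); exfalso; move: bt bt' h1 h2; move: (rho phi phiinv) => f bt bt' h1 h2;
  split_hyps; clear ei; lraL.
Qed.

Lemma flow_close_summand_close e t t' : 0 <= e ->
  valid_summand Lam t -> valid_summand Lam t' ->
  flow_close e (pt_summand Lam t) (pt_summand Lam t') -> summand_close phiinv e t t'.
Proof.
move=> e0 vt vt' cl; have lab := flow_close_label e t t' vt vt' cl.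
have [_ h1 h2] := (flow_close_summand e t t' vt vt').1 cl; move: vt vt' lab h1 h2 {cl}.
rewrite /preceq /summand_close.
case: t => [k a b|k a b|k a|k a|k a b|k a|k a|k];
case: t' => [k' a' b'|k' a' b'|k' a'|k' a'|k' a' b'|k' a'|k' a'|k'] //= vt vt' [] // kk;
  rewrite /= ?lerD2l ?lerN2 => -[h1 h2] [h3 h4]; rewrite kk.
- case/and3P: vt vt' => va vb _ /and3P[va' vb' _]; move: h1 h2 h3 h4.
  by rewrite !le_rhoP.
- case/and3P: vt vt' => va vb _ /and3P[va' vb' _]; move: h1 h2 h3 h4.
  by rewrite !rho_leP // => *; split=> //; lra.
- by move: h2 h4; rewrite !le_rhoP // => *; split=> //; lra.
- by move: h1 h3; rewrite !rho_leP // => *; split=> //; lra.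
- case/andP: vt vt' => va vb /andP[va' vb']; move: h1 h2 h3 h4.
  by rewrite !le_rhoP // !rho_leP // => *; split=> //; lra.
- by move: h1 h3; rewrite !rho_leP // => *; split=> //; lra.
- by move: h2 h4; rewrite !le_rhoP // => *; split=> //; lra.
- by split=> //; lra.
Qed.

Lemma cell_flow_total e v : Sreg Lam v \/ Lreg Lam v \/ Areg Lam v -> exists z, cell_flow e v z.
Proof.
case=> [h|[h|h]]; eexists; [apply: Or31|apply: Or32|apply: Or33]; split=> //.
Qed.

Lemma cell_convex e w z v : cell_flow e w z -> preceq w v -> preceq v z -> bdM Lam v ->
  Sreg Lam v \/ Lreg Lam v \/ Areg Lam v.
Proof.
move=> cw [h1 h2] [h3 h4] bv.
have /andP[b1 b2] : - (2 * Lam) <= v.1 + v.2 <= 2 * Lam by rewrite -ler_norml bv.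
case: cw => -[] [] c1 c2 c3.
- move=> c4 zE; rewrite zE /= in h3 h4; left.
  have := rho_gt (- e) w.1 c1 c2; have := rho_lt e w.2 c3 c4 => r1 r2.
  by split; lraL.
- move=> zE; rewrite zE /= in h3 h4; right; left.
  have lo : - Lam <= w.2 by lraL.
  have := rho_lt e w.2 lo c3 => r1.
  by split; lraL.
- move=> zE; rewrite zE /= in h3 h4; right; right.
  have hi : w.1 <= Lam by lraL.
  have := rho_gt (- e) w.1 c2 hi => r1.
  by split; lraL.
Qed.

(** If [p] lay in no translate of the cell, the default value of [flowM] would fix it; closeness
    would then squeeze it between the summand's point and its flow, and [cell_convex] would put it
    in the cell after all. *)
Lemma bd_cell e t p : valid_summand Lam t -> bdM Lam p ->
  flow_close e (pt_summand Lam t) p ->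
  exists v z, [/\ cell_flow e v z, bdM Lam v,
    preceq (pt_base t) z & preceq v (pt_flow e t)].
Proof.
move=> vt bp cl; have ct := pt_cell_flow e t vt.
have [[k [v [z [cv pE]]]]|no] :=
  pselect (exists k v z, cell_flow e v z /\ p = Tpow Lam k v).
  rewrite pE ?pt_summandE in cl bp.
  have [kk h1 h2] := (flow_close_cell e _ _ _ _ _ _ ct cv).1 cl.
  by exists v, z; split=> //; apply/(bdM_Tpow k).
have [v pE] := Tpow_surj (pt_index t) p.
rewrite pt_summandE in cl; case: cl; rewrite (flowM_cell e _ _ _ ct).
rewrite (flowM_nocell e p); last by move=> k w z cw pE'; apply: no; exists k, w, z.
rewrite pE => /preceq_Tpow h1 /preceq_Tpow h2; exfalso; apply: no.
have bv : bdM Lam v by apply/(bdM_Tpow (pt_index t)); rewrite -pE.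
have [z cz] : exists z, cell_flow e v z; last by exists (pt_index t), v, z.
exact: cell_flow_total (cell_convex _ _ _ _ ct h1 h2 bv).
Qed.

(** A boundary point of the cell is given by one level [c]. Closeness to a pair keeps [c] within [e]
    of both ends in the rescaled coordinate, whence the length at most [2 * e]; every other type
    contradicts the bounds. *)
Lemma bd_close_nonpersistent e t p : valid_summand Lam t -> bdM Lam p ->
  flow_close e (pt_summand Lam t) p -> ~~ persistent phiinv e t.
Proof.
move=> vt bp /(bd_cell e t p vt bp)[[x y] [z [cv bv]]]; rewrite /preceq /=.
have bt := valid_bounds e t vt.
case: cv => -[[] /= c1 c2 c3].
- move=> c4 _; exfalso; have : `|x + y| < 2 * Lam by rewrite ltr_norml; lraL.
  by move: bv; rewrite /bdM /= => ->; rewrite ltxx.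
- have xE : x = - (2 * Lam) - y.
    by move: bv; rewrite /bdM /= ltr0_norm; lraL.
  rewrite xE (_ : - (2 * Lam) - (- (2 * Lam) - y) = y); last by ring.
  move=> -> /= [h1 h2] [h3 h4]; have yl : - Lam <= y by lraL.
  (* At [y = - Lam] there is no finite rescaled level; that corner is fixed by the flow and close to
     no summand. *)
  have yP : y = - Lam \/ - Lam < y < Lam.
    by move: yl; rewrite le_eqVlt => /orP[/eqP|->]; [left|right].
  case: yP h2 h1 => [->|vy].
    rewrite (rho_bot _ _ _ _ hphi) => h2 h1; move: bt h1 h2 h3 h4.
    by case: t {vt} => [k a b|k a b|k a|k a|k a b|k a|k a|k] /=; move: (rho phi phiinv) => f *;
      split_hyps; exfalso; lraL.
  case: t vt bt h3 h4 => [k a b|k a b|k a|k a|k a b|k a|k a|k] /= vt bt h3 h4 h2 h1;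
    try by exfalso; move: bt h1 h2 h3 h4; move: (rho phi phiinv) => f *; split_hyps; lraL.
  case/and3P: vt => va vb _; rewrite -leNgt.
  by move: h1 h2 h3 h4; rewrite !lerD2l !lerN2 !le_rhoP // => *; lra.
- have yE : y = 2 * Lam - x.
    by move: bv; rewrite /bdM /= gtr0_norm; lraL.
  rewrite yE (_ : 2 * Lam - (2 * Lam - x) = x); last by ring.
  move=> -> /= [h1 h2] [h3 h4]; have xl : x <= Lam by lraL.
  have xP : x = Lam \/ - Lam < x < Lam.
    by move: xl; rewrite le_eqVlt => /orP[/eqP|->]; [left|right; rewrite andbT].
  case: xP h2 h1 => [->|vx].
    rewrite (rho_top _ _ _ _ hphi) => h2 h1; move: bt h1 h2 h3 h4.
    by case: t {vt} => [k a b|k a b|k a|k a|k a b|k a|k a|k] /=; move: (rho phi phiinv) => f *;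
      split_hyps; exfalso; lraL.
  case: t vt bt h3 h4 => [k a b|k a b|k a|k a|k a b|k a|k a|k] /= vt bt h3 h4 h2 h1;
    try by exfalso; move: bt h1 h2 h3 h4; move: (rho phi phiinv) => f *; split_hyps; lraL.
  case/and3P: vt => va vb _; rewrite -leNgt.
  by move: h1 h2 h3 h4; rewrite !lerD2l !lerN2 !rho_leP // => *; lra.
Qed.

Lemma dM_close e p q : 0 < e -> flow_close e p q -> (dM Lam phi phiinv p q <= e%:E)%E.
Proof. by move=> e0 cl; apply: ereal_inf_lbound; exists e. Qed.

(** The infimum defining [dM] need not be attained, hence the passage to a larger [e']. *)
Lemma close_dM e e' p q : e < e' -> (dM Lam phi phiinv p q <= e%:E)%E ->
  exists2 d, 0 < d < e' & flow_close d p q.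
Proof.
move=> ee le_e; have : (dM Lam phi phiinv p q < e'%:E)%E.
  by apply: le_lt_trans le_e _; rewrite lte_fin.
case/ereal_inf_lt => _ [d [d0 cl] <-]; rewrite lte_fin => de.
by exists d; rewrite ?d0.
Qed.

Lemma nonpersistent_near_bd e t : 0 < e -> valid_summand Lam t ->
  ~~ persistent phiinv e t -> near_bd Lam phi phiinv e (pt_summand Lam t).
Proof.
move=> e0 vt np.
have key (v : R * R) z : cell_flow e v z -> bdM Lam v -> preceq (pt_base t) z ->
    preceq v (pt_flow e t) -> near_bd Lam phi phiinv e (pt_summand Lam t).
  move=> cv bv h1 h2; exists (Tpow Lam (pt_index t) v); split; first exact/bdM_Tpow.
  apply: dM_close => //; rewrite pt_summandE.
  by apply/(flow_close_cell e _ _ _ _ _ _ (pt_cell_flow e t vt) cv).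
case: t vt np key => [k a b|k a b|k a|k a|k a b|k a|k a|k] //=; rewrite -leNgt.
(* The midpoint is taken in the rescaled coordinate: a pair of length at most [2 * e] there has both
   ends within [e] of it. *)
- move=> /and3P[va vb ab] np key; pose c := phi ((u a + u b) / 2)%:E.
  have vc : - Lam < c < Lam by exact: phi_fin_bounded hphi _.
  have uc : u c = (u a + u b) / 2 by exact: rescale_phi hphi _.
  have uab : u a < u b by rewrite (rescale_lt _ _ _ _ hphi).
  apply: (key (- (2 * Lam) - c, c) (- (2 * Lam) - rh e c, rh e c)).
  + apply: Or32; split; first by split=> /=; lraL.
    by rewrite /= (_ : - (2 * Lam) - (- (2 * Lam) - c) = c) //; ring.
  + by rewrite /bdM /= ltr0_norm; lraL.
  + by rewrite /preceq /= lerD2l lerN2 !le_rhoP // uc; split; lra.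
  + by rewrite /preceq /= lerD2l lerN2 !le_rhoP // uc; split; lra.
- move=> /and3P[va vb ab] np key; pose c := phi ((u a + u b) / 2)%:E.
  have vc : - Lam < c < Lam by exact: phi_fin_bounded hphi _.
  have uc : u c = (u a + u b) / 2 by exact: rescale_phi hphi _.
  have uab : u b < u a by rewrite (rescale_lt _ _ _ _ hphi).
  apply: (key (c, 2 * Lam - c) (rh (- e) c, 2 * Lam - rh (- e) c)).
  + apply: Or33; split; first by split=> /=; lraL.
    by rewrite /= (_ : 2 * Lam - (2 * Lam - c) = c) //; ring.
  + by rewrite /bdM /= gtr0_norm; lraL.
  + by rewrite /preceq /= lerD2l lerN2 !rho_leP // uc; split; lra.
  + by rewrite /preceq /= lerD2l lerN2 !rho_leP // uc; split; lra.
Qed.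

End Strip.

(** * Comparison of the distances *)

Lemma summand_close_le (R : realType) (phiinv : R -> \bar R) (d e : R) t t' : d <= e ->
  summand_close phiinv d t t' -> summand_close phiinv e t t'.
Proof. by move=> de [h1 h2 h3 h4 h5]; split=> //; lra. Qed.

Lemma persistent_le (R : realType) (phiinv : R -> \bar R) (d e : R) t : d <= e ->
  ~~ persistent phiinv d t -> ~~ persistent phiinv e t.
Proof.
move=> de; apply: contra; case: t => //= *; lra.
Qed.

(** Converts an injection between ordinals into the two inverse partial maps on [nat] that
    [summand_matching] takes, with [None] outside the ranges. *)
Lemma partial_matching_nat m n (f : 'I_m -> option 'I_n) :
  (forall i i' j, f i = Some j -> f i' = Some j -> i = i') ->
  exists h h' : nat -> option nat,
    [/\ forall i j, h i = Some j <-> h' j = Some i,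
        forall i j, h i = Some j -> exists (o : 'I_m) (o' : 'I_n),
          [/\ i = o, j = o' & f o = Some o'],
        forall i : 'I_m, h i = None -> f i = None
      & forall j : 'I_n, h' j = None -> forall i, f i <> Some j].
Proof.
move=> inj.
pose rel (i j : nat) := exists (o : 'I_m) (o' : 'I_n), [/\ i = o, j = o' & f o = Some o'].
pose pick (P : nat -> Prop) : option nat :=
  if pselect (exists x, P x) is left e then Some (projT1 (cid e)) else None.
have pickP (P : nat -> Prop) x : (forall y y', P y -> P y' -> y = y') ->
    pick P = Some x <-> P x.
  move=> uP; rewrite /pick; case: pselect => [e|no]; last first.
    by split=> // Px; case: no; exists x.
  by case: cid => y Py /=; split=> [[<-]//|Px]; congr Some; apply: uP.
have u1 i j j' : rel i j -> rel i j' -> j = j'.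
  move=> [o [p [-> -> fo]]] [o' [p' [oo -> fo']]].
  by move: fo; rewrite (val_inj oo) fo' => -[->].
have u2 j i i' : rel i j -> rel i' j -> i = i'.
  move=> [o [p [-> -> fo]]] [o' [p' [-> pp fo']]].
  by rewrite -(val_inj pp) in fo'; rewrite (inj _ _ _ fo fo').
exists (fun i => pick (rel i)), (fun j => pick (fun i => rel i j)); split.
- by move=> i j; rewrite !pickP //; [exact: u2|exact: u1].
- by move=> i j /pickP; apply; apply: u1.
- move=> i hi; case fi : (f i) => [j|//].
  have : pick (rel i) = Some (val j) by apply/pickP; [exact: u1|exists i, j].
  by rewrite hi.
- move=> j hj i fi.
  have : pick (fun i => rel i j) = Some (val i) by apply/pickP; [exact: u2|exists i, j].
  by rewrite hj.
Qed.

Section Comparison.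
Variables (K : fieldType) (R : realType) (Lam : R) (phi : \bar R -> R) (phiinv : R -> \bar R).
Hypothesis Lam_gt0 : 0 < Lam.
Hypothesis hphi : incr_homeo Lam phi phiinv.
Variables (s s' : seq (summand R)).
Hypotheses (vs : all (valid_summand Lam) s) (vs' : all (valid_summand Lam) s').
Local Notation at_ s := (nth (SBox R 0) s).
Local Notation pts := (map (pt_summand Lam)).

Lemma matching_of_interleaved e : 0 < e ->
  interleaved phiinv e (std_cospan K s) (std_cospan K s') ->
  matching Lam phi phiinv e (pts s) (pts s').
Proof.
move=> e0 il.
have [h [h1 h2 h3 h4]] :=
  interleaved_matching K R Lam phi phiinv Lam_gt0 hphi e s s' (ltW e0) vs vs' il.
have v1 (i : 'I_(size s)) : valid_summand Lam (at_ s i) by apply: (all_nthP _ vs).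
have v2 (i : 'I_(size s')) : valid_summand Lam (at_ s' i) by apply: (all_nthP _ vs').
have ss : size (pts s) = size s by rewrite size_map.
have ss' : size s' = size (pts s') by rewrite size_map.
have hE i j : omap (cast_ord ss') (h (cast_ord ss i)) = Some j ->
    h (cast_ord ss i) = Some (cast_ord (esym ss') j).
  by case: (h _) => //= o [<-]; rewrite cast_ordK.
exists (fun i => omap (cast_ord ss') (h (cast_ord ss i))); split.
- by move=> i i' j /hE fi /hE fi'; apply: (@cast_ord_inj _ _ ss); apply: h1 fi fi'.
- move=> i j /hE /h2 cl.
  have := v1 (cast_ord ss i); have := v2 (cast_ord (esym ss') j) => /= w2 w1.
  have li : (i < size s)%N by have := ltn_ord i; rewrite [X in (_ < X)%N]size_map.
  have lj : (j < size s')%N by have := ltn_ord j; rewrite [X in (_ < X)%N]size_map.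
  rewrite !(nth_map (SBox R 0)) //; apply: dM_close => //.
  exact: (summand_close_flow R Lam phi phiinv Lam_gt0 hphi).
- move=> i; case hi : (h (cast_ord ss i)) => [//|] _.
  have li : (i < size s)%N by have := ltn_ord i; rewrite [X in (_ < X)%N]size_map.
  rewrite (nth_map (SBox R 0)) //.
  apply: (nonpersistent_near_bd R Lam phi phiinv Lam_gt0 hphi) => //.
    exact: (v1 (cast_ord ss i)).
  exact: h3 hi.
- move=> j nj.
  have lj : (j < size s')%N by have := ltn_ord j; rewrite [X in (_ < X)%N]size_map.
  rewrite (nth_map (SBox R 0)) //.
  apply: (nonpersistent_near_bd R Lam phi phiinv Lam_gt0 hphi) => //.
    exact: (v2 (cast_ord (esym ss') j)).
  apply: (h4 (cast_ord (esym ss') j)) => i hi.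
  apply: (nj (cast_ord (esym ss) i)).
  by rewrite cast_ordKV hi /= cast_ordKV.
Qed.

Lemma interleaved_of_matching e e' : 0 <= e -> e < e' ->
  matching Lam phi phiinv e (pts s) (pts s') ->
  interleaved phiinv e' (std_cospan K s) (std_cospan K s').
Proof.
move=> e0 ee [f [f1 f2 f3 f4]]; have e0' : 0 <= e' by lra.
have [h [h' [m1 m2 m3 m4]]] := partial_matching_nat _ _ f f1.
apply: (matching_interleaved K R Lam phi phiinv Lam_gt0 hphi e' s s' h h') => //.
have val1 i : (i < size s)%N -> valid_summand Lam (at_ s i) by apply: (all_nthP _ vs).
have val2 i : (i < size s')%N -> valid_summand Lam (at_ s' i) by apply: (all_nthP _ vs').
have bd t : valid_summand Lam t -> near_bd Lam phi phiinv e (pt_summand Lam t) ->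
    ~~ persistent phiinv e' t.
  move=> vt [b [bb db]]; have [d /andP[d0 de] cl] := close_dM _ _ _ _ _ _ _ _ ee db.
  apply: (persistent_le _ _ _ _ _ (ltW de)).
  exact: (bd_close_nonpersistent R Lam phi phiinv Lam_gt0 hphi) cl.
split=> //.
- move=> i j /m2[o [o' [-> -> fo]]].
  have li : (o < size s)%N by have := ltn_ord o; rewrite [X in (_ < X)%N]size_map.
  have lj : (o' < size s')%N by have := ltn_ord o'; rewrite [X in (_ < X)%N]size_map.
  split=> //; have := f2 _ _ fo; rewrite !(nth_map (SBox R 0)) // => db.
  have [d /andP[d0 de] cl] := close_dM _ _ _ _ _ _ _ _ ee db.
  apply: (summand_close_le _ _ _ _ _ _ (ltW de)).
  exact: (flow_close_summand_close R Lam phi phiinv Lam_gt0 hphi _ _ _ (ltW d0) (val1 _ li) (val2 _ lj)).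
- move=> i li hi; have li' : (i < size (pts s))%N by rewrite size_map.
  have := f3 _ (m3 (Ordinal li') hi); rewrite (nth_map (SBox R 0)) //=.
  by apply: bd; apply: val1.
- move=> j lj hj; have lj' : (j < size (pts s'))%N by rewrite size_map.
  have := f4 _ (m4 (Ordinal lj') hj); rewrite (nth_map (SBox R 0)) //=.
  by apply: bd; apply: val2.
Qed.

End Comparison.

Theorem theorem1p6 (K : fieldType) (R : realType) (Lam : R)
    (phi : \bar R -> R) (phiinv : R -> \bar R) :
  0 < Lam -> incr_homeo Lam phi phiinv ->
  forall C X : cospan K R,
    is_cospan C -> is_cospan X -> bounded Lam C -> bounded Lam X ->
    finite_type C -> finite_type X ->
    forall PX PC : seq (R * R),
      is_diagram Lam X PX -> is_diagram Lam C PC ->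
      dB Lam phi phiinv PX PC = dint phi phiinv X C.
Proof.
move=> L0 hphi C X cC cX bC bX _ _ PX PC [s [vs iX ->]] [s' [vs' iC ->]].
have tC := is_cospan_tame _ _ _ _ cC bC; have tX := is_cospan_tame _ _ _ _ cX bX.
have tS := std_tame K R Lam L0 s vs; have tS' := std_tame K R Lam L0 s' vs'.
have {}iX := (hco_isoP _ _ _ _ _ hphi _ _ tX tS).1 iX.
have {}iC := (hco_isoP _ _ _ _ _ hphi _ _ tC tS').1 iC.
have transfer e : 0 <= e -> interleaving phi phiinv e C X <->
    interleaved phiinv e (std_cospan K s) (std_cospan K s').
  move=> e0; rewrite (interleavingP _ _ _ _ _ hphi) //; split=> il.
    apply: (interleaved_transport _ _ _ _ _ hphi _ _ _ _ _ e0 tX tC tS tS') => //.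
    exact: interleaved_sym.
  apply: interleaved_sym.
  by apply: (interleaved_transport _ _ _ _ _ hphi _ _ _ _ _ e0 tS tS' tX tC) => //;
    apply: interleaved_sym.
apply/eqP; rewrite eq_le; apply/andP; split.
  apply/ereal_infP => _ [e [e0 il] <-]; apply: ereal_inf_lbound; exists e => //.
  split; first exact: ltW.
  by apply: (matching_of_interleaved K) => //; apply/transfer; rewrite ?ltW.
(* This direction loses an arbitrarily small [d]: the distances in a matching are infima, and [dB]
   admits [e = 0] while [dint] requires a positive shift. *)
apply/ereal_infP => _ [e [e0 mt] <-]; apply/lee_addgt0Pr => d d0.
rewrite -EFinD; apply: ereal_inf_lbound; exists (e + d) => //.
have ed : e < e + d by rewrite ltrDl.
split; first by lra.
apply/transfer; first by lra.
exact: (interleaved_of_matching K R Lam phi phiinv L0 hphi s s' vs vs' e).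
Qed.
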